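(* Let $\Gamma$ be an analytic Jordan curve (without cusps) bounding the simply connected domain $\Omega$, and let $\Pi=H+CHC$ acting on $\Lambda_\sigma(\Gamma)$. Then $\Pi$ admits a fixed point $F\in\Lambda_\sigma(\Gamma)$ that is not identically zero if and only if there exist non-constant $f\in A(\Gamma)$ and $g\in A'(\Gamma)$ with $f=\bar g$ on $\Gamma$. Moreover, if such $f$ and $g$ exist, then $\Pi f=f$ and $\Pi g=g$.
   Context: Fix $0<\sigma<1$. $\Omega$ is the interior domain of $\Gamma$ and $\Omega':=\widehat{\mathbb C}\setminus\overline\Omega$ the exterior domain (containing $\infty$). $\Lambda_\sigma(\Gamma)$ is the space of complex-valued Hölder continuous functions of order $\sigma$ on $\Gamma$. $A(\Gamma)$ is the set of restrictions to $\Gamma$ of functions that are $\sigma$-Hölder continuous on $\overline\Omega$ and holomorphic in $\Omega$; $A'(\Gamma)$ is the set of restrictions to $\Gamma$ of functions that are $\sigma$-Hölder continuous on $\overline{\Omega'}$, holomorphic in $\Omega'$, and vanish at $\infty$. The Hilbert operator $H:\Lambda_\sigma(\Gamma)\to\Lambda_\sigma(\Gamma)$ sends $F$ to the boundary values on $\Gamma$, taken from inside $\Omega$, of the Cauchy integral $f_i(z)=\frac{1}{2\pi i}\int_\Gamma \frac{F(\zeta)}{\zeta-z}\,d\zeta$, $z\in\Omega$; $H$ is a continuous idempotent with range $A(\Gamma)$ and kernel $A'(\Gamma)$. $C$ denotes complex conjugation, $CF=\overline F$. ($\Pi F$ equals the boundary values from $\Omega$ of the double layer potential $\frac1\pi\int_\Gamma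 F(\zeta)\,\partial_{N_\zeta}\log|z-\zeta|\,ds_\zeta$.) *)

(* Defs.v *)
From Stdlib Require Import Reals ClassicalEpsilon.
From Coquelicot Require Import Coquelicot.
Open Scope R_scope.
Open Scope C_scope.

(** The closed curve Gamma is given by a parametrization gam : R -> C of period 1. *)

Definition real_analytic (gam : R -> C) : Prop :=
  forall t0 : R, exists (a : nat -> C) (r : R), 0 < r /\
    forall t : R, (Rabs (t - t0) < r)%R ->
      @is_pseries R_AbsRing C_R_NormedModule a (t - t0)%R (gam t).

Definition analytic_jordan (gam : R -> C) : Prop :=
  (forall t, gam (t + 1)%R = gam t) /\
  (forall s t, (0 <= s < 1)%R -> (0 <= t < 1)%R -> gam s = gam t -> s = t) /\
  real_analytic gam /\
  (forall t, exists l : C, @is_derive R_AbsRing C_R_NormedModule gam t l /\ l <> 0).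

Definition onG (gam : R -> C) (z : C) : Prop := exists t : R, gam t = z.

(** the derivative gam'(t) (chosen; unique when it exists) *)
Definition dgam (gam : R -> C) (t : R) : C :=
  epsilon (inhabits (RtoC 0))
    (fun l => @is_derive R_AbsRing C_R_NormedModule gam t l).

Definition cint (gam : R -> C) (h : C -> C) : C :=
  @RInt C_R_CompleteNormedModule (fun t => h (gam t) * dgam gam t) 0%R 1%R.

Definition wind (gam : R -> C) (z : C) : C :=
  / (2 * RtoC PI * Ci) * cint gam (fun zeta => / (zeta - z)).

(** exterior domain Omega' (finite part): the unbounded component of C \ Gamma,
    i.e. points that can be joined, avoiding Gamma, to points of arbitrarily
    large modulus by a continuous path. *)
Definition extD (gam : R -> C) (z : C) : Prop :=
  ~ onG gam z /\
  forall M : R, exists p : R -> C,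
    (forall s, 0 <= s <= 1 -> @continuous R_UniformSpace C_UniformSpace p s) /\
    p 0 = z /\ M < Cmod (p 1) /\
    (forall s, 0 <= s <= 1 -> ~ onG gam (p s)).

Definition intD (gam : R -> C) (z : C) : Prop := ~ onG gam z /\ ~ extD gam z.

Definition pos_oriented (gam : R -> C) : Prop :=
  forall z, intD gam z -> wind gam z = 1.

Definition clos (S : C -> Prop) (z : C) : Prop :=
  forall eps : R, 0 < eps -> exists w, S w /\ Cmod (w - z) < eps.

Definition holder (sigma : R) (S : C -> Prop) (f : C -> C) : Prop :=
  exists K : R, forall z w, S z -> S w -> z <> w ->
    Cmod (f z - f w) <= K * Rpower (Cmod (z - w)) sigma.

Definition holo (U : C -> Prop) (f : C -> C) : Prop :=
  forall z, U z -> @ex_derive C_AbsRing C_NormedModule f z.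

(** Functions on Gamma are represented by functions C -> C, only their
    values on Gamma matter. *)
Definition Lambda (sigma : R) (gam : R -> C) (F : C -> C) : Prop :=
  holder sigma (onG gam) F.

Definition inA (sigma : R) (gam : R -> C) (F : C -> C) : Prop :=
  exists f : C -> C,
    holder sigma (clos (intD gam)) f /\ holo (intD gam) f /\
    forall z, onG gam z -> f z = F z.

Definition inA' (sigma : R) (gam : R -> C) (G : C -> C) : Prop :=
  exists g : C -> C,
    holder sigma (clos (extD gam)) g /\ holo (extD gam) g /\
    (forall eps : R, 0 < eps -> exists M : R, forall z,
        extD gam z -> M < Cmod z -> Cmod (g z) < eps) /\
    forall z, onG gam z -> g z = G z.

Definition cauchy (gam : R -> C) (F : C -> C) (z : C) : C :=
  / (2 * RtoC PI * Ci) * cint gam (fun zeta => F zeta / (zeta - z)).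

Definition Hop (gam : R -> C) (F : C -> C) (zeta : C) : C :=
  epsilon (inhabits (RtoC 0))
    (fun l => filterlim (cauchy gam F) (within (intD gam) (locally zeta)) (locally l)).

Definition Cop (F : C -> C) : C -> C := fun z => Cconj (F z).

Definition Piop (gam : R -> C) (F : C -> C) : C -> C :=
  fun z => Hop gam F z + Cop (Hop gam (Cop F)) z.

Definition nonconst (gam : R -> C) (F : C -> C) : Prop :=
  exists z w, onG gam z /\ onG gam w /\ F z <> F w.

(* Main.v *)
(** Write E F for the Cauchy integral of F, and z = gam t + i tau gam' t for points near the
    loop. The winding number is constant along paths avoiding the loop, hence 0 outside and, by
    orientation, 1 inside; since it jumps by one across the loop, small tau > 0 lies inside and
    small tau < 0 outside. For z, w off the loop and any constant A,

      E F z - E F w - A (wind z - wind w)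
        = 1/(2 pi i) int (F - A) (z - w) / ((zeta - z) (zeta - w)) dzeta.

    Taking for A the value of F at the foot of the normal through z, this gives both the Hölder
    continuity of E F on either side (push two points at distance delta off the loop by delta)
    and the jump relation: E F from inside minus E F from outside is F. Consequently
    H F belongs to A and F - H F to A'.

    Conversely, if F = f + g on the loop with f in A and g in A', then E F - f inside and E F + g
    outside agree on the loop, so they form a continuous function on the plane, holomorphic off
    the loop and vanishing at infinity. The loop is covered by O(n) cells of an n by n grid, which
    makes it removable; the function is therefore zero by Liouville's theorem, and H F = f. In
    particular H f = f on A and H g = 0 on A'.

    If Pi F = F, then f = H (conj F) and g = F - H F satisfy f = conj g. If f is constant, then
    so is g, and g = 0 because the only constant in A' is 0; hence F is in A, conj F in A', and
    the pair F, conj F works. *)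

From Stdlib Require Import Reals Lra Lia ZArith Classical ClassicalEpsilon.
From Coquelicot Require Import Coquelicot.
(* Imported last: [cauchy] is the Cauchy integral, not Coquelicot's Cauchy filters. *)
Require Import Defs.
Open Scope R_scope.
Open Scope C_scope.

(** * The complex modulus *)

Lemma Cmod_minus_sym (x y : C) : Cmod (x - y) = Cmod (y - x).
Proof. rewrite <- Cmod_opp. f_equal. ring. Qed.

Lemma Cmod_minus_diag (x : C) : Cmod (x - x) = 0%R.
Proof. replace (x - x) with (RtoC 0) by ring. apply Cmod_0. Qed.

Lemma Cmod_minus_triangle (x y z : C) : Cmod (x - z) <= Cmod (x - y) + Cmod (y - z).
Proof. replace (x - z) with ((x - y) + (y - z)) by ring. apply Cmod_triangle. Qed.

Lemma Cmod_minus_le (x y : C) : Cmod (x - y) <= Cmod x + Cmod y.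
Proof. unfold Cminus. rewrite <- (Cmod_opp y). apply Cmod_triangle. Qed.

Lemma Cmod_triangle_inv (x y : C) : Cmod x - Cmod y <= Cmod (x - y).
Proof.
  pose proof (Cmod_triangle (x - y) y) as T. replace (x - y + y) with x in T by ring. lra.
Qed.

Lemma Cmod_minus_gt_0 (x y : C) : x <> y -> 0 < Cmod (x - y).
Proof. intros N. now apply Cmod_gt_0, Cminus_eq_contra. Qed.

Lemma im_le_Cmod (z : C) : Rabs (Im z) <= Cmod z.
Proof. exact (Rle_trans _ _ _ (Rmax_r _ _) (Rmax_Cmod z)). Qed.

Lemma Cmod_le_re_im (z : C) : Cmod z <= Rabs (Re z) + Rabs (Im z).
Proof.
  pose proof (Cmod2_alt z) as E. rewrite <- (pow2_abs (Re z)), <- (pow2_abs (Im z)) in E.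
  pose proof (Rabs_pos (Re z)). pose proof (Rabs_pos (Im z)). pose proof (Cmod_ge_0 z). nra.
Qed.

Lemma Cmod_div_le (x y : C) (M d : R) :
  0 < d -> d <= Cmod y -> Cmod x <= M -> Cmod (x / y) <= M / d.
Proof.
  intros Hd Hy Hx. rewrite Cmod_div by (apply Cmod_gt_0; lra).
  apply Rmult_le_compat; auto using Cmod_ge_0, Rinv_le_contravar.
  left. apply Rinv_0_lt_compat. lra.
Qed.

Lemma Ceq_of_Cmod_le (x y : C) : (forall eps : R, 0 < eps -> Cmod (x - y) <= eps) -> x = y.
Proof.
  intros H. apply NNPP. intros N. pose proof (Cmod_minus_gt_0 _ _ N).
  specialize (H (Cmod (x - y) / 2)%R). lra.
Qed.

(** * Continuity of complex valued functions *)

Lemma locally_Cmod (z : C) (P : C -> Prop) :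
  @locally C_UniformSpace z P <-> exists d : R, 0 < d /\ forall w, Cmod (w - z) < d -> P w.
Proof.
  rewrite locally_C. split.
  - intros [d H]. exists d. split; [apply cond_pos|exact H].
  - intros (d & Hd & H). exists (mkposreal d Hd). exact H.
Qed.

Lemma filterlim_Cmod {T : Type} (F : (T -> Prop) -> Prop) {FF : Filter F} (f : T -> C) (l : C) :
  filterlim f F (@locally C_UniformSpace l) <->
  forall eps : R, 0 < eps -> F (fun x => Cmod (f x - l) < eps).
Proof.
  split.
  - intros H eps He. apply (H (fun w => Cmod (w - l) < eps)).
    apply locally_Cmod. exists eps; auto.
  - intros H P HP. apply locally_Cmod in HP as (d & Hd & HP).
    exact (filter_imp _ _ (fun x => HP (f x)) (H d Hd)).
Qed.

Lemma filterlim_within_Cmod (f : C -> C) (S : C -> Prop) (z l : C) :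
  filterlim f (within S (locally z)) (locally l) <->
  forall eps : R, 0 < eps -> exists d, 0 < d /\
    forall w, S w -> Cmod (w - z) < d -> Cmod (f w - l) < eps.
Proof.
  rewrite (filterlim_Cmod (within S (locally z))). unfold within.
  setoid_rewrite locally_Cmod. firstorder.
Qed.

Lemma continuous_RC_iff (f : R -> C) (t : R) :
  @continuous R_UniformSpace C_UniformSpace f t <->
  forall eps : R, 0 < eps -> exists d : R, 0 < d /\
    forall s, Rabs (s - t) < d -> Cmod (f s - f t) < eps.
Proof.
  unfold continuous. rewrite (filterlim_Cmod (locally t)). split; intros H eps He.
  - destruct (H eps He) as [d Hd]. exists d. split; [apply cond_pos|exact Hd].
  - destruct (H eps He) as (d & Hd & Hs). now exists (mkposreal d Hd).
Qed.

Lemma continuous_CC_iff (f : C -> C) (z : C) :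
  @continuous C_UniformSpace C_UniformSpace f z <->
  forall eps : R, 0 < eps -> exists d : R, 0 < d /\
    forall w, Cmod (w - z) < d -> Cmod (f w - f z) < eps.
Proof.
  unfold continuous. rewrite (filterlim_Cmod (locally z)). now setoid_rewrite locally_Cmod.
Qed.

Section ContinuousOperations.
Context {U : UniformSpace}.
Implicit Types (f g : U -> C) (x : U).
Notation continuous_C := (@continuous U C_UniformSpace).

Lemma continuous_re f x : continuous_C f x -> continuous (fun y => Re (f y)) x.
Proof.
  intros H. apply (continuous_comp f Re); [exact H|]. destruct (f x). apply continuous_fst.
Qed.

Lemma continuous_im f x : continuous_C f x -> continuous (fun y => Im (f y)) x.
Proof.
  intros H. apply (continuous_comp f Im); [exact H|]. destruct (f x). apply continuous_snd.
Qed.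

Lemma continuous_pair (u v : U -> R) x :
  continuous u x -> continuous v x -> continuous_C (fun y => (u y, v y)) x.
Proof.
  intros Hu Hv. apply (continuous_comp_2 u v (fun a b => (a, b) : C)); auto.
  apply (continuous_ext (fun p => p)); [now intros []|apply continuous_id].
Qed.

Lemma continuous_RtoC (u : U -> R) x : continuous u x -> continuous_C (fun y => RtoC (u y)) x.
Proof. intros Hu. apply continuous_pair; [exact Hu|apply continuous_const]. Qed.

Lemma continuous_Cplus f g x :
  continuous_C f x -> continuous_C g x -> continuous_C (fun y => f y + g y) x.
Proof. exact (continuous_plus (V := C_R_NormedModule) f g x). Qed.

Lemma continuous_Copp f x : continuous_C f x -> continuous_C (fun y => - f y) x.
Proof. exact (continuous_opp (V := C_R_NormedModule) f x). Qed.

Lemma continuous_Cminus f g x :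
  continuous_C f x -> continuous_C g x -> continuous_C (fun y => f y - g y) x.
Proof. exact (continuous_minus (V := C_R_NormedModule) f g x). Qed.

Lemma continuous_Cmult f g x :
  continuous_C f x -> continuous_C g x -> continuous_C (fun y => f y * g y) x.
Proof.
  intros Hf Hg. apply (continuous_scal (K := C_AbsRing) (V := C_NormedModule)); [|exact Hg].
  intros P HP. apply Hf. now apply locally_C.
Qed.

Lemma continuous_Cinv f x : continuous_C f x -> f x <> 0 -> continuous_C (fun y => / f y) x.
Proof.
  intros Hf N.
  pose proof (continuous_re f x Hf) as Hre. pose proof (continuous_im f x Hf) as Him.
  assert (Hn : continuous (fun y => / (Re (f y) ^ 2 + Im (f y) ^ 2))%R x).
  { apply (continuous_comp _ Rinv); [|apply continuous_Rinv].
    - apply (continuous_plus (V := R_NormedModule));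
        apply (continuous_comp _ (fun a => a ^ 2)%R); auto;
        apply (ex_derive_continuous (V := R_NormedModule)); auto_derive; auto.
    - rewrite <- Cmod2_alt. apply pow_nonzero, Rgt_not_eq, Cmod_gt_0, N. }
  apply (continuous_pair (fun y => Re (f y) / (Re (f y) ^ 2 + Im (f y) ^ 2))%R
    (fun y => - Im (f y) / (Re (f y) ^ 2 + Im (f y) ^ 2))%R);
    apply (continuous_mult (K := R_AbsRing)); auto.
  now apply (continuous_opp (V := R_NormedModule)).
Qed.

Lemma continuous_Cdiv f g x :
  continuous_C f x -> continuous_C g x -> g x <> 0 -> continuous_C (fun y => f y / g y) x.
Proof. intros Hf Hg N. apply continuous_Cmult; [|apply continuous_Cinv]; auto. Qed.

Lemma continuous_Cmod f x : continuous_C f x -> continuous (fun y => Cmod (f y)) x.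
Proof.
  intros Hf. apply (filterlim_locally (F := locally x)). intros eps.
  refine (filter_imp _ _ _ (proj1 (filterlim_Cmod (locally x) f (f x)) Hf eps (cond_pos eps))).
  intros y Hy. change (Rabs (Cmod (f y) - Cmod (f x)) < eps).
  pose proof (Cmod_triangle_inv (f y) (f x)). pose proof (Cmod_triangle_inv (f x) (f y)) as T.
  rewrite Cmod_minus_sym in T. apply Rabs_def1; lra.
Qed.

End ContinuousOperations.

Definition continuous_map {U : UniformSpace} (f : U -> C) : Prop :=
  forall x, @continuous U C_UniformSpace f x.

(* The head symbol selects the lemma: a plain [apply] would unfold complex arithmetic
   down to pairs of reals while unifying. *)
Ltac continuity_C := repeat
  lazymatch goal with
  | |- continuous_map _ => intro
  | |- @continuous R_UniformSpace R_UniformSpace _ _ =>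
      apply (ex_derive_continuous (V := R_NormedModule)); auto_derive
  | |- continuous (fun _ => ?c) _ => apply continuous_const
  | |- continuous (fun x => x) _ => apply continuous_id
  | |- continuous (fun x => RtoC (@?u x)) _ => apply (continuous_RtoC u)
  | |- continuous (fun x => (@?u x, @?v x)) _ => apply (continuous_pair u v)
  | |- continuous (fun x => @?f x + @?g x) _ => apply (continuous_Cplus f g)
  | |- continuous (fun x => @?f x - @?g x) _ => apply (continuous_Cminus f g)
  | |- continuous (fun x => @?f x * @?g x) _ => apply (continuous_Cmult f g)
  | |- continuous (fun x => @?f x / @?g x) _ => apply (continuous_Cdiv f g)
  | |- continuous (fun x => / @?f x) _ => apply (continuous_Cinv f)
  | |- continuous (fun x => - @?f x) _ => apply (continuous_Copp f)
  | H : continuous_map ?f |- continuous (fun x => ?f (@?g x)) _ =>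
      apply (continuous_comp g f); [|apply H]
  | H : continuous_map ?f |- continuous ?f _ => apply H
  end; cbv beta; auto.

(** * Integrals of complex valued functions *)

Definition CInt (f : R -> C) (a b : R) : C := @RInt C_R_CompleteNormedModule f a b.
Notation is_CInt := (@is_RInt C_R_NormedModule).

Lemma CInt_correct (f : R -> C) (a b : R) : continuous_map f -> is_CInt f a b (CInt f a b).
Proof.
  intros Hf. apply (RInt_correct (V := C_R_CompleteNormedModule)).
  apply (ex_RInt_continuous (V := C_R_CompleteNormedModule)). intros t _. apply Hf.
Qed.

Lemma CInt_unique (f : R -> C) (a b : R) (l : C) : is_CInt f a b l -> CInt f a b = l.
Proof. apply (is_RInt_unique (V := C_R_CompleteNormedModule)). Qed.

Lemma CInt_ext (f g : R -> C) (a b : R) : (forall t, f t = g t) -> CInt f a b = CInt g a b.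
Proof. intros E. now apply (RInt_ext (V := C_R_CompleteNormedModule)). Qed.

Lemma is_CInt_pair (u v : R -> R) (a b k l : R) :
  is_RInt u a b k -> is_RInt v a b l -> is_CInt (fun t => (u t, v t)) a b (k, l).
Proof.
  intros Hu Hv.
  exact (is_RInt_fct_extend_pair (U := R_NormedModule) (V := R_NormedModule)
    (fun t => (u t, v t)) a b k l Hu Hv).
Qed.

Lemma CInt_minus (f g : R -> C) (a b : R) : continuous_map f -> continuous_map g ->
  CInt (fun t => f t - g t) a b = CInt f a b - CInt g a b.
Proof.
  intros Hf Hg. apply CInt_unique.
  apply (is_RInt_minus (V := C_R_NormedModule)); now apply CInt_correct.
Qed.

Lemma CInt_scal (c : C) (f : R -> C) (a b : R) : continuous_map f ->
  CInt (fun t => c * f t) a b = c * CInt f a b.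
Proof.
  intros Hf. apply CInt_unique. pose proof (CInt_correct f a b Hf) as Hl.
  pose proof (is_RInt_fct_extend_fst (U := R_NormedModule) (V := R_NormedModule) _ _ _ _ Hl) as Hre.
  pose proof (is_RInt_fct_extend_snd (U := R_NormedModule) (V := R_NormedModule) _ _ _ _ Hl) as Him.
  apply (is_CInt_pair (fun t => Re c * Re (f t) - Im c * Im (f t))%R
    (fun t => Re c * Im (f t) + Im c * Re (f t))%R).
  - apply (is_RInt_minus (V := R_NormedModule)); now apply (is_RInt_scal (V := R_NormedModule)).
  - apply (is_RInt_plus (V := R_NormedModule)); now apply (is_RInt_scal (V := R_NormedModule)).
Qed.

Lemma CInt_const (c : C) (a b : R) : CInt (fun _ => c) a b = RtoC (b - a) * c.
Proof.
  apply CInt_unique. rewrite <- scal_R_Cmult. apply (is_RInt_const (V := C_R_NormedModule)).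
Qed.

Lemma CInt_RtoC (u : R -> R) (a b l : R) : is_RInt u a b l ->
  CInt (fun t => RtoC (u t)) a b = RtoC l.
Proof.
  intros Hu. apply CInt_unique, is_CInt_pair; [exact Hu|].
  evar_last; [apply (is_RInt_const (V := R_NormedModule))|apply Rmult_0_r].
Qed.

Lemma CInt_Chasles (f : R -> C) (a b c : R) : continuous_map f ->
  CInt f a b + CInt f b c = CInt f a c.
Proof.
  intros Hf. apply (RInt_Chasles (V := C_R_CompleteNormedModule));
    eexists; now apply CInt_correct.
Qed.

Lemma CInt_shift (f : R -> C) (v a b : R) : continuous_map f ->
  CInt (fun t => f (v + t)%R) a b = CInt f (v + a) (v + b).
Proof.
  intros Hf. apply CInt_unique.
  apply (is_RInt_ext (V := C_R_NormedModule) (fun t => scal 1%R (f (1 * t + v)%R))).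
  - intros t _. rewrite (scal_one (V := C_R_ModuleSpace)). f_equal. ring.
  - apply (is_RInt_comp_lin (V := C_R_NormedModule)).
    rewrite !Rmult_1_l, !(Rplus_comm _ v). now apply CInt_correct.
Qed.

Lemma Cmod_CInt_le (f : R -> C) (u : R -> R) (a b l : R) : a <= b -> continuous_map f ->
  (forall t, a <= t <= b -> Cmod (f t) <= u t) -> is_RInt u a b l -> Cmod (CInt f a b) <= l.
Proof.
  intros Hab Hf Hu Hl. rewrite Cmod_norm.
  apply (norm_RInt_le (V := C_R_NormedModule) f u a b); auto.
  - intros t Ht. rewrite <- Cmod_norm. now apply Hu.
  - now apply CInt_correct.
Qed.

Lemma Cmod_CInt_le_const (f : R -> C) (M a b : R) : continuous_map f ->
  (forall t, Rmin a b <= t <= Rmax a b -> Cmod (f t) <= M) ->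
  Cmod (CInt f a b) <= Rabs (b - a) * M.
Proof.
  intros Hf HM. rewrite Cmod_norm. apply (norm_RInt_le_const_abs (V := C_R_NormedModule) f a b).
  - intros t Ht. rewrite <- Cmod_norm. now apply HM.
  - now apply CInt_correct.
Qed.

Lemma CInt_period (f : R -> C) (a : R) : continuous_map f -> (forall t, f (t + 1)%R = f t) ->
  CInt f a (a + 1) = CInt f 0 1.
Proof.
  intros Hf Hp.
  assert (E : CInt f 1 (1 + a) = CInt f 0 a).
  { rewrite <- (Rplus_0_r 1) at 1. rewrite <- CInt_shift by auto.
    apply CInt_ext. intros t. now rewrite Rplus_comm. }
  rewrite (Rplus_comm a 1).
  replace (CInt f a (1 + a)) with (CInt f 0 a + CInt f a (1 + a) - CInt f 0 a) by ring.
  rewrite CInt_Chasles, <- (CInt_Chasles f 0 1), E by auto. ring.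
Qed.

Lemma CInt_period_centered (f : R -> C) (t : R) :
  continuous_map f -> (forall t, f (t + 1)%R = f t) ->
  CInt f 0 1 = CInt (fun s => f (t + s)%R) (- (1 / 2)) (1 / 2).
Proof.
  intros Hf Hp. rewrite CInt_shift, <- (CInt_period f (t + - (1 / 2))) by auto.
  f_equal. field.
Qed.

Lemma is_RInt_Rabs (u : R -> R) (a l : R) : 0 <= a -> is_RInt u 0 a l ->
  is_RInt (fun s => u (Rabs s)) (- a) a (2 * l)%R.
Proof.
  intros Ha Hl. replace (2 * l)%R with (plus l l) by (unfold plus; simpl; ring).
  apply (is_RInt_Chasles (V := R_NormedModule) _ (- a) 0 a).
  - apply (is_RInt_ext (V := R_NormedModule) (fun s => opp (opp (u (- s)%R)))).
    { intros s Hs. rewrite Rmin_left, Rmax_right in Hs by lra.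
      rewrite opp_opp, Rabs_left by lra. reflexivity. }
    rewrite <- (opp_opp l). apply (is_RInt_opp (V := R_NormedModule)).
    apply (is_RInt_comp_opp (V := R_NormedModule)).
    rewrite Ropp_involutive, Ropp_0. now apply (is_RInt_swap (V := R_NormedModule)).
  - apply (is_RInt_ext (V := R_NormedModule) u); [|exact Hl].
    intros s Hs. rewrite Rmin_left, Rmax_right in Hs by lra. now rewrite Rabs_pos_eq by lra.
Qed.

(** * Derivatives *)

Notation is_derive_RC := (@is_derive R_AbsRing C_R_NormedModule).
Notation is_derive_CC := (@is_derive C_AbsRing C_NormedModule).

Lemma is_derive_RC_iff (f : R -> C) (t : R) (l : C) :
  is_derive_RC f t l <->
  forall eps : R, 0 < eps -> exists d : R, 0 < d /\ forall s, Rabs (s - t) < d ->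
    Cmod (f s - f t - RtoC (s - t) * l) <= eps * Rabs (s - t).
Proof.
  split.
  - intros [_ H] eps He. destruct (H t (fun P HP => HP) (mkposreal eps He)) as [d Hd].
    exists d. split; [apply cond_pos|]. intros s Hs. specialize (Hd s Hs).
    rewrite <- Cmod_norm, scal_R_Cmult in Hd. exact Hd.
  - intros H. split; [apply is_linear_scal_l|]. intros x Hx.
    apply (is_filter_lim_locally_unique (K := R_AbsRing) (V := R_NormedModule)) in Hx as <-.
    intros eps. destruct (H eps (cond_pos eps)) as (d & Hd & Hs).
    exists (mkposreal d Hd). intros s Hst. rewrite <- Cmod_norm, scal_R_Cmult. now apply Hs.
Qed.

Lemma is_derive_CC_iff (f : C -> C) (z l : C) :
  is_derive_CC f z l <->
  forall eps : R, 0 < eps -> exists d : R, 0 < d /\ forall w, Cmod (w - z) < d ->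
    Cmod (f w - f z - (w - z) * l) <= eps * Cmod (w - z).
Proof.
  split.
  - intros [_ H] eps He. destruct (H z (fun P HP => HP) (mkposreal eps He)) as [d Hd].
    exists d. split; [apply cond_pos|exact Hd].
  - intros H. split; [apply is_linear_scal_l|]. intros x Hx.
    apply (is_filter_lim_locally_unique (K := C_AbsRing)
      (V := AbsRing_NormedModule C_AbsRing)) in Hx as <-.
    intros eps. destruct (H eps (cond_pos eps)) as (d & Hd & Hw). now exists (mkposreal d Hd).
Qed.

Lemma is_derive_CC_ext_loc (f g : C -> C) (z l : C) :
  @locally C_UniformSpace z (fun w => f w = g w) -> is_derive_CC f z l -> is_derive_CC g z l.
Proof. intros E. apply is_derive_ext_loc. now apply locally_C. Qed.

Lemma is_derive_CC_continuous (f : C -> C) (z l : C) :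
  is_derive_CC f z l -> @continuous C_UniformSpace C_UniformSpace f z.
Proof.
  intros H P HP. apply locally_C.
  apply (ex_derive_continuous (K := C_AbsRing) (V := C_NormedModule) f z); [now exists l|exact HP].
Qed.

Lemma is_derive_CC_minus (f g : C -> C) (z k l : C) : is_derive_CC f z k -> is_derive_CC g z l ->
  is_derive_CC (fun w => f w - g w) z (k - l).
Proof. exact (is_derive_minus (K := C_AbsRing) (V := C_NormedModule) f g z k l). Qed.

(* [C_NormedModule] carries the product topology of the plane, [C_AbsRing] that of [Cmod]. *)
Lemma is_derive_CC_AbsRing (f : C -> C) (z l : C) :
  is_derive_CC f z l <-> @is_derive C_AbsRing (AbsRing_NormedModule C_AbsRing) f z l.
Proof. split; intros [_ D]; (split; [apply is_linear_scal_l|exact D]). Qed.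

Lemma is_derive_CC_mult (f g : C -> C) (z k l : C) : is_derive_CC f z k -> is_derive_CC g z l ->
  is_derive_CC (fun w => f w * g w) z (k * g z + f z * l).
Proof.
  rewrite !is_derive_CC_AbsRing. intros Hf Hg.
  exact (is_derive_mult (K := C_AbsRing) f g z k l Hf Hg Cmult_comm).
Qed.

Lemma is_derive_CC_id (z : C) : is_derive_CC (fun w => w) z (RtoC 1).
Proof. apply is_derive_CC_AbsRing, (is_derive_id (K := C_AbsRing)). Qed.

Lemma is_derive_CC_minus_const (f : C -> C) (c z l : C) :
  is_derive_CC f z l -> is_derive_CC (fun w => f w - c) z l.
Proof.
  intros Hf. replace l with (l - 0) by ring. apply (is_derive_CC_minus f (fun _ => c) z l 0 Hf).
  apply (is_derive_const (K := C_AbsRing) (V := C_NormedModule)).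
Qed.

Lemma is_derive_CC_scal (f : C -> C) (c z l : C) :
  is_derive_CC f z l -> is_derive_CC (fun w => c * f w) z (c * l).
Proof.
  intros Hf. replace (c * l) with (0 * f z + c * l) by ring.
  apply (is_derive_CC_mult (fun _ => c)); [|exact Hf].
  apply (is_derive_const (K := C_AbsRing) (V := C_NormedModule)).
Qed.

Lemma is_derive_CC_quadratic (f : C -> C) (z l : C) (K d : R) : 0 < d ->
  (forall w, Cmod (w - z) < d -> Cmod (f w - f z - (w - z) * l) <= K * Cmod (w - z) ^ 2) ->
  is_derive_CC f z l.
Proof.
  intros Hd H. apply is_derive_CC_iff. intros eps He.
  pose proof (Rabs_pos K). assert (0 < eps / (Rabs K + 1)) by (apply Rdiv_lt_0_compat; lra).
  exists (Rmin d (eps / (Rabs K + 1))). split; [now apply Rmin_pos|]. intros w Hw.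
  apply Rmin_Rgt in Hw as [Hwd Hwe]. apply Rlt_div_r in Hwe; [|lra].
  pose proof (Cmod_ge_0 (w - z)). pose proof (Rle_abs K).
  eapply Rle_trans; [now apply H|]. nra.
Qed.

Lemma is_derive_CC_inv (f : C -> C) (z l : C) : is_derive_CC f z l -> f z <> 0 ->
  is_derive_CC (fun w => / f w) z (- (l / (f z * f z))).
Proof.
  intros Hf N.
  assert (Hinv : is_derive_CC Cinv (f z) (- / (f z * f z))).
  { set (a := f z) in *. assert (Ha : 0 < Cmod a) by now apply Cmod_gt_0.
    apply (is_derive_CC_quadratic _ _ _ (2 / Cmod a ^ 3) (Cmod a / 2)); [lra|]. intros w Hw.
    pose proof (Cmod_triangle_inv a w) as T. rewrite Cmod_minus_sym in T.
    assert (Nw : w <> 0) by (apply Cmod_gt_0; lra).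
    replace (/ w - / a - (w - a) * - / (a * a)) with ((w - a) * (w - a) / (a * a * w))
      by (field; auto).
    apply Rle_trans with (Cmod (w - a) ^ 2 / (Cmod a * Cmod a * (Cmod a / 2)))%R.
    - apply Cmod_div_le.
      + repeat apply Rmult_lt_0_compat; lra.
      + rewrite !Cmod_mult. apply Rmult_le_compat_l; nra.
      + rewrite Cmod_mult. right. ring.
    - right. field. lra. }
  replace (- (l / (f z * f z))) with (l * - / (f z * f z)) by (field; auto).
  exact (is_derive_comp (K := C_AbsRing) (V := C_NormedModule) Cinv f z _ l Hinv
    (proj1 (is_derive_CC_AbsRing f z l) Hf)).
Qed.

Lemma is_derive_RC_comp (f : C -> C) (g : R -> C) (t : R) (k l : C) :
  is_derive_CC f (g t) k -> is_derive_RC g t l -> is_derive_RC (fun s => f (g s)) t (l * k).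
Proof.
  intros Hf Hg. apply is_derive_RC_iff. intros eps He.
  set (N := (Cmod l + 1)%R). pose proof (Cmod_ge_0 l). pose proof (Cmod_ge_0 k).
  assert (HN : 0 < N) by (unfold N; lra).
  assert (Hf' : 0 < eps / (2 * N)) by (apply Rdiv_lt_0_compat; lra).
  assert (Hg' : 0 < Rmin 1 (eps / (2 * (Cmod k + 1)))).
  { apply Rmin_pos; [lra|]. apply Rdiv_lt_0_compat; lra. }
  destruct (proj1 (is_derive_CC_iff _ _ _) Hf _ Hf') as (d & Hd & Df).
  destruct (proj1 (is_derive_RC_iff _ _ _) Hg _ Hg') as (d' & Hd' & Dg).
  assert (0 < d / N) by now apply Rdiv_lt_0_compat.
  exists (Rmin d' (d / N)). split; [now apply Rmin_pos|]. intros s Hs.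
  apply Rmin_Rgt in Hs as [Hsd Hsd']. apply Rlt_div_r in Hsd'; [|exact HN].
  specialize (Dg s Hsd). set (h := Rabs (s - t)) in *. assert (Hh : 0 <= h) by apply Rabs_pos.
  set (r := g s - g t - RtoC (s - t) * l) in *.
  assert (Hrh : Cmod r <= h) by (pose proof (Rmin_l 1 (eps / (2 * (Cmod k + 1)))); nra).
  assert (Hrk : Cmod r * (Cmod k + 1) <= eps / 2 * h).
  { replace (eps / 2 * h)%R with (eps / (2 * (Cmod k + 1)) * h * (Cmod k + 1))%R by (field; lra).
    pose proof (Rmin_r 1 (eps / (2 * (Cmod k + 1)))). apply Rmult_le_compat_r; nra. }
  assert (Hgs : Cmod (g s - g t) <= N * h).
  { replace (g s - g t) with (r + RtoC (s - t) * l) by (unfold r; ring).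
    eapply Rle_trans; [apply Cmod_triangle|]. rewrite Cmod_mult, Cmod_R. fold h. unfold N. lra. }
  replace (f (g s) - f (g t) - RtoC (s - t) * (l * k)) with
    ((f (g s) - f (g t) - (g s - g t) * k) + r * k) by (unfold r; ring).
  eapply Rle_trans; [apply Cmod_triangle|]. rewrite Cmod_mult.
  specialize (Df (g s) ltac:(lra)).
  assert (eps / (2 * N) * Cmod (g s - g t) <= eps / 2 * h).
  { replace (eps / 2 * h)%R with (eps / (2 * N) * (N * h))%R by (field; lra).
    apply Rmult_le_compat_l; lra. }
  pose proof (Cmod_ge_0 r). nra.
Qed.

Lemma is_derive_RC_continuous (f : R -> C) (t : R) (l : C) :
  is_derive_RC f t l -> @continuous R_UniformSpace C_UniformSpace f t.
Proof. intros H. apply (ex_derive_continuous (V := C_R_NormedModule)). now exists l. Qed.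

Lemma is_derive_RC_re (f : R -> C) (t : R) (l : C) :
  is_derive_RC f t l -> is_derive (fun s => Re (f s)) t (Re l).
Proof.
  intros H. exact (filterdiff_comp' f (fun z : C_R_NormedModule => fst z) t _ _ H
    (filterdiff_linear _ is_linear_fst)).
Qed.

Lemma is_derive_RC_im (f : R -> C) (t : R) (l : C) :
  is_derive_RC f t l -> is_derive (fun s => Im (f s)) t (Im l).
Proof.
  intros H. exact (filterdiff_comp' f (fun z : C_R_NormedModule => snd z) t _ _ H
    (filterdiff_linear _ is_linear_snd)).
Qed.

Lemma is_derive_RC_unique (f : R -> C) (t : R) (k l : C) :
  is_derive_RC f t k -> is_derive_RC f t l -> k = l.
Proof.
  intros Hk Hl.
  pose proof (is_derive_unique _ _ _ (is_derive_RC_re _ _ _ Hk)).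
  pose proof (is_derive_unique _ _ _ (is_derive_RC_re _ _ _ Hl)).
  pose proof (is_derive_unique _ _ _ (is_derive_RC_im _ _ _ Hk)).
  pose proof (is_derive_unique _ _ _ (is_derive_RC_im _ _ _ Hl)).
  apply injective_projections; unfold Re, Im in *; congruence.
Qed.

Lemma CInt_derive (G g : R -> C) (a b : R) :
  (forall t, is_derive_RC G t (g t)) -> continuous_map g -> CInt g a b = G b - G a.
Proof.
  intros HG Hg. apply CInt_unique.
  apply (is_RInt_derive (V := C_R_CompleteNormedModule) G g); intros; auto.
Qed.

Lemma Cmod_mean_value (G g : R -> C) (c : C) (a b eta : R) :
  (forall t, is_derive_RC G t (g t)) -> continuous_map g ->
  (forall t, Rmin a b <= t <= Rmax a b -> Cmod (g t - c) <= eta) ->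
  Cmod (G b - G a - RtoC (b - a) * c) <= Rabs (b - a) * eta.
Proof.
  intros HG Hg Hc. rewrite <- (CInt_derive G g), <- CInt_const by auto.
  rewrite <- (CInt_minus g (fun _ => c)) by continuity_C.
  apply Cmod_CInt_le_const; [continuity_C|exact Hc].
Qed.

(** * Regularity of analytic loops *)

Lemma is_pseries_re_im (a : nat -> C) (x : R) (l : C) :
  @is_pseries R_AbsRing C_R_NormedModule a x l ->
  is_pseries (fun n => Re (a n)) x (Re l) /\ is_pseries (fun n => Im (a n)) x (Im l).
Proof.
  intros H.
  assert (E : forall n, sum_n (fun k => @scal R_AbsRing C_R_NormedModule (pow_n x k) (a k)) n =
    (sum_n (fun k => @scal R_AbsRing R_NormedModule (pow_n x k) (Re (a k))) n,
     sum_n (fun k => @scal R_AbsRing R_NormedModule (pow_n x k) (Im (a k))) n)).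
  { induction n as [|n IH]; [now rewrite !sum_O|]. now rewrite !sum_Sn, IH. }
  split.
  - apply (filterlim_ext (fun n => Re (sum_n (fun k =>
      @scal R_AbsRing C_R_NormedModule (pow_n x k) (a k)) n))); [intros n; now rewrite E|].
    refine (filterlim_comp _ _ _ _ Re _ _ _ H _). destruct l. apply continuous_fst.
  - apply (filterlim_ext (fun n => Im (sum_n (fun k =>
      @scal R_AbsRing C_R_NormedModule (pow_n x k) (a k)) n))); [intros n; now rewrite E|].
    refine (filterlim_comp _ _ _ _ Im _ _ _ H _). destruct l. apply continuous_snd.
Qed.

Lemma CV_radius_ge (a : nat -> R) (r : R) :
  (forall x, Rabs x < r -> ex_pseries a x) -> Rbar_le r (CV_radius a).
Proof.
  intros H. apply Rbar_not_lt_le. intros Lt.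
  assert (exists x, Rabs x < r /\ Rbar_lt (CV_radius a) (Rabs x)) as (x & Hx & Out).
  { pose proof (CV_radius_ge_0 a). destruct (CV_radius a) as [c| |]; simpl in *; try tauto.
    exists ((c + r) / 2)%R. rewrite Rabs_pos_eq; lra. }
  apply (CV_disk_outside _ _ Out).
  apply (is_lim_seq_ext (fun k => @scal R_AbsRing R_NormedModule (pow_n x k) (a k))).
  - intros n. rewrite pow_n_pow. apply Rmult_comm.
  - now apply ex_series_lim_0, H.
Qed.

Lemma is_derive_pseries_continuous (a : nat -> R) (f g : R -> R) (t0 r : R) :
  0 < r -> (forall t, Rabs (t - t0) < r -> is_pseries a (t - t0)%R (f t)) ->
  (forall t, is_derive f t (g t)) -> continuous g t0.
Proof.
  intros Hr Ha Hg.
  assert (Conv : forall x, Rabs x < r -> Rbar_lt (Rabs x) (CV_radius a)).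
  { intros x Hx. apply (Rbar_lt_le_trans _ r); [exact Hx|]. apply CV_radius_ge.
    intros y Hy. exists (f (t0 + y)%R). specialize (Ha (t0 + y)%R).
    replace (t0 + y - t0)%R with y in Ha by ring. now apply Ha. }
  assert (Eg : locally t0 (fun t => PSeries (PS_derive a) (t - t0)%R = g t)).
  { exists (mkposreal r Hr). intros t Ht. change (Rabs (t - t0) < r) in Ht.
    rewrite <- (is_derive_unique _ _ _ (Hg t)). symmetry. apply is_derive_unique.
    apply (is_derive_ext_loc (fun t => PSeries a (t - t0)%R)).
    - assert (Hp : 0 < r - Rabs (t - t0)) by lra.
      exists (mkposreal _ Hp). intros s Hs. change (Rabs (s - t) < r - Rabs (t - t0)) in Hs.
      apply is_pseries_unique, Ha. replace (s - t0)%R with ((s - t) + (t - t0))%R by ring.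
      pose proof (Rabs_triang (s - t) (t - t0)). lra.
    - evar_last.
      + apply (is_derive_comp (K := R_AbsRing) (PSeries a) (fun t => t - t0)%R).
        * apply is_derive_PSeries, Conv, Ht.
        * auto_derive; reflexivity.
      + apply Rmult_1_l. }
  apply (continuous_ext_loc _ (fun t => PSeries (PS_derive a) (t - t0)%R)); [exact Eg|].
  apply (continuous_comp (fun t => t - t0)%R (PSeries (PS_derive a))).
  - apply (ex_derive_continuous (V := R_NormedModule)). auto_derive. trivial.
  - apply continuity_pt_filterlim, PSeries_continuity.
    rewrite CV_radius_derive. apply Conv. now rewrite Rminus_diag, Rabs_R0.
Qed.

Definition periodic (f : R -> C) : Prop := forall t, f (t + 1)%R = f t.

Record regular_loop (gam : R -> C) : Prop := {
  loop_periodic : periodic gam;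
  loop_inj : forall s t, 0 <= s < 1 -> 0 <= t < 1 -> gam s = gam t -> s = t;
  loop_derive : forall t, is_derive_RC gam t (dgam gam t);
  dgam_continuous : continuous_map (dgam gam);
  dgam_neq_0 : forall t, dgam gam t <> 0
}.

Lemma analytic_jordan_regular (gam : R -> C) : analytic_jordan gam -> regular_loop gam.
Proof.
  intros (Hp & Hinj & Han & Hd).
  assert (Der : forall t, is_derive_RC gam t (dgam gam t)).
  { intros t. unfold dgam. apply epsilon_spec. destruct (Hd t) as (l & Hl & _). now exists l. }
  split; auto.
  - intros t. destruct (Han t) as (a & r & Hr & Ha).
    apply (continuous_ext (T := R_UniformSpace) (U := C_UniformSpace)
      (fun s => (Re (dgam gam s), Im (dgam gam s)))).
    { intros s. symmetry. apply surjective_pairing. }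
    apply continuous_pair.
    + apply (is_derive_pseries_continuous (fun n => Re (a n)) (fun s => Re (gam s)) _ t r Hr).
      * intros s Hs. now apply is_pseries_re_im, Ha.
      * intros s. now apply is_derive_RC_re.
    + apply (is_derive_pseries_continuous (fun n => Im (a n)) (fun s => Im (gam s)) _ t r Hr).
      * intros s Hs. now apply is_pseries_re_im, Ha.
      * intros s. now apply is_derive_RC_im.
  - intros t. destruct (Hd t) as (l & Hl & Nl).
    now rewrite (is_derive_RC_unique _ _ _ _ (Der t) Hl).
Qed.

(** * Periodic functions *)

Lemma periodic_IZR (f : R -> C) (n : Z) (t : R) : periodic f -> f (t + IZR n)%R = f t.
Proof.
  intros Hp.
  assert (Nat : forall (k : nat) u, f (u + INR k)%R = f u).
  { induction k as [|k IH]; intros u; [simpl; f_equal; ring|].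
    rewrite S_INR, <- Rplus_assoc, Hp. apply IH. }
  destruct (Z_le_gt_dec 0 n) as [Pos|Neg].
  - rewrite <- (Z2Nat.id n), <- INR_IZR_INZ by auto. apply Nat.
  - rewrite <- (Nat (Z.to_nat (- n)) (t + IZR n)%R).
    rewrite INR_IZR_INZ, Z2Nat.id, opp_IZR by lia. f_equal. ring.
Qed.

Lemma exists_Z_shift (t : R) : exists n : Z, 0 <= t + IZR n < 1.
Proof. exists (- Int_part t)%Z. rewrite opp_IZR. destruct (base_Int_part t). lra. Qed.

Lemma exists_Z_shift_centered (t u : R) : exists s n, Rabs s <= 1 / 2 /\ (u = t + s + IZR n)%R.
Proof.
  destruct (exists_Z_shift (u - t + 1 / 2)) as [n Hn].
  exists (u - t + IZR n)%R, (- n)%Z. rewrite opp_IZR. split; [apply Rabs_le; lra|ring].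
Qed.

Lemma periodic_Cmod_min (f : R -> C) : continuous_map f -> periodic f ->
  exists t, forall u, Cmod (f t) <= Cmod (f u).
Proof.
  intros Hf Hp. destruct (continuity_ab_min (fun t => Cmod (f t)) 0 1) as (t & Ht & _); [lra| |].
  { intros t _. now apply continuity_pt_filterlim, continuous_Cmod. }
  exists t. intros u. destruct (exists_Z_shift u) as [n Hn].
  rewrite <- (periodic_IZR f n u Hp). apply Ht. lra.
Qed.

Lemma continuous_bounded_segment (f : R -> C) (a b : R) : a <= b -> continuous_map f ->
  exists M, 0 < M /\ forall t, a <= t <= b -> Cmod (f t) <= M.
Proof.
  intros Hab Hf. destruct (continuity_ab_maj (fun t => Cmod (f t)) a b Hab) as (u & Hu & _).
  { intros t _. now apply continuity_pt_filterlim, continuous_Cmod. }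
  exists (Cmod (f u) + 1)%R. pose proof (Cmod_ge_0 (f u)). split; [lra|].
  intros t Ht. specialize (Hu t Ht). lra.
Qed.

Lemma periodic_bounded (f : R -> C) : continuous_map f -> periodic f ->
  exists M, 0 < M /\ forall t, Cmod (f t) <= M.
Proof.
  intros Hf Hp. destruct (continuous_bounded_segment f 0 1) as (M & HM & B); [lra|exact Hf|].
  exists M. split; [exact HM|]. intros t. destruct (exists_Z_shift t) as [n Hn].
  rewrite <- (periodic_IZR f n t Hp). apply B. lra.
Qed.

Lemma periodic_uniformly_continuous (f : R -> C) (eps : R) :
  continuous_map f -> periodic f -> 0 < eps ->
  exists d, 0 < d /\ forall s t, Rabs (s - t) <= d -> Cmod (f s - f t) <= eps.
Proof.
  intros Hf Hp He. assert (He2 : 0 < eps / 2) by lra.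
  destruct (unifcont_1d (V := C_UniformSpace) f (-1) 2 (fun t _ => Hf t) (mkposreal _ He2))
    as [d Hd].
  pose proof (cond_pos d). exists (Rmin (d / 2) 1). split; [apply Rmin_pos; lra|].
  intros s t Hst.
  pose proof (Rmin_l (d / 2) 1). pose proof (Rmin_r (d / 2) 1).
  destruct (exists_Z_shift t) as [n Hn].
  rewrite <- (periodic_IZR f n t Hp), <- (periodic_IZR f n s Hp).
  assert (Hs : -1 <= s + IZR n <= 2).
  { assert (A : Rabs (s - t) <= 1) by lra. apply Rabs_le_between in A. lra. }
  assert (Ball : ball (t + IZR n)%R d (s + IZR n)%R).
  { change (Rabs (s + IZR n - (t + IZR n)) < d).
    replace (s + IZR n - (t + IZR n))%R with (s - t)%R by ring. lra. }
  specialize (Hd (t + IZR n)%R (s + IZR n)%R ltac:(lra) Hs Ball).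
  apply NNPP in Hd as [Hre Him]. eapply Rle_trans; [apply Cmod_le_re_im|].
  apply Rlt_le in Hre, Him. eapply Rle_trans; [exact (Rplus_le_compat _ _ _ _ Hre Him)|].
  simpl. lra.
Qed.

Lemma continuity_2d_bounded_below (f : R -> R -> R) (a b c d : R) :
  (forall x y, a <= x <= b -> c <= y <= d -> continuity_2d_pt f x y) ->
  (forall x y, a <= x <= b -> c <= y <= d -> 0 < f x y) ->
  exists m, 0 < m /\ forall x y, a <= x <= b -> c <= y <= d -> m <= f x y.
Proof.
  intros Hc Hf.
  set (good := fun u v (e : posreal) => a <= u <= b -> c <= v <= d -> e <= f u v /\
    forall x y, Rabs (x - u) < e -> Rabs (y - v) < e -> Rabs (f x y - f u v) < f u v / 2).
  set (gauge := fun u v => epsilon (inhabits (mkposreal 1 Rlt_0_1)) (good u v)).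
  assert (Hgauge : forall u v, a <= u <= b -> c <= v <= d -> good u v (gauge u v)).
  { intros u v Hu Hv. apply epsilon_spec. pose proof (Hf u v Hu Hv) as Pos.
    assert (Pos2 : 0 < f u v / 2) by lra.
    destruct (Hc u v Hu Hv (mkposreal _ Pos2)) as [e He].
    exists (mkposreal _ (Rmin_stable_in_posreal (mkposreal _ Pos) e)). intros _ _. simpl.
    pose proof (Rmin_l (f u v) e). pose proof (Rmin_r (f u v) e). split; [lra|].
    intros x y Hx Hy. apply He; lra. }
  destruct (compactness_value_2d a b c d gauge) as [m Hm].
  pose proof (cond_pos m). exists (m / 2)%R. split; [lra|]. intros x y Hx Hy.
  specialize (Hm x y Hx Hy). apply NNPP in Hm as (u & v & Hu & Hv & Hxu & Hyv & Hmg).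
  destruct (Hgauge u v Hu Hv Hu Hv) as [Le Near]. specialize (Near x y Hxu Hyv).
  apply Rabs_lt_between in Near. lra.
Qed.

(** * Geometry of regular loops *)

Definition depth_ge (gam : R -> C) (c t d : R) (z : C) : Prop :=
  forall s, Rabs s <= 1 / 2 -> c * (d + Rabs s) <= Cmod (gam (t + s)%R - z).

Definition normal_pt (gam : R -> C) (t tau : R) : C := gam t + Ci * RtoC tau * dgam gam t.

Lemma orthogonal_Ci_mult (z a : C) : a <> 0 -> (Re z * Re a + Im z * Im a = 0)%R ->
  exists tau : R, z = Ci * RtoC tau * a.
Proof.
  intros Na Orth. exists ((Im z * Re a - Re z * Im a) / (Re a ^ 2 + Im a ^ 2))%R.
  assert (N : (Re a ^ 2 + Im a ^ 2 <> 0)%R).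
  { rewrite <- Cmod2_alt. now apply pow_nonzero, Rgt_not_eq, Cmod_gt_0. }
  destruct z as [x y], a as [p q]. unfold Re, Im in *; simpl in *.
  pose proof (f_equal (Rmult p) Orth). pose proof (f_equal (Rmult q) Orth).
  apply injective_projections; simpl; field_simplify_eq; auto; lra.
Qed.

Section Loop.
Variable gam : R -> C.
Hypothesis gam_regular : regular_loop gam.
Notation dg := (dgam gam).
Notation npt := (normal_pt gam).

Lemma loop_continuous : continuous_map gam.
Proof. intros t. exact (is_derive_RC_continuous _ _ _ (loop_derive gam gam_regular t)). Qed.

Lemma dgam_periodic : periodic dg.
Proof.
  intros t. apply (is_derive_RC_unique gam t); [|now apply loop_derive].
  apply is_derive_RC_iff. intros eps He.
  destruct (proj1 (is_derive_RC_iff _ _ _) (loop_derive gam gam_regular (t + 1)%R) eps He)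
    as (d & Hd & D).
  exists d. split; [exact Hd|]. intros s Hs. specialize (D (s + 1)%R).
  rewrite !(loop_periodic gam gam_regular) in D.
  replace (s + 1 - (t + 1))%R with (s - t)%R in D by ring. auto.
Qed.

Lemma dgam_bounded : exists L, 0 < L /\ forall t, Cmod (dg t) <= L.
Proof. apply periodic_bounded; [now apply dgam_continuous|apply dgam_periodic]. Qed.

Lemma dgam_bounded_below : exists m, 0 < m /\ forall t, m <= Cmod (dg t).
Proof.
  destruct (periodic_Cmod_min dg (dgam_continuous gam gam_regular) dgam_periodic) as [t Ht].
  exists (Cmod (dg t)). split; [|exact Ht]. apply Cmod_gt_0. now apply dgam_neq_0.
Qed.

Lemma loop_uniform_derive (eta : R) : 0 < eta ->
  exists s0, 0 < s0 <= 1 / 2 /\ forall t s, Rabs s <= s0 ->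
    Cmod (dg (t + s) - dg t) <= eta /\
    Cmod (gam (t + s) - gam t - RtoC s * dg t) <= eta * Rabs s.
Proof.
  intros He.
  destruct (periodic_uniformly_continuous dg eta (dgam_continuous gam gam_regular) dgam_periodic He)
    as (d & Hd & Unif).
  pose proof (Rmin_l d (1 / 2)). pose proof (Rmin_r d (1 / 2)).
  exists (Rmin d (1 / 2)). split; [split; [apply Rmin_pos; lra|lra]|].
  intros t s Hs. split; [apply Unif; replace (t + s - t)%R with s by ring; lra|].
  pose proof (Cmod_mean_value gam dg (dg t) t (t + s) eta) as MV.
  replace (t + s - t)%R with s in MV by ring. rewrite (Rmult_comm eta). apply MV.
  - now apply loop_derive.
  - now apply dgam_continuous.
  - intros u Hu. apply Unif. apply Rabs_le_between in Hs as [Lo Up]. apply Rabs_le.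
    destruct (Rle_dec 0 s);
      [rewrite Rmin_left, Rmax_right in Hu|rewrite Rmin_right, Rmax_left in Hu]; lra.
Qed.

Lemma loop_lipschitz (L : R) : (forall t, Cmod (dg t) <= L) ->
  forall s t, Cmod (gam s - gam t) <= L * Rabs (s - t).
Proof.
  intros HL s t. replace (gam s - gam t) with (gam s - gam t - RtoC (s - t) * 0) by ring.
  rewrite Rmult_comm. apply (Cmod_mean_value gam dg).
  - now apply loop_derive.
  - now apply dgam_continuous.
  - intros u _. replace (dg u - 0) with (dg u) by ring. apply HL.
Qed.

Lemma loop_neq (t s : R) : 0 < s < 1 -> gam (t + s)%R <> gam t.
Proof.
  intros Hs E. destruct (exists_Z_shift t) as [n Hn].
  pose proof (loop_periodic gam gam_regular) as Hp.
  rewrite <- (periodic_IZR gam n t Hp), <- (periodic_IZR gam n (t + s)%R Hp) in E.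
  destruct (Rlt_dec (t + s + IZR n) 1).
  - apply (loop_inj gam gam_regular) in E; lra.
  - replace (t + s + IZR n)%R with (t + s + IZR n - 1 + 1)%R in E by ring.
    rewrite Hp in E. apply (loop_inj gam gam_regular) in E; lra.
Qed.

Lemma loop_separation (s0 : R) : 0 < s0 ->
  exists c, 0 < c /\ forall t s, s0 <= Rabs s <= 1 / 2 -> c <= Cmod (gam (t + s) - gam t).
Proof.
  intros Hs0. pose proof (loop_periodic gam gam_regular) as Hp.
  destruct (continuity_2d_bounded_below (fun t s => Cmod (gam (t + s) - gam t)) 0 1 s0 (1 - s0))
    as (c & Hc & B).
  - intros t s _ _. apply continuity_2d_pt_filterlim.
    apply (continuous_Cmod (fun p : R * R => gam (fst p + snd p)%R - gam (fst p))).
    apply continuous_Cminus; [apply (continuous_comp (fun p : R * R => fst p + snd p)%R gam)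
      |apply (continuous_comp (fun p : R * R => fst p) gam)]; try apply loop_continuous.
    + apply (continuous_plus (V := R_NormedModule)); [apply continuous_fst|apply continuous_snd].
    + apply continuous_fst.
  - intros t s _ Hs. apply Cmod_minus_gt_0, loop_neq. lra.
  - exists c. split; [exact Hc|]. intros t s Hs. destruct (exists_Z_shift t) as [n Hn].
    rewrite <- (periodic_IZR gam n t Hp), <- (periodic_IZR gam n (t + s)%R Hp).
    destruct (Rle_dec 0 s) as [Pos|Neg].
    + rewrite Rabs_pos_eq in Hs by lra. specialize (B (t + IZR n)%R s ltac:(lra) ltac:(lra)).
      now replace (t + s + IZR n)%R with (t + IZR n + s)%R by ring.
    + rewrite Rabs_left in Hs by lra. specialize (B (t + IZR n)%R (s + 1)%R ltac:(lra) ltac:(lra)).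
      now rewrite <- (Hp (t + s + IZR n)%R),
        (ltac:(ring) : (t + s + IZR n + 1 = t + IZR n + (s + 1))%R).
Qed.

Lemma Cmod_normal_pt_minus (t tau tau' : R) :
  Cmod (npt t tau - npt t tau') = (Rabs (tau - tau') * Cmod (dg t))%R.
Proof.
  replace (npt t tau - npt t tau') with (Ci * RtoC (tau - tau') * dg t).
  - now rewrite !Cmod_mult, Cmod_Ci, Cmod_R, Rmult_1_l.
  - unfold normal_pt. rewrite RtoC_minus. ring.
Qed.

Lemma Cmod_normal_pt_foot (t tau : R) : Cmod (npt t tau - gam t) = (Rabs tau * Cmod (dg t))%R.
Proof.
  replace (gam t) with (npt t 0) by (unfold normal_pt; ring).
  now rewrite Cmod_normal_pt_minus, Rminus_0_r.
Qed.

Lemma depth_ge_dist (c t d : R) (z : C) : 0 < c -> depth_ge gam c t d z ->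
  forall u, c * d <= Cmod (gam u - z).
Proof.
  intros Hc Hz u. destruct (exists_Z_shift_centered t u) as (s & n & Hs & ->).
  rewrite periodic_IZR by now apply loop_periodic.
  specialize (Hz s Hs). pose proof (Rabs_pos s). nra.
Qed.

Lemma depth_ge_weaken (c c' t d d' : R) (z : C) : 0 < c' <= c -> 0 <= d' <= d ->
  depth_ge gam c t d z -> depth_ge gam c' t d' z.
Proof.
  intros Hc Hd Hz s Hs. eapply Rle_trans; [|now apply Hz].
  pose proof (Rabs_pos s). apply Rmult_le_compat; lra.
Qed.

Lemma depth_ge_transfer (c t d M : R) (z w : C) : 0 < c -> 0 <= M ->
  depth_ge gam c t d z -> (forall u, c * d <= Cmod (gam u - w)) -> Cmod (w - z) <= M * d ->
  depth_ge gam (c / (1 + M / c)) t d w.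
Proof.
  intros Hc HM Hz Hw Hzw s Hs. specialize (Hz s Hs). specialize (Hw (t + s)%R).
  pose proof (Cmod_minus_triangle (gam (t + s)) w z) as T.
  assert (HMc : 0 <= M / c) by (apply Rle_div_r; lra).
  replace (c / (1 + M / c) * (d + Rabs s))%R with ((c * (d + Rabs s)) / (1 + M / c))%R
    by (field; split; [|apply Rgt_not_eq, Rlt_gt]; nra).
  apply Rle_div_l; [lra|]. apply (Rmult_le_compat_l (M / c)) in Hw; [|exact HMc].
  replace (M / c * (c * d))%R with (M * d)%R in Hw by (field; lra). lra.
Qed.

Lemma depth_ge_not_onG (c t d : R) (z : C) : 0 < c -> 0 < d -> depth_ge gam c t d z ->
  ~ onG gam z.
Proof.
  intros Hc Hd Hz [u E]. pose proof (depth_ge_dist c t d z Hc Hz u) as D.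
  rewrite E, Cmod_minus_diag in D. nra.
Qed.

Lemma normal_pt_depth_near (m s0 : R) : 0 < m -> (forall t, m <= Cmod (dg t)) ->
  (forall t s, Rabs s <= s0 -> Cmod (gam (t + s) - gam t - RtoC s * dg t) <= m / 4 * Rabs s) ->
  forall t s tau, Rabs s <= s0 -> m / 4 * (Rabs tau + Rabs s) <= Cmod (gam (t + s) - npt t tau).
Proof.
  intros Hm Bm Der t s tau Hs. specialize (Der t s Hs).
  set (r := gam (t + s) - gam t - RtoC s * dg t) in *.
  set (q := RtoC s - Ci * RtoC tau).
  assert (Hq : Rabs tau + Rabs s <= 2 * Cmod q).
  { pose proof (re_le_Cmod q) as Hre. pose proof (im_le_Cmod q) as Him.
    replace (Re q) with s in Hre by (simpl; ring).
    replace (Im q) with (- tau)%R in Him by (simpl; ring). rewrite Rabs_Ropp in Him. lra. }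
  assert (Hqm : Cmod q * m <= Cmod (q * dg t)).
  { rewrite Cmod_mult. apply Rmult_le_compat_l; [apply Cmod_ge_0|apply Bm]. }
  replace (q * dg t) with (gam (t + s) - npt t tau - r) in Hqm by (unfold q, r, normal_pt; ring).
  pose proof (Cmod_minus_le (gam (t + s) - npt t tau) r). pose proof (Rabs_pos tau). nra.
Qed.

Lemma normal_pt_depth : exists c tau0, 0 < c /\ 0 < tau0 /\
  forall t tau, Rabs tau <= tau0 -> depth_ge gam c t (Rabs tau) (npt t tau).
Proof.
  destruct dgam_bounded as (L & HL & BL). destruct dgam_bounded_below as (m & Hm & Bm).
  destruct (loop_uniform_derive (m / 4)%R) as (s0 & Hs0 & Der); [lra|].
  destruct (loop_separation s0) as (c0 & Hc0 & Sep); [lra|].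
  assert (Hq : 0 < c0 / (2 * L)) by (apply Rdiv_lt_0_compat; lra).
  pose proof (Rmin_l (1 / 2) (c0 / (2 * L))). pose proof (Rmin_r (1 / 2) (c0 / (2 * L))).
  pose proof (Rmin_l (m / 4) (c0 / 2)). pose proof (Rmin_r (m / 4) (c0 / 2)).
  assert (Hc : 0 < Rmin (m / 4) (c0 / 2)) by (apply Rmin_pos; lra).
  exists (Rmin (m / 4) (c0 / 2)), (Rmin (1 / 2) (c0 / (2 * L))).
  split; [exact Hc|split; [apply Rmin_pos; lra|]].
  intros t tau Htau s Hs. pose proof (Rabs_pos s). pose proof (Rabs_pos tau).
  destruct (Rle_dec (Rabs s) s0) as [Near|Far].
  - eapply Rle_trans; [apply Rmult_le_compat_r; [lra|apply Rmin_l]|].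
    apply (normal_pt_depth_near m s0); auto. intros t' s' Hs'. now apply Der.
  - pose proof (Sep t s ltac:(lra)) as Hsep.
    pose proof (Cmod_minus_triangle (gam (t + s)) (npt t tau) (gam t)) as T.
    rewrite Cmod_normal_pt_foot in T.
    assert (Rabs tau * Cmod (dg t) <= c0 / (2 * L) * L).
    { apply Rmult_le_compat; auto using Cmod_ge_0. lra. }
    replace (c0 / (2 * L) * L)%R with (c0 / 2)%R in * by (field; lra). nra.
Qed.

(* The derivative of [|gam u - z|^2] vanishes at a closest point [gam t], so [z - gam t] is
   orthogonal to [gam' t]. *)
Lemma nearest_normal_pt (z : C) : exists t tau,
  z = npt t tau /\ forall u, Cmod (gam t - z) <= Cmod (gam u - z).
Proof.
  destruct (periodic_Cmod_min (fun t => gam t - z)) as [t Min].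
  { pose proof loop_continuous. continuity_C. }
  { intros t. now rewrite (loop_periodic gam gam_regular). }
  exists t.
  set (sq := fun u => ((Re (gam u) - Re z) ^ 2 + (Im (gam u) - Im z) ^ 2)%R).
  assert (Esq : forall u, sq u = (Cmod (gam u - z) ^ 2)%R) by (intros u; now rewrite Cmod2_alt).
  set (slope := (2 * ((Re (gam t) - Re z) * Re (dg t) + (Im (gam t) - Im z) * Im (dg t)))%R).
  assert (Dsq : is_derive sq t slope).
  { pose proof (loop_derive gam gam_regular t) as D. unfold sq, slope. evar_last.
    - apply (is_derive_plus (V := R_NormedModule)); apply (is_derive_pow _ 2);
        apply (is_derive_minus (V := R_NormedModule));
        [apply (is_derive_RC_re _ _ _ D)|apply is_derive_const
        |apply (is_derive_RC_im _ _ _ D)|apply is_derive_const].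
    - unfold plus, minus, opp, zero; simpl. unfold plus, opp; simpl. ring. }
  assert (Crit : slope = 0%R).
  { apply is_derive_Reals in Dsq. rewrite <- (derive_pt_eq_0 sq t _ (exist _ _ Dsq) Dsq).
    apply (deriv_minimum sq (t - 1) (t + 1)); [lra|lra|].
    intros u _ _. rewrite !Esq. apply pow_incr. split; [apply Cmod_ge_0|apply Min]. }
  destruct (orthogonal_Ci_mult (z - gam t) (dg t)) as [tau Etau].
  - now apply dgam_neq_0.
  - unfold slope in Crit. unfold Re, Im in *. simpl. lra.
  - exists tau. split; [|exact Min]. unfold normal_pt. rewrite <- Etau. ring.
Qed.

End Loop.

(** * Cauchy integrals along closed curves *)

Definition vanishes_at_infinity (S : C -> Prop) (f : C -> C) : Prop :=
  forall eps : R, 0 < eps -> exists M : R, forall z, S z -> M < Cmod z -> Cmod (f z) < eps.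

Definition cauchy_transform (gam h : R -> C) (z : C) : C := CInt (fun t => h t / (gam t - z)) 0 1.

Section ClosedCurve.
Variable gam : R -> C.
Hypothesis gam_continuous : continuous_map gam.
Hypothesis gam_periodic : periodic gam.

Lemma not_onG_neq (z : C) : ~ onG gam z -> forall t, gam t - z <> 0.
Proof. intros Off t. apply Cminus_eq_contra. intros E. apply Off. now exists t. Qed.

Lemma not_onG_dist (z : C) : ~ onG gam z -> exists d, 0 < d /\ forall t, d <= Cmod (gam t - z).
Proof.
  intros Off. destruct (periodic_Cmod_min (fun t => gam t - z)) as [t Min].
  - continuity_C.
  - intros t. now rewrite gam_periodic.
  - exists (Cmod (gam t - z)). split; [now apply Cmod_gt_0, not_onG_neq|exact Min].
Qed.

Lemma dist_not_onG (z : C) (d : R) : 0 < d -> (forall t, d <= Cmod (gam t - z)) -> ~ onG gam z.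
Proof. intros Hd D [t E]. specialize (D t). rewrite E, Cmod_minus_diag in D. lra. Qed.

Lemma dist_perturb (z w : C) (d : R) : (forall t, d <= Cmod (gam t - z)) ->
  forall t, d - Cmod (w - z) <= Cmod (gam t - w).
Proof. intros D t. specialize (D t). pose proof (Cmod_minus_triangle (gam t) w z). lra. Qed.

Lemma Cmod_cauchy_transform_le (h : R -> C) (z : C) (M d : R) : continuous_map h -> 0 < d ->
  (forall t, d <= Cmod (gam t - z)) -> (forall t, 0 <= t <= 1 -> Cmod (h t) <= M) ->
  Cmod (cauchy_transform gam h z) <= M / d.
Proof.
  intros Hh Hd D B. pose proof (not_onG_neq z (dist_not_onG z d Hd D)).
  replace (M / d)%R with (Rabs (1 - 0) * (M / d))%R by (rewrite Rabs_pos_eq by lra; ring).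
  apply Cmod_CInt_le_const; [continuity_C|].
  intros t Ht. rewrite Rmin_left, Rmax_right in Ht by lra. apply Cmod_div_le; auto.
Qed.

Lemma is_derive_cauchy_transform (h : R -> C) (z : C) : continuous_map h -> ~ onG gam z ->
  is_derive_CC (cauchy_transform gam h) z (CInt (fun t => h t / ((gam t - z) * (gam t - z))) 0 1).
Proof.
  intros Hh Off. destruct (not_onG_dist z Off) as (d & Hd & D).
  destruct (continuous_bounded_segment h 0 1) as (M & HM & B); [lra|exact Hh|].
  apply (is_derive_CC_quadratic _ _ _ (M / (d * d * (d / 2))) (d / 2)); [lra|]. intros w Hw.
  assert (Dw : forall t, d / 2 <= Cmod (gam t - w)).
  { intros t. pose proof (dist_perturb z w d D t). lra. }
  pose proof (not_onG_neq z Off) as Nz.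
  pose proof (not_onG_neq w (dist_not_onG w (d / 2) ltac:(lra) Dw)) as Nw.
  set (rest := fun t => h t / ((gam t - z) * (gam t - z) * (gam t - w))).
  assert (Crest : continuous_map rest) by (unfold rest; continuity_C; auto using Cmult_neq_0).
  assert (E : cauchy_transform gam h w - cauchy_transform gam h z -
      (w - z) * CInt (fun t => h t / ((gam t - z) * (gam t - z))) 0 1 =
      (w - z) * (w - z) * CInt rest 0 1).
  { unfold cauchy_transform. rewrite <- !CInt_scal, <- !CInt_minus;
      try (continuity_C; auto using Cmult_neq_0).
    apply CInt_ext. intros t. unfold rest. field. auto. }
  rewrite E, !Cmod_mult, Rmult_comm. simpl. rewrite Rmult_1_r.
  apply Rmult_le_compat_r; [apply Rmult_le_pos; apply Cmod_ge_0|].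
  rewrite <- (Rmult_1_l (M / _)).
  replace 1%R with (Rabs (1 - 0)) at 2 by (rewrite Rabs_pos_eq by lra; ring).
  apply Cmod_CInt_le_const; [exact Crest|]. intros t Ht. rewrite Rmin_left, Rmax_right in Ht by lra.
  apply Cmod_div_le; auto.
  - repeat apply Rmult_lt_0_compat; lra.
  - rewrite !Cmod_mult. repeat apply Rmult_le_compat; auto; nra.
Qed.

Lemma cauchy_transform_vanishes (h : R -> C) : continuous_map h ->
  vanishes_at_infinity (fun _ => True) (cauchy_transform gam h).
Proof.
  intros Hh eps He.
  destruct (continuous_bounded_segment h 0 1) as (M & HM & B); [lra|exact Hh|].
  destruct (periodic_bounded gam gam_continuous gam_periodic) as (G & HG & BG).
  assert (Hd : 0 < 2 * M / eps) by (apply Rdiv_lt_0_compat; lra).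
  exists (G + 2 * M / eps)%R. intros z _ Hz.
  apply Rle_lt_trans with (M / (2 * M / eps))%R.
  - apply Cmod_cauchy_transform_le; auto. intros t.
    pose proof (Cmod_triangle_inv z (gam t)) as T. rewrite Cmod_minus_sym in T.
    specialize (BG t). lra.
  - replace (M / (2 * M / eps))%R with (eps / 2)%R by (field; lra). lra.
Qed.

End ClosedCurve.

Lemma locally_constant_path (f : C -> C) (p : R -> C) :
  (forall s, 0 <= s <= 1 -> @continuous R_UniformSpace C_UniformSpace p s) ->
  (forall s, 0 <= s <= 1 -> @locally C_UniformSpace (p s) (fun w => f w = f (p s))) ->
  f (p 0%R) = f (p 1%R).
Proof.
  intros Hp Hf. apply (eq_is_derive (V := C_R_NormedModule) (fun s => f (p s))); [|lra].
  intros s Hs. apply (is_derive_ext_loc (K := R_AbsRing) (V := C_R_NormedModule)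
    (fun _ => f (p s))); [|apply is_derive_const].
  apply (filter_imp (fun u => f (p u) = f (p s))); [auto|]. exact (Hp s Hs _ (Hf s Hs)).
Qed.

Lemma is_derive_CC_0_constant (f : C -> C) (z : C) (d : R) :
  (forall w, Cmod (w - z) < d -> is_derive_CC f w (RtoC 0)) ->
  forall w, Cmod (w - z) < d -> f w = f z.
Proof.
  intros Hf w Hw. set (p := fun s : R => z + RtoC s * (w - z)).
  assert (E : f (p 0%R) = f (p 1%R)).
  { apply (eq_is_derive (V := C_R_NormedModule) (fun s => f (p s))); [|lra].
    intros s Hs. replace (@zero C_R_NormedModule) with ((w - z) * 0) by apply Cmult_0_r.
    apply is_derive_RC_comp.
    - apply Hf. replace (p s - z) with (RtoC s * (w - z)) by (unfold p; ring).
      rewrite Cmod_mult, Cmod_R, Rabs_pos_eq by lra. pose proof (Cmod_ge_0 (w - z)). nra.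
    - apply is_derive_RC_iff. intros eps He. exists 1%R. split; [lra|]. intros s' _.
      replace (p s' - p s - RtoC (s' - s) * (w - z)) with (RtoC 0)
        by (unfold p; rewrite RtoC_minus; ring).
      rewrite Cmod_0. pose proof (Rabs_pos (s' - s)). nra. }
  replace (p 0%R) with z in E by (unfold p; ring).
  now replace (p 1%R) with w in E by (unfold p; ring).
Qed.

(** * The winding number and its jump across the loop *)

Definition C2PIi : C := 2 * RtoC PI * Ci.

Lemma Cmod_C2PIi : Cmod C2PIi = (2 * PI)%R.
Proof.
  pose proof PI_RGT_0. unfold C2PIi.
  rewrite !Cmod_mult, Cmod_Ci, !Cmod_R, !Rabs_pos_eq by lra. ring.
Qed.

Lemma C2PIi_neq_0 : C2PIi <> 0.
Proof. pose proof PI_RGT_0. apply Cmod_gt_0. rewrite Cmod_C2PIi. lra. Qed.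

Lemma PI_gt_3 : 3 < PI.
Proof. pose proof PI2_3_2. unfold PI2 in *. lra. Qed.

Lemma Cmod_inv_C2PIi_le : Cmod (/ C2PIi) <= 1 / 6.
Proof.
  pose proof PI_gt_3. rewrite Cmod_inv, Cmod_C2PIi by apply C2PIi_neq_0.
  unfold Rdiv. rewrite Rmult_1_l. apply Rinv_le_contravar; lra.
Qed.

Lemma is_RInt_atan (tau a b : R) : 0 < tau ->
  is_RInt (fun u => tau / (u ^ 2 + tau ^ 2))%R a b (atan (b / tau) - atan (a / tau))%R.
Proof.
  intros Ht. apply (is_RInt_derive (V := R_CompleteNormedModule) (fun u => atan (u / tau))).
  - intros u _. auto_derive; trivial. field. split; nra.
  - intros u _. apply (ex_derive_continuous (V := R_NormedModule)). auto_derive. nra.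
Qed.

Lemma atan_le_id (x : R) : 0 <= x -> 0 <= atan x <= x.
Proof.
  intros Hx. destruct (MVT_gen atan 0 x (fun u => / (1 + u ^ 2))%R) as (u & Hu & E).
  - intros u _. apply is_derive_Reals, derivable_pt_lim_atan.
  - intros u _. apply derivable_continuous_pt, derivable_pt_atan.
  - rewrite atan_0, !Rminus_0_r in E. rewrite E.
    assert (0 < / (1 + u ^ 2) <= / 1).
    { split; [apply Rinv_0_lt_compat|apply Rinv_le_contravar]; nra. }
    nra.
Qed.

Lemma tangent_numerator_eq (a r v : C) (s tau : R) :
  a * (a + v) * RtoC (s ^ 2 + tau ^ 2)
    - (RtoC s * a + r - Ci * RtoC tau * a) * (RtoC s * a + r + Ci * RtoC tau * a) =
  a * v * RtoC (s ^ 2 + tau ^ 2) - 2 * a * RtoC s * r - r * r.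
Proof.
  assert (ECi : Ci * Ci = - (1)) by (apply injective_projections; simpl; ring).
  transitivity (a * (a + v) * RtoC (s ^ 2 + tau ^ 2) - ((RtoC s * a + r) * (RtoC s * a + r)
    - Ci * Ci * RtoC tau * RtoC tau * a * a)); [ring|].
  rewrite ECi, RtoC_plus, !RtoC_pow. ring.
Qed.

Lemma Cmod_tangent_numerator_le (a r v : C) (s tau eta L : R) :
  0 <= eta <= 1 -> Cmod a <= L -> Cmod r <= eta * Rabs s -> Cmod v <= eta ->
  Cmod (a * v * RtoC (s ^ 2 + tau ^ 2) - 2 * a * RtoC s * r - r * r) <=
  (3 * L + 1) * eta * (s ^ 2 + tau ^ 2).
Proof.
  intros He Ha Hr Hv. pose proof (Rabs_pos s). pose proof (Cmod_ge_0 a).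
  pose proof (pow2_abs s) as Es. set (Q := (s ^ 2 + tau ^ 2)%R).
  assert (HQ : 0 <= Q) by (unfold Q; nra).
  eapply Rle_trans; [apply Cmod_minus_le|].
  eapply Rle_trans; [apply Rplus_le_compat_r, Cmod_minus_le|].
  rewrite !Cmod_mult, !Cmod_R, (Rabs_pos_eq 2), (Rabs_pos_eq Q) by lra.
  assert (Cmod a * Cmod v * Q <= L * eta * Q).
  { apply Rmult_le_compat_r; [lra|]. apply Rmult_le_compat; auto using Cmod_ge_0. }
  assert (2 * Cmod a * Rabs s * Cmod r <= 2 * L * Rabs s * (eta * Rabs s)).
  { repeat apply Rmult_le_compat; auto using Cmod_ge_0; nra. }
  assert (Cmod r * Cmod r <= (eta * Rabs s) * (eta * Rabs s)).
  { apply Rmult_le_compat; auto using Cmod_ge_0. }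
  assert (0 <= L * eta * tau ^ 2) by (apply Rmult_le_pos; nra).
  assert (0 <= eta * s ^ 2 * (1 - eta)) by (apply Rmult_le_pos; nra).
  assert (0 <= eta * tau ^ 2) by nra. unfold Q in *. rewrite <- Es in *. nra.
Qed.

(* The tangent line [s a] gives the kernel [2 i tau / (s^2 + tau^2)]; [r] and [v] are the
   deviations of the loop and of its derivative from it. *)
Lemma tangent_kernel_error (a r v : C) (s tau eta L c : R) :
  0 < c -> 0 < tau -> 0 <= eta <= 1 -> Cmod a <= L ->
  Cmod r <= eta * Rabs s -> Cmod v <= eta ->
  let X := RtoC s * a + r - Ci * RtoC tau * a in
  let Y := RtoC s * a + r + Ci * RtoC tau * a in
  c * (tau + Rabs s) <= Cmod X -> c * (tau + Rabs s) <= Cmod Y ->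
  Cmod (2 * Ci * RtoC tau * a / (X * Y) * (a + v) - 2 * Ci * RtoC (tau / (s ^ 2 + tau ^ 2)))
  <= 2 * (3 * L + 1) * eta / c ^ 2 * (tau / (s ^ 2 + tau ^ 2)).
Proof.
  intros Hc Ht He Ha Hr Hv X Y HX HY. pose proof (Rabs_pos s) as Hs.
  pose proof (tangent_numerator_eq a r v s tau) as EN. fold X Y in EN.
  pose proof (Cmod_tangent_numerator_le a r v s tau eta L He Ha Hr Hv) as HN. rewrite <- EN in HN.
  clear EN. set (Q := (s ^ 2 + tau ^ 2)%R) in *.
  assert (HQ : 0 < Q) by (unfold Q; nra). assert (Hc2 : 0 < c ^ 2) by nra.
  assert (Hd : 0 < c * (tau + Rabs s)) by (apply Rmult_lt_0_compat; lra).
  assert (NX : X <> 0) by (apply Cmod_gt_0; lra). assert (NY : Y <> 0) by (apply Cmod_gt_0; lra).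
  assert (NQ : RtoC Q <> 0) by (apply Cmod_gt_0; rewrite Cmod_R, Rabs_pos_eq; lra).
  replace (2 * Ci * RtoC tau * a / (X * Y) * (a + v) - 2 * Ci * RtoC (tau / Q)) with
    (2 * Ci * RtoC tau * (a * (a + v) * RtoC Q - X * Y) / (X * Y * RtoC Q))
    by (rewrite RtoC_div by lra; field; auto).
  replace (2 * (3 * L + 1) * eta / c ^ 2 * (tau / Q))%R with
    (2 * tau * ((3 * L + 1) * eta * Q) / ((c ^ 2 * Q) * Q))%R by (field; lra).
  apply Cmod_div_le.
  - repeat apply Rmult_lt_0_compat; lra.
  - rewrite !Cmod_mult, Cmod_R, (Rabs_pos_eq Q) by lra. apply Rmult_le_compat_r; [lra|].
    apply Rle_trans with ((c * (tau + Rabs s)) * (c * (tau + Rabs s)))%R.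
    + unfold Q. rewrite <- (pow2_abs s). assert (0 <= Rabs s * tau) by nra. nra.
    + apply Rmult_le_compat; lra.
  - rewrite !(Cmod_mult (_ * _)), !Cmod_mult, Cmod_Ci, !Cmod_R, !Rabs_pos_eq, Rmult_1_r by lra.
    apply Rmult_le_compat_l; lra.
Qed.

Lemma CInt_near_atan_kernel (f : R -> C) (tau s0 eps : R) : 0 < tau -> 0 < s0 ->
  continuous_map f ->
  (forall s, - s0 <= s <= s0 ->
    Cmod (f s - 2 * Ci * RtoC (tau / (s ^ 2 + tau ^ 2))) <= eps * (tau / (s ^ 2 + tau ^ 2))) ->
  Cmod (CInt f (- s0) s0 - C2PIi) <= eps * PI + 4 * (tau / s0).
Proof.
  intros Ht Hs Hf B. pose proof (is_RInt_atan tau (- s0) s0 Ht) as I.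
  assert (Ra : 0 < tau / s0) by now apply Rdiv_lt_0_compat.
  pose proof (atan_le_id (tau / s0) ltac:(lra)) as Ha. set (A := atan (tau / s0)) in *.
  replace (atan (s0 / tau) - atan (- s0 / tau))%R with (PI - 2 * A)%R in I.
  2:{ replace (s0 / tau)%R with (/ (tau / s0))%R by (field; lra).
      replace (- s0 / tau)%R with (- / (tau / s0))%R by (field; lra).
      rewrite atan_opp, atan_inv by exact Ra. unfold A. lra. }
  set (kernel := fun s => RtoC (tau / (s ^ 2 + tau ^ 2))).
  assert (Ck : continuous_map kernel) by (unfold kernel; continuity_C; nra).
  assert (Ik : CInt (fun s => 2 * Ci * kernel s) (- s0) s0 = C2PIi - 4 * RtoC A * Ci).
  { rewrite CInt_scal by exact Ck. unfold kernel. rewrite (CInt_RtoC _ _ _ _ I).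
    unfold C2PIi. rewrite RtoC_minus, RtoC_mult. ring. }
  replace (CInt f (- s0) s0 - C2PIi) with
    (CInt (fun s => f s - 2 * Ci * kernel s) (- s0) s0 - 4 * RtoC A * Ci).
  2:{ rewrite CInt_minus, Ik by continuity_C. ring. }
  eapply Rle_trans; [apply Cmod_minus_le|]. apply Rplus_le_compat.
  - apply Rle_trans with (eps * (PI - 2 * A))%R.
    + apply (Cmod_CInt_le _ (fun s => eps * (tau / (s ^ 2 + tau ^ 2)))%R (- s0) s0);
        [lra|continuity_C|exact B|]. exact (is_RInt_scal (V := R_NormedModule) _ _ _ eps _ I).
    + assert (0 <= eps); [|nra]. specialize (B 0%R ltac:(lra)).
      assert (0 < tau / (0 ^ 2 + tau ^ 2)) by (apply Rdiv_lt_0_compat; nra).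
      pose proof (Rle_trans _ _ _ (Cmod_ge_0 _) B). nra.
  - rewrite !Cmod_mult, Cmod_Ci, !Cmod_R, !Rabs_pos_eq by lra. lra.
Qed.

Section WindingNumber.
Variable gam : R -> C.
Hypothesis gam_regular : regular_loop gam.
Notation dg := (dgam gam).
Notation npt := (normal_pt gam).

Let gam_continuous : continuous_map gam := loop_continuous gam gam_regular.
Let gam_periodic : periodic gam := loop_periodic gam gam_regular.
Let dg_continuous : continuous_map dg := dgam_continuous gam gam_regular.

Lemma cauchy_eq_transform (F : C -> C) (z : C) :
  cauchy gam F z = / C2PIi * cauchy_transform gam (fun t => F (gam t) * dg t) z.
Proof. unfold cauchy. f_equal. apply CInt_ext. intros t. unfold Cdiv. ring. Qed.

Lemma wind_eq_cauchy (z : C) : wind gam z = cauchy gam (fun _ => 1) z.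
Proof. unfold wind, cauchy. f_equal. apply CInt_ext. intros t. unfold Cdiv. ring. Qed.

Lemma is_derive_cauchy (F : C -> C) (z : C) :
  continuous_map (fun t => F (gam t)) -> ~ onG gam z ->
  is_derive_CC (cauchy gam F) z
    (/ C2PIi * CInt (fun t => F (gam t) * dg t / ((gam t - z) * (gam t - z))) 0 1).
Proof.
  intros HF Off.
  apply (is_derive_ext (fun w => / C2PIi * cauchy_transform gam (fun t => F (gam t) * dg t) w)).
  { intros w. symmetry. apply cauchy_eq_transform. }
  apply is_derive_CC_scal, is_derive_cauchy_transform; auto. continuity_C.
Qed.

Lemma cauchy_vanishes (F : C -> C) : continuous_map (fun t => F (gam t)) ->
  vanishes_at_infinity (fun _ => True) (cauchy gam F).
Proof.
  intros HF eps He.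
  destruct (cauchy_transform_vanishes gam gam_continuous gam_periodic
    (fun t => F (gam t) * dg t)) with (eps := eps) as [M HM]; [continuity_C; apply HF|exact He|].
  exists M. intros z _ Hz. rewrite cauchy_eq_transform, Cmod_mult.
  specialize (HM z I Hz). pose proof Cmod_inv_C2PIi_le. pose proof (Cmod_ge_0 (/ C2PIi)).
  pose proof (Cmod_ge_0 (cauchy_transform gam (fun t => F (gam t) * dg t) z)). nra.
Qed.

Lemma is_derive_wind (z : C) : ~ onG gam z -> is_derive_CC (wind gam) z (RtoC 0).
Proof.
  intros Off. pose proof (not_onG_neq gam z Off) as N.
  apply (is_derive_ext (cauchy gam (fun _ => 1))).
  { intros w. symmetry. apply wind_eq_cauchy. }
  assert (Zero : CInt (fun t => dg t * - (1 / ((gam t - z) * (gam t - z)))) 0 1 = 0).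
  { rewrite (CInt_derive (fun t => / (gam t - z))).
    - rewrite <- (gam_periodic 0%R), Rplus_0_l. ring.
    - intros t. apply (is_derive_RC_comp (fun w => / (w - z)));
        [|exact (loop_derive gam gam_regular t)].
      apply (is_derive_CC_inv (fun w => w - z)); [|apply N].
      apply is_derive_CC_minus_const, is_derive_CC_id.
    - continuity_C. now apply Cmult_neq_0. }
  replace (RtoC 0) with
    (/ C2PIi * CInt (fun t => 1 * dg t / ((gam t - z) * (gam t - z))) 0 1).
  - apply (is_derive_cauchy (fun _ => 1)); [continuity_C|exact Off].
  - rewrite (CInt_ext _ (fun t => (- (1)) * (dg t * - (1 / ((gam t - z) * (gam t - z)))))).
    + rewrite CInt_scal, Zero by (continuity_C; now apply Cmult_neq_0). ring.
    + intros t. unfold Cdiv. ring.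
Qed.

Lemma wind_locally_constant (z : C) : ~ onG gam z ->
  @locally C_UniformSpace z (fun w => wind gam w = wind gam z).
Proof.
  intros Off. destruct (not_onG_dist gam gam_continuous gam_periodic z Off) as (d & Hd & D).
  apply locally_Cmod. exists d. split; [exact Hd|]. apply is_derive_CC_0_constant.
  intros w Hw. apply is_derive_wind, (dist_not_onG gam w (d - Cmod (w - z))); [lra|].
  now apply dist_perturb.
Qed.

Lemma wind_extD (z : C) : extD gam z -> wind gam z = 0.
Proof.
  intros [_ Path]. apply Ceq_of_Cmod_le. intros eps He.
  destruct (cauchy_vanishes (fun _ => 1) ltac:(continuity_C) eps He) as [M HM].
  destruct (Path M) as (p & Hp & P0 & P1 & Off).
  rewrite <- P0, (locally_constant_path (wind gam) p Hp), wind_eq_cauchy.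
  - replace (cauchy gam (fun _ => 1) (p 1%R) - 0) with (cauchy gam (fun _ => 1) (p 1%R)) by ring.
    left. now apply HM.
  - intros s Hs. now apply wind_locally_constant, Off.
Qed.

Definition cauchy_kernel (z w : C) (t : R) : C := (z - w) / ((gam t - z) * (gam t - w)) * dg t.

Lemma cauchy_kernel_continuous (z w : C) : ~ onG gam z -> ~ onG gam w ->
  continuous_map (cauchy_kernel z w).
Proof.
  intros Oz Ow. pose proof (not_onG_neq gam z Oz). pose proof (not_onG_neq gam w Ow).
  unfold cauchy_kernel. continuity_C. now apply Cmult_neq_0.
Qed.

Lemma cauchy_kernel_periodic (z w : C) : periodic (cauchy_kernel z w).
Proof.
  intros t. unfold cauchy_kernel. now rewrite gam_periodic, (dgam_periodic gam gam_regular).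
Qed.

Lemma Cmod_cauchy_kernel_le (z w : C) (t a b k L : R) : 0 < a -> 0 < b ->
  a <= Cmod (gam t - z) -> b <= Cmod (gam t - w) -> Cmod (z - w) <= k -> Cmod (dg t) <= L ->
  Cmod (cauchy_kernel z w t) <= k / (a * b) * L.
Proof.
  intros Ha Hb Hz Hw Hk HL. unfold cauchy_kernel. rewrite Cmod_mult.
  apply Rmult_le_compat; auto using Cmod_ge_0. apply Cmod_div_le; auto.
  - now apply Rmult_lt_0_compat.
  - rewrite Cmod_mult. apply Rmult_le_compat; lra.
Qed.

Lemma cauchy_minus (F : C -> C) (A z w : C) :
  continuous_map (fun t => F (gam t)) -> ~ onG gam z -> ~ onG gam w ->
  cauchy gam F z - cauchy gam F w - A * (wind gam z - wind gam w) =
  / C2PIi * CInt (fun t => (F (gam t) - A) * cauchy_kernel z w t) 0 1.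
Proof.
  intros HF Oz Ow. pose proof (not_onG_neq gam z Oz) as Nz. pose proof (not_onG_neq gam w Ow) as Nw.
  rewrite !wind_eq_cauchy, !cauchy_eq_transform.
  set (T := cauchy_transform gam). set (h := fun t => F (gam t) * dg t).
  transitivity (/ C2PIi * ((T h z - T h w) -
    A * (T (fun t => 1 * dg t) z - T (fun t => 1 * dg t) w))); [ring|].
  assert (Ch : continuous_map h) by (unfold h; continuity_C).
  f_equal. unfold T, cauchy_transform. rewrite <- !CInt_minus, <- CInt_scal, <- CInt_minus
    by continuity_C.
  apply CInt_ext. intros t. unfold h, cauchy_kernel. field. auto.
Qed.

Lemma wind_minus (z w : C) : ~ onG gam z -> ~ onG gam w ->
  wind gam z - wind gam w = / C2PIi * CInt (cauchy_kernel z w) 0 1.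
Proof.
  intros Oz Ow. pose proof (cauchy_minus (fun _ => 1) 0 z w ltac:(continuity_C) Oz Ow) as E.
  rewrite <- !wind_eq_cauchy in E.
  replace (wind gam z - wind gam w) with (wind gam z - wind gam w - 0 * (wind gam z - wind gam w))
    by ring.
  rewrite E. f_equal. apply CInt_ext. intros t. ring.
Qed.

Lemma normal_pt_opp_minus (t tau : R) : npt t tau - npt t (- tau) = 2 * Ci * RtoC tau * dg t.
Proof. unfold normal_pt. rewrite RtoC_opp. ring. Qed.

Lemma cauchy_kernel_tangent (c L eta s0 t tau : R) :
  0 < c -> 0 < tau -> 0 < eta <= 1 -> s0 <= 1 / 2 -> (forall u, Cmod (dg u) <= L) ->
  (forall s, Rabs s <= s0 -> Cmod (dg (t + s) - dg t) <= eta /\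
    Cmod (gam (t + s) - gam t - RtoC s * dg t) <= eta * Rabs s) ->
  depth_ge gam c t tau (npt t tau) -> depth_ge gam c t tau (npt t (- tau)) ->
  forall s, Rabs s <= s0 ->
  Cmod (cauchy_kernel (npt t tau) (npt t (- tau)) (t + s) - 2 * Ci * RtoC (tau / (s ^ 2 + tau ^ 2)))
  <= 2 * (3 * L + 1) * eta / c ^ 2 * (tau / (s ^ 2 + tau ^ 2)).
Proof.
  intros Hc Ht He Hs0 BL Der Dz Dw s Hs. destruct (Der s Hs) as [Hv Hr].
  specialize (Dz s ltac:(lra)). specialize (Dw s ltac:(lra)).
  unfold cauchy_kernel. rewrite normal_pt_opp_minus. unfold normal_pt in *.
  rewrite RtoC_opp in *.
  set (a := dg t) in *. set (r := gam (t + s) - gam t - RtoC s * a) in *.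
  set (v := dg (t + s) - a) in *.
  replace (dg (t + s)) with (a + v) by (unfold v; ring).
  replace (gam (t + s) - (gam t + Ci * RtoC tau * a))
    with (RtoC s * a + r - Ci * RtoC tau * a) in *
    by (unfold r; ring).
  replace (gam (t + s) - (gam t + Ci * - RtoC tau * a))
    with (RtoC s * a + r + Ci * RtoC tau * a) in *
    by (unfold r; ring).
  apply tangent_kernel_error; auto; [lra|apply BL].
Qed.

Lemma Cmod_cauchy_kernel_far (c L s0 t tau : R) :
  0 < c -> 0 < tau -> 0 < s0 -> (forall u, Cmod (dg u) <= L) ->
  depth_ge gam c t tau (npt t tau) -> depth_ge gam c t tau (npt t (- tau)) ->
  forall s, s0 <= Rabs s <= 1 / 2 ->
  Cmod (cauchy_kernel (npt t tau) (npt t (- tau)) (t + s)) <= 2 * tau * L / (c * s0 * (c * s0)) * L.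
Proof.
  intros Hc Ht Hs0 BL Dz Dw s Hs. specialize (Dz s (proj2 Hs)). specialize (Dw s (proj2 Hs)).
  apply Cmod_cauchy_kernel_le; auto; try nra.
  rewrite normal_pt_opp_minus, !Cmod_mult, Cmod_Ci, !Cmod_R, !Rabs_pos_eq, Rmult_1_r by lra.
  apply Rmult_le_compat_l; [lra|apply BL].
Qed.

Lemma CInt_cauchy_kernel_minus_C2PIi (c L s0 eps t tau : R) :
  0 < c -> 0 < tau -> 0 < s0 <= 1 / 2 -> (forall u, Cmod (dg u) <= L) ->
  depth_ge gam c t tau (npt t tau) -> depth_ge gam c t tau (npt t (- tau)) ->
  (forall s, Rabs s <= s0 -> Cmod (cauchy_kernel (npt t tau) (npt t (- tau)) (t + s)
    - 2 * Ci * RtoC (tau / (s ^ 2 + tau ^ 2))) <= eps * (tau / (s ^ 2 + tau ^ 2))) ->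
  Cmod (CInt (cauchy_kernel (npt t tau) (npt t (- tau))) 0 1 - C2PIi)
  <= eps * PI + 4 * (tau / s0) + 2 * tau * L / (c * s0 * (c * s0)) * L.
Proof.
  intros Hc Ht Hs0 BL Dz Dw Tangent.
  set (K := cauchy_kernel (npt t tau) (npt t (- tau))) in *.
  set (B := (2 * tau * L / (c * s0 * (c * s0)) * L)%R).
  assert (CK : continuous_map K).
  { apply cauchy_kernel_continuous; eapply (depth_ge_not_onG gam gam_regular c t tau); eauto. }
  assert (CKt : continuous_map (fun s => K (t + s)%R)) by continuity_C.
  rewrite (CInt_period_centered K t CK (cauchy_kernel_periodic _ _)).
  rewrite <- (CInt_Chasles _ _ (- s0)), <- (CInt_Chasles _ (- s0) s0) by exact CKt.
  assert (Near : Cmod (CInt (fun s => K (t + s)%R) (- s0) s0 - C2PIi) <= eps * PI + 4 * (tau / s0)).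
  { apply CInt_near_atan_kernel; [lra|lra|exact CKt|]. intros s Hs. now apply Tangent, Rabs_le. }
  assert (Far : forall a b, a <= b <= a + 1 / 2 ->
    (forall s, a <= s <= b -> s0 <= Rabs s <= 1 / 2) ->
    Cmod (CInt (fun s => K (t + s)%R) a b) <= 1 / 2 * B).
  { intros a b Hab Hs.
    assert (HB : 0 <= B).
    { eapply Rle_trans; [apply Cmod_ge_0|].
      apply (Cmod_cauchy_kernel_far c L s0 t tau) with (s := a); auto; [lra|apply Hs; lra]. }
    apply Rle_trans with (Rabs (b - a) * B)%R.
    - apply Cmod_CInt_le_const; [exact CKt|]. intros s Hs'.
      rewrite Rmin_left, Rmax_right in Hs' by lra.
      apply Cmod_cauchy_kernel_far; auto; lra.
    - apply Rmult_le_compat_r; [exact HB|]. rewrite Rabs_pos_eq; lra. }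
  pose proof (Far (- (1 / 2))%R (- s0)%R ltac:(lra) ltac:(intros; rewrite Rabs_left1; lra)) as Fl.
  pose proof (Far s0 (1 / 2)%R ltac:(lra) ltac:(intros; rewrite Rabs_pos_eq; lra)) as Fr.
  set (Il := CInt _ (- (1 / 2)) (- s0)) in *. set (Ic := CInt _ (- s0) s0) in *.
  set (Ir := CInt _ s0 (1 / 2)) in *.
  replace (Il + (Ic + Ir) - C2PIi) with ((Ic - C2PIi) + (Il + Ir)) by ring.
  eapply Rle_trans; [apply Cmod_triangle|]. pose proof (Cmod_triangle Il Ir). lra.
Qed.

Lemma CInt_cauchy_kernel_jump : exists tau0, 0 < tau0 /\ forall t tau, 0 < tau <= tau0 ->
  ~ onG gam (npt t tau) /\ ~ onG gam (npt t (- tau)) /\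
  Cmod (CInt (cauchy_kernel (npt t tau) (npt t (- tau))) 0 1 - C2PIi) <= 1 / 2 * PI + 1.
Proof.
  destruct (dgam_bounded gam gam_regular) as (L & HL & BL).
  destruct (normal_pt_depth gam gam_regular) as (c & tau1 & Hc & Ht1 & Depth).
  assert (Hc2 : 0 < c ^ 2) by nra.
  set (eta := Rmin 1 (c ^ 2 / (4 * (3 * L + 1)))).
  assert (He : 0 < eta <= 1).
  { split; [apply Rmin_pos; [lra|apply Rdiv_lt_0_compat; lra]|apply Rmin_l]. }
  assert (Hk : 2 * (3 * L + 1) * eta / c ^ 2 <= 1 / 2).
  { apply Rle_div_l; [exact Hc2|]. pose proof (Rmin_r 1 (c ^ 2 / (4 * (3 * L + 1)))) as Q.
    fold eta in Q. apply Rle_div_r in Q; lra. }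
  destruct (loop_uniform_derive gam gam_regular eta (proj1 He)) as (s0 & Hs0 & Der).
  set (q := (c * s0 * (c * s0) / (4 * L * L))%R).
  assert (Hq : 0 < q).
  { apply Rdiv_lt_0_compat; [repeat apply Rmult_lt_0_compat; lra|nra]. }
  exists (Rmin tau1 (Rmin (s0 / 8) q)). split; [repeat apply Rmin_pos; lra|]. intros t tau Htau.
  pose proof (Rmin_l tau1 (Rmin (s0 / 8) q)). pose proof (Rmin_r tau1 (Rmin (s0 / 8) q)).
  pose proof (Rmin_l (s0 / 8) q). pose proof (Rmin_r (s0 / 8) q).
  assert (Dzw : depth_ge gam c t tau (npt t tau) /\ depth_ge gam c t tau (npt t (- tau))).
  { pose proof (Depth t tau) as D. pose proof (Depth t (- tau)%R) as D'.
    rewrite Rabs_Ropp in D'. rewrite Rabs_pos_eq in D, D' by lra. split; [apply D|apply D']; lra. }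
  destruct Dzw as [Dz Dw].
  split; [|split]; try (eapply (depth_ge_not_onG gam gam_regular c t tau); eauto; lra).
  eapply Rle_trans.
  - apply (CInt_cauchy_kernel_minus_C2PIi c L s0 (1 / 2)); auto; [lra|]. intros s Hs.
    eapply Rle_trans; [apply (cauchy_kernel_tangent c L eta s0); auto; lra|].
    apply Rmult_le_compat_r; [|exact Hk]. left. apply Rdiv_lt_0_compat; nra.
  - replace (2 * tau * L / (c * s0 * (c * s0)) * L)%R with (1 / 2 * (tau / q))%R
      by (unfold q; field; lra).
    assert (tau / q <= 1) by (apply Rle_div_l; lra).
    assert (tau / s0 <= 1 / 8) by (apply Rle_div_l; lra). lra.
Qed.

Lemma sides_of_loop : pos_oriented gam -> exists tau0, 0 < tau0 /\
  forall t tau, 0 < tau <= tau0 -> intD gam (npt t tau) /\ extD gam (npt t (- tau)).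
Proof.
  intros Hpos. destruct CInt_cauchy_kernel_jump as (tau0 & Ht0 & Jump).
  exists tau0. split; [exact Ht0|]. intros t tau Htau. destruct (Jump t tau Htau) as (Oz & Ow & J).
  set (z := npt t tau) in *. set (w := npt t (- tau)) in *.
  assert (Hw : Cmod (wind gam z - wind gam w - 1) < 1).
  { rewrite wind_minus by auto. set (I := CInt _ 0 1) in *.
    replace (/ C2PIi * I - 1) with (/ C2PIi * (I - C2PIi)) by (field; apply C2PIi_neq_0).
    rewrite Cmod_mult. pose proof Cmod_inv_C2PIi_le. pose proof (Cmod_ge_0 (/ C2PIi)).
    pose proof PI_4. pose proof (Cmod_ge_0 (I - C2PIi)). nra. }
  destruct (classic (extD gam z)) as [Ez|Iz]; [|destruct (classic (extD gam w)) as [Ew|Iw]].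
  - exfalso. apply (Rlt_not_le _ _ Hw). rewrite (wind_extD z Ez).
    destruct (classic (extD gam w)) as [Ew|Iw].
    + rewrite (wind_extD w Ew). replace (0 - 0 - 1) with (- (1)) by ring. rewrite Cmod_m1. lra.
    + rewrite (Hpos w) by now split. replace (0 - 1 - 1) with (RtoC (- 2)).
      * rewrite Cmod_R, Rabs_left; lra.
      * apply injective_projections; simpl; ring.
  - split; [now split|exact Ew].
  - exfalso. apply (Rlt_not_le _ _ Hw). rewrite (Hpos z), (Hpos w) by now split.
    replace (1 - 1 - 1) with (- (1)) by ring. rewrite Cmod_m1. lra.
Qed.

End WindingNumber.

(** * Hölder functions and their boundary limits *)

Lemma Rpower_gt_0 (x a : R) : 0 < Rpower x a.
Proof. apply exp_pos. Qed.

Lemma Rpower_scale_le (k x a : R) : 1 <= k -> 0 < x -> 0 <= a <= 1 ->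
  Rpower (k * x) a <= k * Rpower x a.
Proof.
  intros Hk Hx Ha. rewrite <- Rpower_mult_distr by lra.
  apply Rmult_le_compat_r; [left; apply Rpower_gt_0|].
  rewrite <- (Rpower_1 k) at 2 by lra. apply Rle_Rpower; lra.
Qed.

Lemma Rpower_minus_1 (x a : R) : 0 < x -> (Rpower x (a - 1) = Rpower x a / x)%R.
Proof. intros Hx. unfold Rminus. now rewrite Rpower_plus, Rpower_Ropp, Rpower_1. Qed.

Lemma Rpower_small (a K eps : R) : 0 < a -> 0 < eps ->
  exists r, 0 < r /\ forall x, 0 < x <= r -> K * Rpower x a < eps.
Proof.
  intros Ha He. pose proof (Rabs_pos K). set (y := (eps / (Rabs K + 1))%R).
  assert (Hy : 0 < y) by (apply Rdiv_lt_0_compat; lra).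
  assert (Ey : (y * (Rabs K + 1) = eps)%R) by (unfold y; field; lra).
  exists (Rpower y (/ a)). split; [apply Rpower_gt_0|]. intros x Hx.
  assert (Rpower x a <= y).
  { rewrite <- (Rpower_1 y), <- (Rinv_l a), <- Rpower_mult by lra. apply Rle_Rpower_l; lra. }
  pose proof (Rpower_gt_0 x a). pose proof (Rle_abs K). nra.
Qed.

Section Holder.
Variables (sigma : R) (S : C -> Prop).

Lemma holder_modulus (f : C -> C) : 0 < sigma -> holder sigma S f ->
  exists K, 0 <= K /\ forall z w r, S z -> S w -> 0 < r -> Cmod (z - w) <= r ->
    Cmod (f z - f w) <= K * Rpower r sigma.
Proof.
  intros Hs [K H]. exists (Rabs K). split; [apply Rabs_pos|]. intros z w r Hz Hw Hr Hzw.
  pose proof (Rabs_pos K). pose proof (Rpower_gt_0 r sigma).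
  destruct (classic (z = w)) as [->|N]; [rewrite Cmod_minus_diag; nra|].
  pose proof (Rpower_gt_0 (Cmod (z - w)) sigma). pose proof (Rle_abs K).
  assert (Rpower (Cmod (z - w)) sigma <= Rpower r sigma).
  { apply Rle_Rpower_l; [lra|]. split; [now apply Cmod_minus_gt_0|exact Hzw]. }
  eapply Rle_trans; [now apply H|]. nra.
Qed.

Lemma holder_subset (T : C -> Prop) (f : C -> C) :
  (forall z, T z -> S z) -> holder sigma S f -> holder sigma T f.
Proof. intros TS [K H]. exists K. auto. Qed.

Lemma holder_ext (f g : C -> C) :
  (forall z, S z -> f z = g z) -> holder sigma S f -> holder sigma S g.
Proof. intros E [K H]. exists K. intros z w Hz Hw N. rewrite <- !E by auto. auto. Qed.

Lemma holder_const (c : C) : holder sigma S (fun _ => c).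
Proof. exists 0%R. intros z w _ _ _. rewrite Cmod_minus_diag. lra. Qed.

Lemma holder_opp (f : C -> C) : holder sigma S f -> holder sigma S (fun z => - f z).
Proof.
  intros [K H]. exists K. intros z w Hz Hw N.
  replace (- f z - - f w) with (- (f z - f w)) by ring. rewrite Cmod_opp. auto.
Qed.

Lemma holder_conj (f : C -> C) : holder sigma S f -> holder sigma S (fun z => Cconj (f z)).
Proof. intros [K H]. exists K. intros z w Hz Hw N. rewrite <- Cminus_conj, Cmod_conj. auto. Qed.

Lemma holder_plus (f g : C -> C) :
  holder sigma S f -> holder sigma S g -> holder sigma S (fun z => f z + g z).
Proof.
  intros [K HK] [M HM]. exists (K + M)%R. intros z w Hz Hw N.
  replace (f z + g z - (f w + g w)) with ((f z - f w) + (g z - g w)) by ring.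
  eapply Rle_trans; [apply Cmod_triangle|].
  specialize (HK z w Hz Hw N). specialize (HM z w Hz Hw N). lra.
Qed.

Lemma holder_of_locally_holder (f : C -> C) (K M r0 : R) : 0 < sigma -> 0 < r0 ->
  (forall z w, S z -> S w -> z <> w -> Cmod (z - w) <= r0 ->
    Cmod (f z - f w) <= K * Rpower (Cmod (z - w)) sigma) ->
  (forall z, S z -> Cmod (f z) <= M) -> holder sigma S f.
Proof.
  intros Hs Hr0 Local Bound. pose proof (Rpower_gt_0 r0 sigma) as P0.
  exists (Rmax K (2 * M / Rpower r0 sigma)). intros z w Hz Hw N.
  pose proof (Rpower_gt_0 (Cmod (z - w)) sigma).
  destruct (Rle_dec (Cmod (z - w)) r0) as [Near|Far].
  - eapply Rle_trans; [now apply Local|]. apply Rmult_le_compat_r; [lra|apply Rmax_l].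
  - pose proof (Bound z Hz). pose proof (Bound w Hw). pose proof (Cmod_ge_0 (f z)).
    apply Rle_trans with (2 * M / Rpower r0 sigma * Rpower (Cmod (z - w)) sigma)%R.
    2:{ apply Rmult_le_compat_r; [lra|apply Rmax_r]. }
    apply Rle_trans with (2 * M / Rpower r0 sigma * Rpower r0 sigma)%R.
    + replace (2 * M / Rpower r0 sigma * Rpower r0 sigma)%R with (2 * M)%R by (field; lra).
      pose proof (Cmod_minus_le (f z) (f w)). lra.
    + apply Rmult_le_compat_l; [apply Rle_div_r; lra|]. apply Rle_Rpower_l; lra.
Qed.

Lemma holder_filterlim (f : C -> C) (z : C) : 0 < sigma -> holder sigma S f -> S z ->
  filterlim f (within S (locally z)) (locally (f z)).
Proof.
  intros Hs Hf Hz. destruct (holder_modulus f Hs Hf) as (K & HK & Mod).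
  apply filterlim_within_Cmod. intros eps He.
  destruct (Rpower_small sigma K eps Hs He) as (r & Hr & Small).
  exists r. split; [exact Hr|]. intros w Hw Near.
  eapply Rle_lt_trans; [apply (Mod w z r); auto; lra|]. apply Small. lra.
Qed.

End Holder.

Definition lim_within (f : C -> C) (S : C -> Prop) (z : C) : C :=
  epsilon (inhabits (RtoC 0)) (fun l => filterlim f (within S (locally z)) (locally l)).

Section LimWithin.
Variable S : C -> Prop.

Lemma subset_clos (z : C) : S z -> clos S z.
Proof. intros Hz eps He. exists z. now rewrite Cmod_minus_diag. Qed.

Lemma within_clos_proper (z : C) : clos S z -> ProperFilter (within S (@locally C_UniformSpace z)).
Proof.
  intros Hz. constructor; [|apply within_filter, locally_filter].
  intros P HP. apply locally_Cmod in HP as (d & Hd & HP).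
  destruct (Hz d Hd) as (w & Hw & Near). exists w. auto.
Qed.

Lemma lim_within_unique (f : C -> C) (z l : C) : clos S z ->
  filterlim f (within S (locally z)) (locally l) -> lim_within f S z = l.
Proof.
  intros Hz Hl. pose proof (within_clos_proper z Hz) as PF.
  apply (filterlim_locally_unique (V := C_R_NormedModule) (F := within S (locally z)) f); auto.
  apply (epsilon_spec (inhabits (RtoC 0))
    (fun l => filterlim f (within S (locally z)) (locally l))). now exists l.
Qed.

Lemma lim_within_holder (sigma : R) (f : C -> C) (z : C) :
  0 < sigma -> holder sigma S f -> clos S z ->
  filterlim f (within S (locally z)) (locally (lim_within f S z)).
Proof.
  intros Hs Hf Hz. pose proof (within_clos_proper z Hz) as PF.
  destruct (holder_modulus sigma S f Hs Hf) as (K & HK & Mod).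
  apply (epsilon_spec (inhabits (RtoC 0))
    (fun l => filterlim f (within S (locally z)) (locally l))).
  apply (filterlim_locally_cauchy (U := C_R_CompleteNormedModule)). intros eps.
  destruct (Rpower_small sigma K eps Hs (cond_pos eps)) as (r & Hr & Small).
  exists (fun w => S w /\ Cmod (w - z) < r / 2). split.
  - apply locally_Cmod. exists (r / 2)%R. split; [lra|auto].
  - intros u v [Su Hu] [Sv Hv]. apply C_NormedModule_mixin_compat1.
    apply Rle_lt_trans with (K * Rpower r sigma)%R; [|apply Small; lra].
    apply (Mod v u); auto. pose proof (Cmod_minus_triangle v z u) as T.
    rewrite (Cmod_minus_sym z u) in T. lra.
Qed.

Lemma lim_within_eq (sigma : R) (f g : C -> C) (z : C) : 0 < sigma ->
  holder sigma (clos S) g -> (forall w, S w -> f w = g w) -> clos S z -> lim_within f S z = g z.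
Proof.
  intros Hs Hg E Hz. apply lim_within_unique; [exact Hz|].
  apply (filterlim_within_ext S g); [intros w Hw; symmetry; auto|].
  pose proof (holder_filterlim sigma (clos S) g z Hs Hg Hz) as Lim.
  rewrite filterlim_within_Cmod in *. intros eps He. destruct (Lim eps He) as (d & Hd & D).
  exists d. split; [exact Hd|]. intros w Hw. now apply D, subset_clos.
Qed.

Lemma lim_within_interior (sigma : R) (f : C -> C) (z : C) :
  0 < sigma -> holder sigma S f -> S z -> lim_within f S z = f z.
Proof.
  intros Hs Hf Hz. apply lim_within_unique; [now apply subset_clos|].
  now apply (holder_filterlim sigma).
Qed.

Lemma holder_lim_within (sigma : R) (f : C -> C) : 0 < sigma <= 1 ->
  holder sigma S f -> holder sigma (clos S) (lim_within f S).
Proof.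
  intros Hs Hf. destruct (holder_modulus sigma S f (proj1 Hs) Hf) as (K & HK & Mod).
  assert (Approx : forall z d, clos S z -> 0 < d ->
    exists w, S w /\ Cmod (w - z) < d /\ Cmod (f w - lim_within f S z) < Rpower d sigma).
  { intros z d Hz Hd. pose proof (Rpower_gt_0 d sigma) as P.
    pose proof (lim_within_holder sigma f z (proj1 Hs) Hf Hz) as Lim.
    destruct (proj1 (filterlim_within_Cmod _ _ _ _) Lim _ P) as (e & He & Near).
    destruct (Hz (Rmin d e)) as (w & Hw & Dw); [now apply Rmin_pos|].
    apply Rmin_Rgt in Dw as [Dd De]. exists w. auto. }
  exists (2 + 3 * K)%R. intros z w Hz Hw N.
  set (r := Cmod (z - w)). assert (Hr : 0 < r) by now apply Cmod_minus_gt_0.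
  destruct (Approx z r Hz Hr) as (z' & Sz & Dz & Lz).
  destruct (Approx w r Hw Hr) as (w' & Sw & Dw & Lw).
  assert (Hfzw : Cmod (f z' - f w') <= K * Rpower (3 * r) sigma).
  { apply Mod; auto; [lra|]. pose proof (Cmod_minus_triangle z' z w') as T.
    pose proof (Cmod_minus_triangle z w w') as T'. rewrite (Cmod_minus_sym w w') in T'.
    fold r in T'. lra. }
  pose proof (Rpower_scale_le 3 r sigma ltac:(lra) Hr ltac:(lra)) as Scale.
  apply (Rmult_le_compat_l K) in Scale; [|exact HK].
  pose proof (Cmod_minus_triangle (lim_within f S z) (f z') (lim_within f S w)) as T.
  pose proof (Cmod_minus_triangle (f z') (f w') (lim_within f S w)) as T'.
  rewrite (Cmod_minus_sym _ (f z')) in T. lra.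
Qed.

End LimWithin.

(** * Hölder continuity of Cauchy integrals up to the loop *)

Lemma is_RInt_Rpower_shift (p d a b : R) : p <> 0%R -> 0 < d + a -> a <= b ->
  is_RInt (fun u => Rpower (d + u) (p - 1)) a b ((Rpower (d + b) p - Rpower (d + a) p) / p)%R.
Proof.
  intros Np Ha Hab.
  assert (Der : forall q u, 0 < d + u ->
    is_derive (fun u => Rpower (d + u) q) u (q * Rpower (d + u) (q - 1))%R).
  { intros q u Hu. rewrite <- (Rmult_1_l (q * _)).
    apply (is_derive_comp (K := R_AbsRing) (V := R_NormedModule)
      (fun x => Rpower x q) (fun u => d + u)%R).
    - now apply is_derive_Reals, derivable_pt_lim_power.
    - auto_derive; auto; ring. }
  replace ((Rpower (d + b) p - Rpower (d + a) p) / p)%R with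
    (minus (/ p * Rpower (d + b) p) (/ p * Rpower (d + a) p))%R
    by (unfold minus, plus, opp; simpl; field; exact Np).
  apply (is_RInt_derive (V := R_CompleteNormedModule) (fun u => / p * Rpower (d + u) p)%R);
    rewrite Rmin_left, Rmax_right by exact Hab; intros u Hu.
  - replace (Rpower (d + u) (p - 1)) with (/ p * (p * Rpower (d + u) (p - 1)))%R
      by (field; exact Np).
    apply is_derive_scal, Der. lra.
  - apply (ex_derive_continuous (V := R_NormedModule)). eexists. apply Der. lra.
Qed.

Definition weak_kernel (sigma d delta u : R) : R :=
  (Rpower (d + u) (sigma - 1) * (delta / (delta + u)))%R.

Section WeakKernel.
Variables sigma d delta : R.
Hypothesis sigma_range : 0 < sigma < 1.
Hypothesis d_le_delta : 0 < d <= delta.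

Lemma ex_RInt_weak_kernel (a b : R) : 0 <= a <= b -> ex_RInt (weak_kernel sigma d delta) a b.
Proof.
  intros Hab. apply (ex_RInt_continuous (V := R_CompleteNormedModule)).
  rewrite Rmin_left, Rmax_right by lra. intros u Hu.
  apply (ex_derive_continuous (V := R_NormedModule)). unfold weak_kernel, Rpower.
  auto_derive. lra.
Qed.

Lemma RInt_weak_kernel_near :
  RInt (weak_kernel sigma d delta) 0 delta <= 2 / sigma * Rpower delta sigma.
Proof.
  pose proof (RInt_correct _ _ _ (ex_RInt_weak_kernel 0 delta ltac:(lra))) as I.
  pose proof (is_RInt_Rpower_shift sigma d 0 delta ltac:(lra) ltac:(lra) ltac:(lra)) as J.
  eapply Rle_trans; [apply (is_RInt_le _ _ 0 delta _ _ ltac:(lra) I J)|].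
  - intros u Hu. unfold weak_kernel. rewrite <- (Rmult_1_r (Rpower _ _)) at 2.
    apply Rmult_le_compat_l; [left; apply Rpower_gt_0|]. apply Rle_div_l; lra.
  - apply Rle_div_l; [lra|]. pose proof (Rpower_gt_0 (d + 0) sigma).
    replace (2 / sigma * Rpower delta sigma * sigma)%R with (2 * Rpower delta sigma)%R
      by (field; lra).
    pose proof (Rpower_scale_le 2 delta sigma ltac:(lra) ltac:(lra) ltac:(lra)).
    assert (Rpower (d + delta) sigma <= Rpower (2 * delta) sigma) by (apply Rle_Rpower_l; lra). lra.
Qed.

Lemma RInt_weak_kernel_far (a : R) : delta <= a ->
  RInt (weak_kernel sigma d delta) delta a <= 1 / (1 - sigma) * Rpower delta sigma.
Proof.
  intros Ha. pose proof (RInt_correct _ _ _ (ex_RInt_weak_kernel delta a ltac:(lra))) as I.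
  pose proof (is_RInt_Rpower_shift (sigma - 1) d delta a ltac:(lra) ltac:(lra) Ha) as J.
  apply (is_RInt_scal (V := R_NormedModule) _ _ _ delta) in J.
  eapply Rle_trans; [apply (is_RInt_le _ _ delta a _ _ Ha I J)|].
  - intros u Hu. unfold weak_kernel. rewrite (Rpower_minus_1 _ (sigma - 1)) by lra.
    assert (P : 0 < Rpower (d + u) (sigma - 1)) by apply Rpower_gt_0.
    apply Rle_trans with (Rpower (d + u) (sigma - 1) * (delta / (d + u)))%R.
    + repeat (apply Rmult_le_compat_l; [lra|]). apply Rinv_le_contravar; lra.
    + right. unfold scal; simpl; unfold mult; simpl. field. lra.
  - assert (Mono : Rpower (d + delta) (sigma - 1) <= Rpower delta (sigma - 1)).
    { replace (sigma - 1)%R with (- (1 - sigma))%R by ring. rewrite !Rpower_Ropp.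
      apply Rinv_le_contravar; [apply Rpower_gt_0|]. apply Rle_Rpower_l; lra. }
    rewrite (Rpower_minus_1 delta) in Mono by lra. apply Rle_div_r in Mono; [|lra].
    pose proof (Rpower_gt_0 (d + a) (sigma - 1)). unfold scal; simpl; unfold mult; simpl.
    replace (1 / (1 - sigma) * Rpower delta sigma)%R with (Rpower delta sigma / (1 - sigma))%R
      by (field; lra).
    replace (delta *
      ((Rpower (d + a) (sigma - 1) - Rpower (d + delta) (sigma - 1)) / (sigma - 1)))%R
      with ((Rpower (d + delta) (sigma - 1) * delta - Rpower (d + a) (sigma - 1) * delta)
        / (1 - sigma))%R by (field; lra).
    apply Rmult_le_compat_r; [left; apply Rinv_0_lt_compat; lra|]. nra.
Qed.

Lemma RInt_weak_kernel_le (a : R) : delta <= a ->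
  RInt (weak_kernel sigma d delta) 0 a <= (2 / sigma + 1 / (1 - sigma)) * Rpower delta sigma.
Proof.
  intros Ha. pose proof RInt_weak_kernel_near. pose proof (RInt_weak_kernel_far a Ha).
  rewrite <- (RInt_Chasles _ 0 delta a) by (apply ex_RInt_weak_kernel; lra).
  unfold plus; simpl. lra.
Qed.

End WeakKernel.

(* [U] is the side of the loop towards which the normal [e i gam'] points, and [kappa] the
   winding number there. *)
Record collar (gam : R -> C) (U : C -> Prop) (e kappa L c tau0 : R) : Prop := {
  collar_sign : Rabs e = 1%R;
  collar_const_pos : 0 < c;
  collar_width : 0 < tau0 <= 1 / 2;
  collar_speed : forall t, Cmod (dgam gam t) <= L;
  collar_wind : forall z, U z -> wind gam z = RtoC kappa;
  collar_normal : forall t tau, 0 < tau <= tau0 -> U (normal_pt gam t (e * tau));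
  collar_depth : forall t tau, 0 < tau <= tau0 -> depth_ge gam c t tau (normal_pt gam t (e * tau));
  collar_cover : forall z, U z ->
    (exists t tau, 0 < tau <= tau0 /\ z = normal_pt gam t (e * tau)) \/
    (forall t, c <= Cmod (gam t - z))
}.

Arguments collar_sign {gam U e kappa L c tau0} _.
Arguments collar_const_pos {gam U e kappa L c tau0} _.
Arguments collar_width {gam U e kappa L c tau0} _.
Arguments collar_speed {gam U e kappa L c tau0} _ t.
Arguments collar_wind {gam U e kappa L c tau0} _ z.
Arguments collar_normal {gam U e kappa L c tau0} _ t tau.
Arguments collar_depth {gam U e kappa L c tau0} _ t tau.
Arguments collar_cover {gam U e kappa L c tau0} _ z.

Section Privalov.
Variable gam : R -> C.
Hypothesis gam_regular : regular_loop gam.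
Variable sigma : R.
Hypothesis sigma_range : 0 < sigma < 1.
Variable F : C -> C.
Hypothesis F_holder : Lambda sigma gam F.
Notation dg := (dgam gam).
Notation npt := (normal_pt gam).

Lemma Lambda_along_loop : exists K, 0 <= K /\ forall t s r, 0 < r -> Rabs s <= r ->
  Cmod (F (gam (t + s)%R) - F (gam t)) <= K * Rpower r sigma.
Proof.
  destruct (holder_modulus _ _ _ (proj1 sigma_range) F_holder) as (K & HK & Mod).
  destruct (dgam_bounded gam gam_regular) as (L & HL & BL).
  pose proof (Rpower_gt_0 L sigma). exists (K * Rpower L sigma)%R. split; [nra|].
  intros t s r Hr Hs. rewrite Rmult_assoc, Rpower_mult_distr by auto.
  apply Mod; [now exists (t + s)%R|now exists t|nra|].
  eapply Rle_trans; [now apply (loop_lipschitz gam gam_regular L)|].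
  replace (t + s - t)%R with s by ring. apply Rmult_le_compat_l; lra.
Qed.

Lemma Lambda_continuous : continuous_map (fun t => F (gam t)).
Proof.
  destruct Lambda_along_loop as (K & HK & Mod). intros t. apply continuous_RC_iff. intros eps He.
  destruct (Rpower_small sigma K eps (proj1 sigma_range) He) as (r & Hr & Small).
  exists r. split; [exact Hr|]. intros s Hs.
  replace s with (t + (s - t))%R by ring.
  eapply Rle_lt_trans; [apply (Mod t (s - t)%R r); lra|]. apply Small. lra.
Qed.

Lemma Cmod_cauchy_le (L M d : R) (z : C) : (forall t, Cmod (dg t) <= L) ->
  (forall t, Cmod (F (gam t)) <= M) -> 0 < d -> (forall t, d <= Cmod (gam t - z)) ->
  Cmod (cauchy gam F z) <= M * L / d.
Proof.
  intros BL BF Hd D. pose proof Lambda_continuous. pose proof (dgam_continuous gam gam_regular).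
  rewrite cauchy_eq_transform, Cmod_mult.
  assert (B : Cmod (cauchy_transform gam (fun t => F (gam t) * dg t) z) <= M * L / d).
  { apply Cmod_cauchy_transform_le; auto.
    - now apply loop_continuous.
    - continuity_C.
    - intros t _. rewrite Cmod_mult. apply Rmult_le_compat; auto using Cmod_ge_0. }
  pose proof Cmod_inv_C2PIi_le. pose proof (Cmod_ge_0 (/ C2PIi)).
  pose proof (Cmod_ge_0 (cauchy_transform gam (fun t => F (gam t) * dg t) z)). nra.
Qed.

Lemma Cmod_cauchy_kernel_weak (K L M c t d delta : R) (z w : C) :
  (forall s, Cmod (F (gam (t + s)%R) - F (gam t)) <= K * Rpower (d + Rabs s) sigma) ->
  (forall s, Cmod (dg s) <= L) -> 0 < c -> 0 < d -> 0 < delta ->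
  depth_ge gam c t d z -> depth_ge gam c t delta w -> Cmod (z - w) <= M * delta ->
  forall s, Rabs s <= 1 / 2 ->
  Cmod ((F (gam (t + s)%R) - F (gam t)) * cauchy_kernel gam z w (t + s))
  <= K * M * L / (c * c) * weak_kernel sigma d delta (Rabs s).
Proof.
  intros Mod BL Hc Hd Hdelta Dz Dw Hzw s Hs. specialize (Dz s Hs). specialize (Dw s Hs).
  pose proof (Rabs_pos s). rewrite Cmod_mult.
  set (a := (d + Rabs s)%R) in *. set (b := (delta + Rabs s)%R) in *.
  assert (Ha : 0 < a) by (unfold a; lra). assert (Hb : 0 < b) by (unfold b; lra).
  apply Rle_trans with (K * Rpower a sigma * (M * delta / (c * a * (c * b)) * L))%R.
  - apply Rmult_le_compat; auto using Cmod_ge_0.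
    apply Cmod_cauchy_kernel_le; auto; now apply Rmult_lt_0_compat.
  - right. unfold weak_kernel. fold a b. rewrite Rpower_minus_1 by exact Ha. field. lra.
Qed.

(* Subtracting the value of [F] at the foot [gam t] makes the kernel weakly singular. *)
Lemma cauchy_increment_le (c M : R) : 0 < c -> 0 <= M -> exists B, 0 <= B /\
  forall t d delta z w, 0 < d <= delta -> delta <= 1 / 2 ->
    depth_ge gam c t d z -> depth_ge gam c t delta w -> Cmod (z - w) <= M * delta ->
    Cmod (cauchy gam F z - cauchy gam F w - F (gam t) * (wind gam z - wind gam w))
    <= B * Rpower delta sigma.
Proof.
  intros Hc HM. destruct Lambda_along_loop as (K & HK & Mod).
  destruct (dgam_bounded gam gam_regular) as (L & HL & BL).
  assert (HN : 0 <= K * M * L / (c * c)).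
  { apply Rle_div_r; [nra|]. rewrite Rmult_0_l. repeat apply Rmult_le_pos; lra. }
  set (N := (K * M * L / (c * c))%R) in *. set (k := (2 / sigma + 1 / (1 - sigma))%R).
  assert (Hk : 0 < k) by (apply Rplus_lt_0_compat; apply Rdiv_lt_0_compat; lra).
  exists (2 * (N * k))%R. split; [nra|]. intros t d delta z w Hd Hdelta Dz Dw Hzw.
  assert (Oz := depth_ge_not_onG gam gam_regular c t d z Hc (proj1 Hd) Dz).
  assert (Ow := depth_ge_not_onG gam gam_regular c t delta w Hc ltac:(lra) Dw).
  rewrite cauchy_minus by auto using Lambda_continuous.
  set (phi := fun u => (F (gam u) - F (gam t)) * cauchy_kernel gam z w u).
  assert (Cphi : continuous_map phi).
  { pose proof Lambda_continuous. pose proof (cauchy_kernel_continuous gam gam_regular z w Oz Ow).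
    unfold phi. continuity_C. }
  rewrite (CInt_period_centered phi t Cphi).
  2:{ intros u. unfold phi. now rewrite (loop_periodic gam gam_regular), cauchy_kernel_periodic. }
  set (I := CInt _ _ _).
  assert (BI : Cmod I <= 2 * (N * k) * Rpower delta sigma).
  { set (W := RInt (weak_kernel sigma d delta) 0 (1 / 2)).
    assert (HW : W <= k * Rpower delta sigma) by now apply RInt_weak_kernel_le.
    apply Rle_trans with (2 * (N * W))%R; [|nra].
    apply (Cmod_CInt_le _ (fun s => N * weak_kernel sigma d delta (Rabs s))%R (- (1 / 2)) (1 / 2)).
    - lra.
    - continuity_C.
    - intros s Hs. unfold N. apply Cmod_cauchy_kernel_weak; auto; try lra; [|now apply Rabs_le].
      intros u. apply Mod; pose proof (Rabs_pos u); lra.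
    - apply (is_RInt_Rabs (fun u => N * weak_kernel sigma d delta u)%R); [lra|].
      apply (is_RInt_scal (V := R_NormedModule)), (RInt_correct (V := R_CompleteNormedModule)).
      apply ex_RInt_weak_kernel; lra. }
  rewrite Cmod_mult. pose proof Cmod_inv_C2PIi_le. pose proof (Cmod_ge_0 (/ C2PIi)).
  pose proof (Cmod_ge_0 I). nra.
Qed.

Section OneSide.
Variables (U : C -> Prop) (e kappa L c tau0 : R).
Hypothesis U_collar : collar gam U e kappa L c tau0.

Let c_pos : 0 < c := collar_const_pos U_collar.
Let tau0_range : 0 < tau0 <= 1 / 2 := collar_width U_collar.
Let speed : forall t, Cmod (dg t) <= L := collar_speed U_collar.

Lemma collar_speed_ge_0 : 0 <= L.
Proof. exact (Rle_trans _ _ _ (Cmod_ge_0 _) (speed 0%R)). Qed.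

Lemma cauchy_minus_same_side_le (c' M : R) : 0 < c' -> 0 <= M -> exists B, 0 <= B /\
  forall t d delta z w, U z -> U w -> 0 < d <= delta -> delta <= 1 / 2 ->
    depth_ge gam c' t d z -> depth_ge gam c' t delta w -> Cmod (z - w) <= M * delta ->
    Cmod (cauchy gam F z - cauchy gam F w) <= B * Rpower delta sigma.
Proof.
  intros Hc' HM. destruct (cauchy_increment_le c' M Hc' HM) as (B & HB & Inc).
  exists B. split; [exact HB|]. intros t d delta z w Uz Uw Hd Hdelta Dz Dw Hzw.
  specialize (Inc t d delta z w Hd Hdelta Dz Dw Hzw).
  rewrite !(collar_wind U_collar) in Inc by auto.
  now replace (cauchy gam F z - cauchy gam F w) with
    (cauchy gam F z - cauchy gam F w - F (gam t) * (kappa - kappa)) by ring.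
Qed.

Lemma collar_push : exists B, 0 <= B /\ forall z delta, U z -> 0 < delta <= tau0 ->
  exists w t, U w /\ depth_ge gam c t delta w /\ Cmod (w - z) <= L * delta /\
    Cmod (cauchy gam F w - cauchy gam F z) <= B * Rpower delta sigma.
Proof.
  pose proof collar_speed_ge_0 as HL.
  destruct (cauchy_minus_same_side_le c L c_pos HL) as (B & HB & Inc).
  exists B. split; [exact HB|]. intros z delta Uz Hdelta. pose proof (Rpower_gt_0 delta sigma).
  assert (Stay : Cmod (z - z) <= L * delta /\
      Cmod (cauchy gam F z - cauchy gam F z) <= B * Rpower delta sigma).
  { rewrite !Cmod_minus_diag. split; apply Rmult_le_pos; lra. }
  destruct (collar_cover U_collar z Uz) as [(t & tau & Htau & ->)|Far].
  - pose proof (collar_depth U_collar t tau Htau) as Dz.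
    destruct (Rle_dec delta tau) as [Deep|Shallow].
    + exists (npt t (e * tau)), t. split; [exact Uz|split; [|exact Stay]].
      apply (depth_ge_weaken gam c c t tau); auto; lra.
    + pose proof (collar_normal U_collar t delta Hdelta) as Uw.
      pose proof (collar_depth U_collar t delta Hdelta) as Dw.
      assert (Dist : Cmod (npt t (e * delta) - npt t (e * tau)) <= L * delta).
      { rewrite Cmod_normal_pt_minus, <- Rmult_minus_distr_l, Rabs_mult,
          (collar_sign U_collar), Rabs_pos_eq, Rmult_1_l, Rmult_comm by lra.
        apply Rmult_le_compat; auto using Cmod_ge_0; lra. }
      exists (npt t (e * delta)), t. split; [exact Uw|split; [exact Dw|split; [exact Dist|]]].
      rewrite Cmod_minus_sym in Dist |- *. apply (Inc t tau delta); auto; lra.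
  - exists z, 0%R. split; [exact Uz|split; [|exact Stay]]. intros s Hs.
    eapply Rle_trans; [|apply Far]. pose proof (Rabs_pos s). nra.
Qed.

Lemma collar_cauchy_bounded : exists M, forall z, U z -> Cmod (cauchy gam F z) <= M.
Proof.
  destruct collar_push as (B & HB & Push).
  destruct (periodic_bounded (fun t => F (gam t))) as (MF & HMF & BF).
  { exact Lambda_continuous. }
  { intros t. now rewrite (loop_periodic gam gam_regular). }
  exists (MF * L / (c * tau0) + B * Rpower tau0 sigma)%R. intros z Uz.
  destruct (Push z tau0 Uz ltac:(lra)) as (w & t & Uw & Dw & _ & Ew).
  pose proof (Cmod_triangle_inv (cauchy gam F z) (cauchy gam F w)) as T.
  rewrite Cmod_minus_sym in T.
  assert (Cmod (cauchy gam F w) <= MF * L / (c * tau0)); [|lra].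
  apply Cmod_cauchy_le; auto; [nra|]. exact (depth_ge_dist gam gam_regular c t tau0 w c_pos Dw).
Qed.

(* Two points at distance [r] are first pushed to depth [r]. *)
Lemma holder_cauchy_one_side : holder sigma U (cauchy gam F).
Proof.
  pose proof collar_speed_ge_0 as HL. destruct collar_push as (B & HB & Push).
  destruct collar_cauchy_bounded as [MF Bound].
  set (M := (2 * L + 1)%R). set (c' := (c / (1 + M / c))%R).
  assert (HMc : 0 < M / c) by (apply Rdiv_lt_0_compat; unfold M; lra).
  assert (Hc' : 0 < c' <= c).
  { split; [apply Rdiv_lt_0_compat; lra|]. apply Rle_div_l; nra. }
  destruct (cauchy_minus_same_side_le c' M) as (B' & HB' & Inc); [lra|unfold M; lra|].
  apply (holder_of_locally_holder sigma U _ (2 * B + B') MF tau0); [lra|lra| |exact Bound].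
  intros z w Uz Uw N Hr. assert (Pr : 0 < Cmod (z - w)) by now apply Cmod_minus_gt_0.
  set (r := Cmod (z - w)) in *.
  destruct (Push z r Uz ltac:(lra)) as (z' & t & Uz' & Dz' & Nz & Ez).
  destruct (Push w r Uw ltac:(lra)) as (w' & u & Uw' & Dw' & Nw & Ew).
  assert (Dist : Cmod (w' - z') <= M * r).
  { pose proof (Cmod_minus_triangle w' w z') as T. pose proof (Cmod_minus_triangle w z z') as T'.
    rewrite (Cmod_minus_sym w z), (Cmod_minus_sym z z') in T'. fold r in T'. unfold M. lra. }
  assert (Dw : depth_ge gam c' t r w').
  { apply (depth_ge_transfer gam c t r M z'); auto; [unfold M; lra|].
    exact (depth_ge_dist gam gam_regular c u r w' c_pos Dw'). }
  assert (Ezw : Cmod (cauchy gam F z' - cauchy gam F w') <= B' * Rpower r sigma).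
  { apply (Inc t r r); auto; try lra.
    - apply (depth_ge_weaken gam c c' t r); auto; lra.
    - now rewrite Cmod_minus_sym. }
  pose proof (Cmod_minus_triangle (cauchy gam F z) (cauchy gam F z') (cauchy gam F w)) as T.
  pose proof (Cmod_minus_triangle (cauchy gam F z') (cauchy gam F w') (cauchy gam F w)) as T'.
  rewrite (Cmod_minus_sym _ (cauchy gam F z')) in T. lra.
Qed.

End OneSide.
End Privalov.

Section SidesOfLoop.
Variable gam : R -> C.
Hypothesis gam_regular : regular_loop gam.
Hypothesis gam_pos : pos_oriented gam.
Notation dg := (dgam gam).
Notation npt := (normal_pt gam).

Lemma normal_pt_near_or_dist (c tau0 : R) (z : C) : 0 < tau0 ->
  (forall t, depth_ge gam c t tau0 (npt t tau0)) -> ~ onG gam z ->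
  (exists t tau, 0 < Rabs tau <= tau0 /\ z = npt t tau) \/ (forall u, c * tau0 <= Cmod (gam u - z)).
Proof.
  intros Ht0 Depth Off. destruct (nearest_normal_pt gam gam_regular z) as (t & tau & -> & Min).
  destruct (Rle_dec (Rabs tau) tau0) as [Near|Far].
  - left. exists t, tau. split; [split; [|exact Near]|reflexivity].
    apply Rabs_pos_lt. intros ->. apply Off. exists t. unfold normal_pt. ring.
  - right. intros u. eapply Rle_trans; [|apply Min].
    specialize (Depth t 0%R ltac:(rewrite Rabs_R0; lra)).
    rewrite Rabs_R0, !Rplus_0_r, Cmod_minus_sym, Cmod_normal_pt_foot, Rabs_pos_eq in Depth by lra.
    rewrite Cmod_minus_sym, Cmod_normal_pt_foot. pose proof (Cmod_ge_0 (dg t)). nra.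
Qed.

Lemma exists_collars : exists L c tau0,
  collar gam (intD gam) 1 1 L c tau0 /\ collar gam (extD gam) (-1) 0 L c tau0.
Proof.
  destruct (dgam_bounded gam gam_regular) as (L & HL & BL).
  destruct (normal_pt_depth gam gam_regular) as (c & tau1 & Hc & Ht1 & Depth).
  destruct (sides_of_loop gam gam_regular gam_pos) as (tau2 & Ht2 & Sides).
  set (tau0 := Rmin (1 / 2) (Rmin tau1 tau2)).
  assert (Ht0 : 0 < tau0) by (repeat apply Rmin_pos; lra).
  assert (Le : tau0 <= 1 / 2 /\ tau0 <= tau1 /\ tau0 <= tau2).
  { pose proof (Rmin_l (1 / 2) (Rmin tau1 tau2)). pose proof (Rmin_r (1 / 2) (Rmin tau1 tau2)).
    pose proof (Rmin_l tau1 tau2). pose proof (Rmin_r tau1 tau2). unfold tau0. lra. }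
  assert (Signed : forall e t tau, Rabs e = 1%R -> 0 < tau <= tau0 ->
    depth_ge gam (c * tau0) t tau (npt t (e * tau))).
  { intros e t tau He Htau. pose proof (Depth t (e * tau)%R) as D.
    rewrite Rabs_mult, He, Rmult_1_l, Rabs_pos_eq in D by lra.
    apply (depth_ge_weaken gam c (c * tau0) t tau); try lra; [nra|]. apply D. lra. }
  assert (Cover : forall z, ~ onG gam z -> (exists t tau, 0 < Rabs tau <= tau0 /\ z = npt t tau) \/
    (forall u, c * tau0 <= Cmod (gam u - z))).
  { intros z. apply normal_pt_near_or_dist; [exact Ht0|]. intros t.
    rewrite <- (Rabs_pos_eq tau0) at 1 by lra. apply Depth. rewrite Rabs_pos_eq; lra. }
  pose proof Rabs_R1. assert (Rabs (-1) = 1%R) by (rewrite Rabs_left; lra).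
  exists L, (c * tau0)%R, tau0. split; split; auto; try nra.
  - intros t tau Htau. rewrite Rmult_1_l. apply Sides. lra.
  - intros z Hz. destruct (Cover z (proj1 Hz)) as [(t & tau & Htau & E)|Far]; [left|now right].
    exists t, (Rabs tau). split; [exact Htau|]. rewrite Rmult_1_l.
    destruct (Rle_dec 0 tau) as [Pos|Neg]; [now rewrite Rabs_pos_eq|exfalso].
    rewrite Rabs_left in Htau by lra. apply (proj2 Hz). rewrite E, <- (Ropp_involutive tau).
    apply Sides. lra.
  - intros z Hz. now apply (wind_extD gam gam_regular).
  - intros t tau Htau. replace (-1 * tau)%R with (- tau)%R by ring. apply Sides. lra.
  - intros z Hz. destruct (Cover z (proj1 Hz)) as [(t & tau & Htau & E)|Far]; [left|now right].
    exists t, (Rabs tau). split; [exact Htau|].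
    destruct (Rle_dec 0 tau) as [Pos|Neg]; [exfalso|rewrite Rabs_left, E by lra; f_equal; ring].
    rewrite Rabs_pos_eq in Htau by lra. apply (proj2 (proj1 (Sides t tau ltac:(lra)))).
    now rewrite <- E.
Qed.

End SidesOfLoop.

(** * Integrals along the boundary of a rectangle *)

Definition rect_int (f : C -> C) (x1 x2 y1 y2 : R) : C :=
  CInt (fun x => f (x, y1) - f (x, y2)) x1 x2 + Ci * CInt (fun y => f (x2, y) - f (x1, y)) y1 y2.

Definition square_int (f : C -> C) (x y l : R) : C := rect_int f x (x + l) y (y + l).

Definition in_square (x y l : R) (w : C) : Prop := x <= Re w <= x + l /\ y <= Im w <= y + l.

Definition edges_continuous (f : C -> C) (x1 x2 y1 y2 : R) : Prop :=
  (continuous_map (fun x : R => f (x, y1)) /\ continuous_map (fun x : R => f (x, y2))) /\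
  (continuous_map (fun y : R => f (x1, y)) /\ continuous_map (fun y : R => f (x2, y))).

Section RectInt.
Variables x1 x2 y1 y2 : R.

Lemma continuous_edges (f : C -> C) : continuous_map f -> edges_continuous f x1 x2 y1 y2.
Proof. intros Hf. repeat split; continuity_C. Qed.

Lemma rect_int_minus (f g : C -> C) :
  edges_continuous f x1 x2 y1 y2 -> edges_continuous g x1 x2 y1 y2 ->
  rect_int (fun w => f w - g w) x1 x2 y1 y2 = rect_int f x1 x2 y1 y2 - rect_int g x1 x2 y1 y2.
Proof.
  intros [[? ?] [? ?]] [[? ?] [? ?]]. unfold rect_int.
  rewrite !CInt_minus by continuity_C. ring.
Qed.

Lemma rect_int_scal (c : C) (f : C -> C) : edges_continuous f x1 x2 y1 y2 ->
  rect_int (fun w => c * f w) x1 x2 y1 y2 = c * rect_int f x1 x2 y1 y2.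
Proof.
  intros [[? ?] [? ?]]. unfold rect_int. rewrite !CInt_minus, !CInt_scal by continuity_C. ring.
Qed.

Lemma rect_int_affine (a b : C) : rect_int (fun w => a + b * w) x1 x2 y1 y2 = 0.
Proof.
  assert (Eh : forall x, a + b * (x, y1) - (a + b * (x, y2)) = b * Ci * RtoC (y1 - y2)).
  { intros x. apply injective_projections; simpl; ring. }
  assert (Ev : forall y, a + b * (x2, y) - (a + b * (x1, y)) = b * RtoC (x2 - x1)).
  { intros y. apply injective_projections; simpl; ring. }
  unfold rect_int. rewrite (CInt_ext _ _ x1 x2 Eh), (CInt_ext _ _ y1 y2 Ev).
  rewrite !CInt_const, !RtoC_minus. ring.
Qed.

Lemma rect_int_split_h (f : C -> C) (x : R) : continuous_map f ->
  rect_int f x1 x2 y1 y2 = rect_int f x1 x y1 y2 + rect_int f x x2 y1 y2.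
Proof.
  intros Hf. unfold rect_int. rewrite <- (CInt_Chasles _ x1 x x2), !CInt_minus by continuity_C.
  ring.
Qed.

Lemma rect_int_split_v (f : C -> C) (y : R) : continuous_map f ->
  rect_int f x1 x2 y1 y2 = rect_int f x1 x2 y1 y + rect_int f x1 x2 y y2.
Proof.
  intros Hf. unfold rect_int. rewrite <- (CInt_Chasles _ y1 y y2), !CInt_minus by continuity_C.
  ring.
Qed.

Lemma Cmod_rect_int_le (f : C -> C) (M : R) : x1 <= x2 -> y1 <= y2 ->
  edges_continuous f x1 x2 y1 y2 ->
  (forall x, x1 <= x <= x2 -> Cmod (f (x, y1)) <= M /\ Cmod (f (x, y2)) <= M) ->
  (forall y, y1 <= y <= y2 -> Cmod (f (x1, y)) <= M /\ Cmod (f (x2, y)) <= M) ->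
  Cmod (rect_int f x1 x2 y1 y2) <= ((x2 - x1) + (y2 - y1)) * (2 * M).
Proof.
  intros Hx Hy [[? ?] [? ?]] Hh Hv. unfold rect_int.
  eapply Rle_trans; [apply Cmod_triangle|].
  rewrite Cmod_mult, Cmod_Ci, Rmult_1_l, Rmult_plus_distr_r.
  rewrite <- (Rabs_pos_eq (x2 - x1)), <- (Rabs_pos_eq (y2 - y1)) by lra.
  apply Rplus_le_compat; (apply Cmod_CInt_le_const; [continuity_C|]);
    rewrite Rmin_left, Rmax_right by lra; intros u Hu; eapply Rle_trans; try apply Cmod_minus_le.
  - destruct (Hh u Hu). lra.
  - destruct (Hv u Hu). lra.
Qed.

End RectInt.

Lemma CInt_atan_kernel_shift (c r : R) : 0 < r ->
  CInt (fun x => RtoC (r / ((x - c) ^ 2 + r ^ 2))) (c - r) (c + r) = RtoC (PI / 2).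
Proof.
  intros Hr. set (k := fun u => RtoC (r / (u ^ 2 + r ^ 2))).
  assert (Ck : continuous_map k) by (unfold k; continuity_C; nra).
  change (CInt (fun x => k (x - c)%R) (c + - r) (c + r) = RtoC (PI / 2)).
  rewrite <- (CInt_shift (fun x => k (x - c)%R)) by continuity_C.
  rewrite (CInt_ext _ k) by (intros u; f_equal; ring).
  unfold k. rewrite (CInt_RtoC _ _ _ _ (is_RInt_atan r (- r) r Hr)).
  replace (r / r)%R with 1%R by (field; lra). replace (- r / r)%R with (- (1))%R by (field; lra).
  rewrite atan_opp, atan_1. f_equal. field.
Qed.

Lemma rect_int_inv (z0 : C) (r : R) : 0 < r ->
  rect_int (fun w => / (w - z0)) (Re z0 - r) (Re z0 + r) (Im z0 - r) (Im z0 + r) = C2PIi.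
Proof.
  intros Hr. destruct z0 as [x0 y0]. unfold rect_int, Re, Im. simpl fst. simpl snd.
  assert (Hq : forall u : R, (u ^ 2 + r ^ 2 <> 0)%R) by (intros u; nra).
  assert (Eh : forall x : R, / ((x, (y0 - r)%R) - (x0, y0)) - / ((x, (y0 + r)%R) - (x0, y0)) =
    2 * Ci * RtoC (r / ((x - x0) ^ 2 + r ^ 2))).
  { intros x. specialize (Hq (x - x0)%R).
    apply injective_projections; simpl; field; repeat split; contradict Hq; rewrite <- Hq; ring. }
  assert (Ev : forall y : R, / (((x0 + r)%R, y) - (x0, y0)) - / (((x0 - r)%R, y) - (x0, y0)) =
    2 * RtoC (r / ((y - y0) ^ 2 + r ^ 2))).
  { intros y. specialize (Hq (y - y0)%R).
    apply injective_projections; simpl; field; repeat split; contradict Hq; rewrite <- Hq; ring. }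
  assert (Ck : forall c, continuous_map (fun x => RtoC (r / ((x - c) ^ 2 + r ^ 2)))).
  { intros c. continuity_C. specialize (Hq (x - c)%R). contradict Hq. rewrite <- Hq. ring. }
  rewrite (CInt_ext _ _ _ _ Eh), (CInt_ext _ _ _ _ Ev), !CInt_scal, !CInt_atan_kernel_shift by auto.
  unfold C2PIi. rewrite RtoC_div by lra. field.
Qed.

Lemma additive_interval_bound (G : R -> R -> C) (x h : R) (N : nat) :
  (forall a b c, G a c = G a b + G b c) ->
  Cmod (G x (x + INR (S N) * h)%R) <=
  sum_f_R0 (fun i => Cmod (G (x + INR i * h) (x + INR i * h + h))%R) N.
Proof.
  intros HG. induction N as [|N IH].
  - simpl. rewrite Rmult_0_l, Rmult_1_l, Rplus_0_r. lra.
  - rewrite (HG _ (x + INR (S N) * h)%R). eapply Rle_trans; [apply Cmod_triangle|].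
    rewrite tech5. apply Rplus_le_compat; [exact IH|].
    rewrite (S_INR (S N)). right. do 2 f_equal. ring.
Qed.

Lemma square_int_grid_le (f : C -> C) (x y h : R) (N : nat) : continuous_map f ->
  Cmod (square_int f x y (INR (S N) * h)) <=
  sum_f_R0 (fun i => sum_f_R0 (fun j => Cmod (square_int f (x + INR i * h) (y + INR j * h) h)) N) N.
Proof.
  intros Hf. unfold square_int.
  eapply Rle_trans; [apply (additive_interval_bound
    (fun a b => rect_int f a b y (y + INR (S N) * h)))|].
  - intros a b c. now apply rect_int_split_h.
  - apply sum_Rle. intros i _.
    apply (additive_interval_bound (rect_int f (x + INR i * h) (x + INR i * h + h))).
    intros a b c. now apply rect_int_split_v.
Qed.

Lemma Cmod_square_int_affine_le (f : C -> C) (a b : C) (x y l M : R) : continuous_map f -> 0 <= l ->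
  (forall w, in_square x y l w -> Cmod (f w - (a + b * w)) <= M) ->
  Cmod (square_int f x y l) <= 4 * l * M.
Proof.
  intros Hf Hl HM. unfold square_int.
  assert (Ca : continuous_map (fun w => a + b * w)) by continuity_C.
  replace (rect_int f x (x + l) y (y + l)) with
    (rect_int (fun w => f w - (a + b * w)) x (x + l) y (y + l)).
  2:{ rewrite rect_int_minus, rect_int_affine by now apply continuous_edges. ring. }
  replace (4 * l * M)%R with ((x + l - x + (y + l - y)) * (2 * M))%R by ring.
  apply Cmod_rect_int_le; try lra.
  - apply continuous_edges. continuity_C.
  - intros u Hu. split; apply HM; unfold in_square; simpl; lra.
  - intros u Hu. split; apply HM; unfold in_square; simpl; lra.
Qed.

(** * Goursat's theorem *)

Lemma nested_halving_intervals (u : nat -> R) (l : R) : 0 < l ->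
  (forall n, u (S n) = u n \/ u (S n) = u n + l / 2 ^ S n)%R ->
  exists X, forall n, u n <= X <= u n + l / 2 ^ n.
Proof.
  intros Hl Hu. set (v := fun n => (u n + l / 2 ^ n)%R).
  assert (Half : forall n, (l / 2 ^ n = 2 * (l / 2 ^ S n))%R /\ 0 < l / 2 ^ S n).
  { intros n. pose proof (pow_lt 2 n ltac:(lra)). simpl. split; [field; lra|].
    apply Rdiv_lt_0_compat; lra. }
  assert (Incr : forall n, u n <= u (S n)) by (intros n; destruct (Half n), (Hu n); lra).
  assert (Decr : forall n, v (S n) <= v n).
  { intros n. unfold v. destruct (Half n), (Hu n); lra. }
  destruct (ex_lim_seq_adj u v Incr Decr) as ([X HX] & [Y HY] & E).
  { apply (is_lim_seq_ext (fun n => l * (/ 2) ^ n)%R).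
    - intros n. unfold v. rewrite pow_inv. unfold Rdiv. ring.
    - replace (Finite 0) with (Rbar_mult l 0) by (simpl; f_equal; ring).
      apply is_lim_seq_scal_l, is_lim_seq_geom. rewrite Rabs_pos_eq; lra. }
  rewrite (is_lim_seq_unique _ _ HX), (is_lim_seq_unique _ _ HY) in E. injection E as <-.
  exists X. intros n. split.
  - exact (is_lim_seq_incr_compare u X HX Incr n).
  - exact (is_lim_seq_decr_compare v X HY Decr n).
Qed.

Lemma square_bisection (P : R -> R -> R -> Prop) (x y l : R) : 0 < l ->
  (forall x y l, P x y (l / 2) -> P (x + l / 2) y (l / 2) -> P x (y + l / 2) (l / 2) ->
    P (x + l / 2) (y + l / 2) (l / 2) -> P x y l)%R ->
  (forall w, in_square x y l w -> exists d, 0 < d /\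
    forall x' y' l', 0 < l' < d -> in_square x' y' l' w -> P x' y' l') ->
  P x y l.
Proof.
  intros Hl Join Local. apply NNPP. intros Bad.
  set (side := fun n => (l / 2 ^ n)%R).
  assert (Eside : forall n, side (S n) = (side n / 2)%R).
  { intros n. unfold side. simpl. field. apply pow_nonzero. lra. }
  set (child := fun n (p q : R * R) =>
    (fst q = fst p \/ fst q = fst p + side (S n))%R /\
    (snd q = snd p \/ snd q = snd p + side (S n))%R /\ ~ P (fst q) (snd q) (side (S n))).
  set (corner := fix corner n := match n with
    | O => (x, y)
    | S n => epsilon (inhabits (x, y)) (child n (corner n)) end).
  assert (Step : forall n p, ~ P (fst p) (snd p) (side n) -> exists q, child n p q).
  { intros n p Np. apply NNPP. intros None. apply Np. unfold child in None. rewrite Eside in None.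
    apply Join; apply NNPP; intros Nq; apply None.
    - exists p. auto.
    - exists (fst p + side n / 2, snd p)%R. auto.
    - exists (fst p, snd p + side n / 2)%R. auto.
    - exists (fst p + side n / 2, snd p + side n / 2)%R. auto. }
  assert (Hcorner : forall n, ~ P (fst (corner n)) (snd (corner n)) (side n)).
  { induction n as [|n IH].
    - unfold side. simpl. now rewrite Rdiv_1_r.
    - exact (proj2 (proj2 (epsilon_spec _ _ (Step n _ IH)))). }
  assert (Hchild : forall n, child n (corner n) (corner (S n))).
  { intros n. exact (epsilon_spec _ _ (Step n _ (Hcorner n))). }
  destruct (nested_halving_intervals (fun n => fst (corner n)) l Hl) as [X HX].
  { intros n. apply Hchild. }
  destruct (nested_halving_intervals (fun n => snd (corner n)) l Hl) as [Y HY].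
  { intros n. apply Hchild. }
  destruct (Local (X, Y)) as (d & Hd & Small).
  { specialize (HX 0%nat). specialize (HY 0%nat). simpl in HX, HY. rewrite Rdiv_1_r in HX, HY.
    now split. }
  destruct (pow_lt_1_zero (/ 2) ltac:(rewrite Rabs_pos_eq; lra) (d / l)) as [n Hn].
  { now apply Rdiv_lt_0_compat. }
  specialize (Hn n (Nat.le_refl n)). apply (Hcorner n), Small; [|now split].
  pose proof (pow_lt 2 n ltac:(lra)). unfold side. split; [now apply Rdiv_lt_0_compat|].
  rewrite pow_inv, Rabs_pos_eq in Hn by (left; now apply Rinv_0_lt_compat).
  apply Rlt_div_r in Hn; [|exact Hl]. unfold Rdiv. lra.
Qed.

Lemma goursat (f : C -> C) (x y l : R) : continuous_map f -> 0 < l ->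
  (forall w, in_square x y l w -> exists D, is_derive_CC f w D) -> square_int f x y l = 0.
Proof.
  intros Hf Hl Der. apply Ceq_of_Cmod_le. intros eps He.
  replace (square_int f x y l - 0) with (square_int f x y l) by ring.
  assert (Hl2 : 0 < l ^ 2) by nra. set (e := (eps / l ^ 2)%R).
  assert (He' : 0 < e) by now apply Rdiv_lt_0_compat.
  replace eps with (e * l ^ 2)%R by (unfold e; field; lra). clearbody e.
  apply (square_bisection (fun x y l => Cmod (square_int f x y l) <= e * l ^ 2)); [exact Hl| |].
  - clear - Hf. intros x y l Q1 Q2 Q3 Q4.
    pose proof (square_int_grid_le f x y (l / 2) 1 Hf) as G. simpl in G.
    replace ((1 + 1) * (l / 2))%R with l in G by field.
    rewrite !Rmult_0_l, !Rmult_1_l, !Rplus_0_r in G.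
    replace (e * l ^ 2)%R with (4 * (e * (l / 2) ^ 2))%R by field. lra.
  - intros w Hw. destruct (Der w Hw) as [D HD].
    assert (He8 : 0 < e / 8) by lra.
    destruct (proj1 (is_derive_CC_iff _ _ _) HD _ He8) as (d & Hd & Near).
    exists (d / 2)%R. split; [lra|]. clear - Hf He' Near. intros x y l Hl [Hx Hy].
    replace (e * l ^ 2)%R with (4 * l * (e / 8 * (2 * l)))%R by field.
    apply (Cmod_square_int_affine_le f (f w - w * D) D); [exact Hf|lra|]. intros u [Ux Uy].
    assert (Dist : Cmod (u - w) <= 2 * l).
    { eapply Rle_trans; [apply Cmod_le_re_im|].
      assert (Rabs (Re (u - w)) <= l) by (apply Rabs_le; unfold Re, Im in *; simpl; lra).
      assert (Rabs (Im (u - w)) <= l) by (apply Rabs_le; unfold Re, Im in *; simpl; lra). lra. }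
    replace (f u - (f w - w * D + D * u)) with (f u - f w - (u - w) * D) by ring.
    eapply Rle_trans; [apply Near; lra|]. apply Rmult_le_compat_l; lra.
Qed.

(** * Removability of thin sets and Liouville's theorem *)

(* Finite upper one-dimensional Minkowski content. *)
Definition thin (S : C -> Prop) : Prop := exists (rho : R) (m : nat), 0 <= rho /\
  forall n : nat, (0 < n)%nat -> exists p : nat -> C, forall z, S z ->
    exists k, (k < m * n)%nat /\ Cmod (z - p k) <= rho / INR n.

Lemma thin_add_point (S : C -> Prop) (z0 : C) : thin S -> thin (fun z => S z \/ z = z0).
Proof.
  intros (rho & m & Hrho & Cover). exists rho, (Datatypes.S m). split; [exact Hrho|]. intros n Hn.
  destruct (Cover n Hn) as [p Hp].
  exists (fun k => if Nat.ltb k (m * n) then p k else z0). intros z [Sz| ->].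
  - destruct (Hp z Sz) as (k & Hk & Near). exists k. split; [lia|].
    now rewrite (proj2 (Nat.ltb_lt _ _) Hk).
  - exists (m * n)%nat. split; [lia|]. rewrite Nat.ltb_irrefl, Cmod_minus_diag.
    apply Rle_div_r; [now apply lt_0_INR|lra].
Qed.

Lemma thin_loop (gam : R -> C) : regular_loop gam -> thin (onG gam).
Proof.
  intros Hgam. destruct (dgam_bounded gam Hgam) as (L & HL & BL).
  exists L, 1%nat. split; [lra|]. intros n Hn. assert (HN : 0 < INR n) by now apply lt_0_INR.
  exists (fun k => gam (INR k / INR n)%R). intros z [t <-].
  destruct (exists_Z_shift t) as [j Hj].
  rewrite <- (periodic_IZR gam j t) by now apply loop_periodic.
  set (u := (t + IZR j)%R) in *.
  destruct (nfloor_ex (u * INR n)) as (k & Hk); [nra|].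
  exists k. split.
  - apply INR_lt. rewrite Nat.mul_1_l. nra.
  - eapply Rle_trans; [now apply (loop_lipschitz gam Hgam L)|].
    apply Rmult_le_compat_l; [lra|].
    replace (u - INR k / INR n)%R with ((u * INR n - INR k) / INR n)%R by (field; lra).
    rewrite Rabs_pos_eq by (apply Rle_div_r; lra). apply Rle_div_l; [exact HN|].
    rewrite Rinv_l; lra.
Qed.

Definition window (a q r : R) : R := if Rle_dec (Rabs (a - q)) r then 1 else 0.

Lemma window_eq_1 (a q r : R) : Rabs (a - q) <= r -> window a q r = 1%R.
Proof. intros H. unfold window. now destruct Rle_dec. Qed.

Lemma window_ge_0 (a q r : R) : 0 <= window a q r.
Proof. unfold window. destruct Rle_dec; lra. Qed.

(* Each counted point contributes [h] to the increase of the identity clipped to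
   [q - r, q + r + h]. *)
Lemma sum_window_le (x h q r : R) (N : nat) : 0 < h -> 0 <= r ->
  sum_f_R0 (fun i => window (x + INR i * h) q r) N <= 2 * r / h + 1.
Proof.
  intros Hh Hr. set (clip := fun u => Rmax (q - r) (Rmin u (q + r + h))).
  assert (Term : forall a, window a q r * h <= clip (a + h)%R - clip a).
  { intros a. unfold window, clip, Rmax, Rmin.
    destruct (Rle_dec (Rabs (a - q)) r) as [Le|_]; [apply Rabs_le_between in Le|];
      repeat destruct Rle_dec; lra. }
  assert (Tele : forall n, sum_f_R0 (fun i => window (x + INR i * h) q r) n * h <=
    clip (x + INR (S n) * h)%R - clip x).
  { induction n as [|n IH].
    - simpl. rewrite Rmult_0_l, Rmult_1_l, Rplus_0_r. apply Term.
    - rewrite tech5, Rmult_plus_distr_r. specialize (Term (x + INR (S n) * h)%R).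
      rewrite (S_INR (S n)).
      replace (x + (INR (S n) + 1) * h)%R with (x + INR (S n) * h + h)%R by ring. lra. }
  assert (Clip : forall u, q - r <= clip u <= q + r + h).
  { intros u. unfold clip, Rmax, Rmin. repeat destruct Rle_dec; lra. }
  replace (2 * r / h + 1)%R with ((2 * r + h) / h)%R by (field; lra). apply Rle_div_r; [exact Hh|].
  specialize (Tele N). destruct (Clip x), (Clip (x + INR (S N) * h)%R). lra.
Qed.

Lemma sum_f_R0_swap (u : nat -> nat -> R) (m n : nat) :
  sum_f_R0 (fun i => sum_f_R0 (u i) n) m = sum_f_R0 (fun j => sum_f_R0 (fun i => u i j) m) n.
Proof.
  pose proof (sum_n_switch (G := R_AbelianMonoid) u m n) as E. rewrite !sum_n_Reals in E.
  rewrite (sum_eq _ (fun i => sum_n (u i) n)), (sum_eq _ (fun j => sum_n (fun i => u i j) m) n);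
    [exact E|..]; intros; now rewrite sum_n_Reals.
Qed.

Lemma sum_f_R0_ge_term (a : nat -> R) (n k : nat) : (forall i, 0 <= a i) -> (k <= n)%nat ->
  a k <= sum_f_R0 a n.
Proof.
  intros Ha Hk. induction n as [|n IH].
  - replace k with 0%nat by lia. simpl. lra.
  - rewrite tech5. specialize (Ha (S n)) as HS. destruct (Nat.eq_dec k (S n)) as [->|N].
    + pose proof (cond_pos_sum a n Ha). lra.
    + specialize (IH ltac:(lia)). lra.
Qed.

(* Double counting of the pairs of a cell and a nearby covering point. *)
Lemma grid_sum_le_of_cover (a : nat -> nat -> R) (x y h r e : R) (N M : nat) (p : nat -> C) :
  0 < h -> 0 <= r -> 0 <= e ->
  (forall i j, (i <= N)%nat -> (j <= N)%nat -> a i j <= e) ->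
  (forall i j, (i <= N)%nat -> (j <= N)%nat ->
    (exists k, (k <= M)%nat /\ Rabs (x + INR i * h - Re (p k)) <= r /\
      Rabs (y + INR j * h - Im (p k)) <= r) \/ a i j <= 0) ->
  sum_f_R0 (fun i => sum_f_R0 (a i) N) N <= INR (S M) * (e * (2 * r / h + 1) ^ 2).
Proof.
  intros Hh Hr He Hae Hnear.
  set (X := fun i k => window (x + INR i * h) (Re (p k)) r).
  set (Y := fun j k => window (y + INR j * h) (Im (p k)) r).
  assert (Cell : forall i j, (i <= N)%nat -> (j <= N)%nat ->
    a i j <= sum_f_R0 (fun k => e * (X i k * Y j k))%R M).
  { intros i j Hi Hj.
    assert (Pos : forall k, 0 <= e * (X i k * Y j k)).
    { intros k. apply Rmult_le_pos; [exact He|]. apply Rmult_le_pos; apply window_ge_0. }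
    destruct (Hnear i j Hi Hj) as [(k & Hk & Hx & Hy)|Far].
    - eapply Rle_trans; [|apply (sum_f_R0_ge_term _ M k Pos Hk)]. unfold X, Y.
      rewrite !window_eq_1 by assumption. specialize (Hae i j Hi Hj). lra.
    - eapply Rle_trans; [exact Far|]. now apply cond_pos_sum. }
  apply Rle_trans with (sum_f_R0 (fun i => sum_f_R0 (fun k => e * (X i k *
    sum_f_R0 (fun j => Y j k) N))%R M) N).
  { apply sum_Rle. intros i Hi.
    apply Rle_trans with (sum_f_R0 (fun j => sum_f_R0 (fun k => e * (X i k * Y j k))%R M) N).
    - apply sum_Rle. intros j Hj. now apply Cell.
    - rewrite sum_f_R0_swap. right. apply sum_eq. intros k _.
      rewrite <- Rmult_assoc, scal_sum. apply sum_eq. intros j _. ring. }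
  rewrite sum_f_R0_swap, (Rmult_comm (INR (S M))), <- sum_cte. apply sum_Rle. intros k _.
  set (Sx := sum_f_R0 (fun i => X i k) N). set (Sy := sum_f_R0 (fun j => Y j k) N).
  replace (sum_f_R0 (fun i => e * (X i k * Sy))%R N) with (e * (Sx * Sy))%R.
  2:{ transitivity ((e * Sy) * Sx)%R; [ring|]. unfold Sx. rewrite scal_sum.
      apply sum_eq. intros i _. ring. }
  apply Rmult_le_compat_l; [exact He|]. simpl. rewrite Rmult_1_r.
  apply Rmult_le_compat; try (apply cond_pos_sum; intros; apply window_ge_0);
    now apply sum_window_le.
Qed.

Lemma continuous_uniformly_square (f : C -> C) (x y l eps : R) : continuous_map f -> 0 < eps ->
  exists d, 0 < d /\ forall w w', in_square x y l w -> in_square x y l w' ->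
    Rabs (Re w - Re w') < d -> Rabs (Im w - Im w') < d -> Cmod (f w - f w') <= eps.
Proof.
  intros Hf He. assert (He2 : 0 < eps / 2) by lra.
  assert (Unif : forall pr : C -> R, (forall z, continuous (fun w => pr (f w)) z) ->
    exists d : posreal, forall u v u' v', x <= u <= x + l -> y <= v <= y + l ->
      x <= u' <= x + l -> y <= v' <= y + l -> Rabs (u' - u) < d -> Rabs (v' - v) < d ->
      Rabs (pr (f (u', v')) - pr (f (u, v))) < eps / 2).
  { intros pr Hpr.
    apply (uniform_continuity_2d (fun u v => pr (f (u, v))) x (x + l) y (y + l)) with
      (eps := mkposreal _ He2).
    intros u v _ _. apply continuity_2d_pt_filterlim.
    apply (filterlim_ext (fun z => pr (f z))); [now intros []|]. exact (Hpr (u, v)). }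
  destruct (Unif Re (fun z => continuous_re f z (Hf z))) as [d Hd].
  destruct (Unif Im (fun z => continuous_im f z (Hf z))) as [d' Hd'].
  exists (Rmin d d'). split; [apply Rmin_pos; apply cond_pos|].
  intros [u v] [u' v'] [Hu Hv] [Hu' Hv'] Du Dv. unfold Re, Im in Hu, Hv, Hu', Hv', Du, Dv.
  simpl in Hu, Hv, Hu', Hv', Du, Dv.
  pose proof (Rmin_l d d'). pose proof (Rmin_r d d').
  specialize (Hd u' v' u v Hu' Hv' Hu Hv ltac:(lra) ltac:(lra)).
  specialize (Hd' u' v' u v Hu' Hv' Hu Hv ltac:(lra) ltac:(lra)).
  eapply Rle_trans; [apply Cmod_le_re_im|].
  change (Rabs (Re (f (u, v)) - Re (f (u', v'))) + Rabs (Im (f (u, v)) - Im (f (u', v'))) <= eps).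
  lra.
Qed.

Lemma in_square_near_corner (x y l rho : R) (z q : C) : in_square x y l z -> Cmod (z - q) <= rho ->
  Rabs (x - Re q) <= l + rho /\ Rabs (y - Im q) <= l + rho.
Proof.
  intros [Hx Hy] Hq. pose proof (re_le_Cmod (z - q)) as Hre. pose proof (im_le_Cmod (z - q)) as Him.
  change (Re (z - q)) with (Re z - Re q)%R in Hre. change (Im (z - q)) with (Im z - Im q)%R in Him.
  assert (Bre : Rabs (Re z - Re q) <= rho) by lra. assert (Bim : Rabs (Im z - Im q) <= rho) by lra.
  apply Rabs_le_between in Bre, Bim. split; apply Rabs_le; lra.
Qed.

Lemma in_square_grid_cell (x y h : R) (i j N : nat) (w : C) : (i <= N)%nat -> (j <= N)%nat ->
  in_square (x + INR i * h) (y + INR j * h) h w -> in_square x y (INR (S N) * h) w.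
Proof.
  intros Hi Hj [Wx Wy]. apply le_INR in Hi, Hj. rewrite S_INR.
  pose proof (pos_INR i). pose proof (pos_INR j). split; nra.
Qed.

(* Cells that avoid the set contribute nothing, by Goursat's theorem. *)
Lemma square_int_cover_le (f : C -> C) (T : C -> Prop) (x y h r e : R) (N M : nat) (p : nat -> C) :
  continuous_map f -> 0 < h -> 0 <= r -> 0 <= e ->
  (forall w w', in_square x y (INR (S N) * h) w -> in_square x y (INR (S N) * h) w' ->
    Rabs (Re w - Re w') <= h -> Rabs (Im w - Im w') <= h -> Cmod (f w - f w') <= e) ->
  (forall z, T z -> exists k, (k <= M)%nat /\ Cmod (z - p k) <= r) ->
  (forall w, ~ T w -> exists D, is_derive_CC f w D) ->
  Cmod (square_int f x y (INR (S N) * h)) <=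
  INR (S M) * (4 * h * e * (2 * (h + r) / h + 1) ^ 2).
Proof.
  intros Hf Hh Hr He Osc Cover Der. eapply Rle_trans; [now apply square_int_grid_le|].
  apply (grid_sum_le_of_cover _ x y h (h + r) (4 * h * e) N M p); try lra.
  - apply Rmult_le_pos; lra.
  - intros i j Hi Hj. set (v := f ((x + INR i * h)%R, (y + INR j * h)%R)).
    apply (Cmod_square_int_affine_le f v 0); [exact Hf|lra|]. intros w Hw.
    replace (f w - (v + 0 * w)) with (f w - v) by ring.
    apply Osc; try (apply (in_square_grid_cell x y h i j N); auto).
    + split; unfold Re, Im; simpl; lra.
    + apply Rabs_le. destruct Hw as [Wx _]. unfold Re in *. simpl. lra.
    + apply Rabs_le. destruct Hw as [_ Wy]. unfold Im in *. simpl. lra.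
  - intros i j _ _.
    destruct (classic (exists z, T z /\ in_square (x + INR i * h) (y + INR j * h) h z))
      as [(z & Tz & Qz)|None].
    + left. destruct (Cover z Tz) as (k & Hk & Near). exists k. split; [exact Hk|].
      exact (in_square_near_corner _ _ _ _ z (p k) Qz Near).
    + right. rewrite (goursat f _ _ h Hf Hh), Cmod_0; [lra|]. intros w Hw. apply Der. eauto.
Qed.

(* On an [n] by [n] grid only [O(n)] cells meet the thin set, each contributing [o(1/n)]. *)
Lemma square_int_thin (f : C -> C) (T : C -> Prop) (x y l : R) :
  continuous_map f -> thin T -> 0 < l ->
  (forall w, ~ T w -> exists D, is_derive_CC f w D) -> square_int f x y l = 0.
Proof.
  intros Hf (rho & m & Hrho & Cover) Hl Der. set (Q := (2 * (l + rho) / l + 1)%R).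
  assert (HQ : 0 <= 2 * (l + rho) / l) by (apply Rle_div_r; lra).
  set (K := (4 * l * (INR m + 1) * Q ^ 2)%R). pose proof (pos_INR m).
  assert (HK : 0 < K) by (unfold K; repeat apply Rmult_lt_0_compat; unfold Q; lra).
  apply Ceq_of_Cmod_le. intros eps He.
  replace (square_int f x y l - 0) with (square_int f x y l) by ring.
  assert (Ho : 0 < eps / K) by now apply Rdiv_lt_0_compat.
  destruct (continuous_uniformly_square f x y l _ Hf Ho) as (d & Hd & Unif).
  destruct (archimed_cor1 (d / l)) as ([|N] & Hn & Pos); [now apply Rdiv_lt_0_compat|lia|].
  set (n := INR (S N)) in *. assert (HN : 0 < n) by now apply lt_0_INR.
  set (h := (l / n)%R). assert (Hh : 0 < h) by now apply Rdiv_lt_0_compat.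
  assert (Hhd : h < d) by (apply Rlt_div_r in Hn; [unfold h, Rdiv; lra|exact Hl]).
  assert (El : (n * h = l)%R) by (unfold h; field; lra).
  destruct (Cover (S N) Pos) as [p Hp]. rewrite <- El. unfold n.
  eapply Rle_trans; [apply (square_int_cover_le f T x y h (rho / n) (eps / K) N (m * S N) p)|];
    auto; try lra.
  - apply Rle_div_r; lra.
  - fold n. rewrite El. intros w w' Hw Hw' Dx Dy. apply Unif; auto; lra.
  - intros z Tz. destruct (Hp z Tz) as (k & Hk & Near). exists k. split; [lia|exact Near].
  - replace (2 * (h + rho / n) / h + 1)%R with Q by (unfold Q, h; field; lra).
    assert (Hcount : INR (S (m * S N)) <= (INR m + 1) * n).
    { rewrite S_INR, mult_INR. fold n. assert (1 <= n) by (apply (le_INR 1); lia). lra. }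
    apply Rle_trans with ((INR m + 1) * n * (4 * h * (eps / K) * Q ^ 2))%R.
    + apply Rmult_le_compat_r; [|exact Hcount]. apply Rmult_le_pos; [apply Rmult_le_pos; lra|nra].
    + right. transitivity (4 * (n * h) * (INR m + 1) * Q ^ 2 * (eps / K))%R; [ring|].
      rewrite El. fold K. field. lra.
Qed.

Definition slope (f : C -> C) (z0 D w : C) : C :=
  if excluded_middle_informative (w = z0) then D else (f w - f z0) / (w - z0).

Lemma slope_at (f : C -> C) (z0 D : C) : slope f z0 D z0 = D.
Proof. unfold slope. now destruct excluded_middle_informative. Qed.

Lemma slope_neq (f : C -> C) (z0 D w : C) : w <> z0 -> slope f z0 D w = (f w - f z0) / (w - z0).
Proof. intros N. unfold slope. now destruct excluded_middle_informative. Qed.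

Lemma slope_neq_locally (f : C -> C) (z0 D z : C) : z <> z0 ->
  @locally C_UniformSpace z (fun w => (f w - f z0) / (w - z0) = slope f z0 D w).
Proof.
  intros N. apply locally_Cmod. exists (Cmod (z - z0)). split; [now apply Cmod_minus_gt_0|].
  intros w Hw. symmetry. apply slope_neq. intros ->. rewrite Cmod_minus_sym in Hw. lra.
Qed.

Lemma slope_continuous (f : C -> C) (z0 D : C) : continuous_map f -> is_derive_CC f z0 D ->
  continuous_map (slope f z0 D).
Proof.
  intros Hf HD z. destruct (classic (z = z0)) as [->|N].
  - apply continuous_CC_iff. intros eps He. rewrite slope_at.
    assert (He2 : 0 < eps / 2) by lra.
    destruct (proj1 (is_derive_CC_iff _ _ _) HD _ He2) as (d & Hd & Near).
    exists d. split; [exact Hd|]. intros w Hw.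
    destruct (classic (w = z0)) as [->|Nw]; [now rewrite slope_at, Cmod_minus_diag|].
    rewrite slope_neq by exact Nw. pose proof (Cmod_minus_gt_0 _ _ Nw) as Pos.
    replace ((f w - f z0) / (w - z0) - D) with ((f w - f z0 - (w - z0) * D) / (w - z0))
      by (field; now apply Cminus_eq_contra).
    eapply Rle_lt_trans; [apply (Cmod_div_le _ _ _ _ Pos (Rle_refl _) (Near w Hw))|].
    unfold Rdiv. rewrite Rmult_assoc, Rinv_r by lra. lra.
  - apply (continuous_ext_loc _ _ _ (slope_neq_locally f z0 D z N)).
    continuity_C. now apply Cminus_eq_contra.
Qed.

Lemma slope_derive (f : C -> C) (z0 D z Dz : C) : z <> z0 -> is_derive_CC f z Dz ->
  exists D', is_derive_CC (slope f z0 D) z D'.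
Proof.
  intros N HD. eexists. apply (is_derive_CC_ext_loc _ _ _ _ (slope_neq_locally f z0 D z N)).
  apply (is_derive_CC_mult (fun w => f w - f z0) (fun w => / (w - z0))).
  - apply is_derive_CC_minus_const, HD.
  - apply (is_derive_CC_inv (fun w => w - z0)); [|now apply Cminus_eq_contra].
    apply is_derive_CC_minus_const, is_derive_CC_id.
Qed.

Section Liouville.
Variables (h : C -> C) (S : C -> Prop).
Hypothesis h_continuous : continuous_map h.
Hypothesis S_thin : thin S.
Hypothesis h_holo : forall z, ~ S z -> exists D, is_derive_CC h z D.

(* The quotient [(h w - h z0) / (w - z0)] has zero integral along every square. *)
Lemma cauchy_formula_square (z0 : C) (r : R) : ~ S z0 -> 0 < r ->
  rect_int (fun w => h w * / (w - z0)) (Re z0 - r) (Re z0 + r) (Im z0 - r) (Im z0 + r) =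
  C2PIi * h z0.
Proof.
  intros Off Hr. destruct (h_holo z0 Off) as [D HD]. set (k := fun w => / (w - z0)).
  set (x1 := (Re z0 - r)%R). set (x2 := (Re z0 + r)%R).
  set (y1 := (Im z0 - r)%R). set (y2 := (Im z0 + r)%R).
  assert (Nh : forall x y : R, y = y1 \/ y = y2 -> (x, y) <> z0).
  { intros x y Hy E. apply (f_equal Im) in E. unfold y1, y2 in Hy. unfold Im at 1 in E.
    simpl in E. destruct Hy; lra. }
  assert (Nv : forall x y : R, x = x1 \/ x = x2 -> (x, y) <> z0).
  { intros x y Hx E. apply (f_equal Re) in E. unfold x1, x2 in Hx. unfold Re at 1 in E.
    simpl in E. destruct Hx; lra. }
  assert (Ck : edges_continuous k x1 x2 y1 y2).
  { unfold k. repeat split; continuity_C; apply Cminus_eq_contra; auto. }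
  assert (Zero : rect_int (slope h z0 D) x1 x2 y1 y2 = 0).
  { unfold x2, y2. replace (Re z0 + r)%R with (x1 + 2 * r)%R by (unfold x1; ring).
    replace (Im z0 + r)%R with (y1 + 2 * r)%R by (unfold y1; ring).
    apply (square_int_thin _ (fun z => S z \/ z = z0)).
    - now apply slope_continuous.
    - now apply thin_add_point.
    - lra.
    - intros w Hw. destruct (h_holo w) as [Dw HDw]; [tauto|].
      apply (slope_derive h z0 D w Dw); [tauto|exact HDw]. }
  assert (Eq : rect_int (slope h z0 D) x1 x2 y1 y2 =
    rect_int (fun w => h w * k w - h z0 * k w) x1 x2 y1 y2).
  { unfold rect_int. f_equal; [|f_equal]; apply CInt_ext; intros u;
      rewrite !slope_neq by auto; unfold k, Cdiv; ring. }
  rewrite rect_int_minus, rect_int_scal in Eq.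
  - rewrite Zero, (rect_int_inv z0 r Hr : rect_int k x1 x2 y1 y2 = C2PIi) in Eq.
    apply Ceq_minus. rewrite (Cmult_comm C2PIi). now symmetry.
  - exact Ck.
  - destruct Ck as [[? ?] [? ?]]. repeat split; continuity_C.
  - destruct Ck as [[? ?] [? ?]]. repeat split; continuity_C.
Qed.

Lemma liouville_thin : vanishes_at_infinity (fun _ => True) h -> forall z0, ~ S z0 -> h z0 = 0.
Proof.
  intros Hinf z0 Off. apply Ceq_of_Cmod_le. intros eps He.
  replace (h z0 - 0) with (h z0) by ring. assert (He2 : 0 < eps / 2) by lra.
  destruct (Hinf _ He2) as [M HM]. set (r := (Rabs M + Cmod z0 + 1)%R).
  pose proof (Rabs_pos M). pose proof (Cmod_ge_0 z0). assert (Hr : 0 < r) by (unfold r; lra).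
  assert (Far : forall w, r <= Cmod (w - z0) ->
    w - z0 <> 0 /\ Cmod (h w * / (w - z0)) <= eps / 2 / r).
  { intros w Hw. split; [apply Cmod_gt_0; lra|].
    apply (Cmod_div_le (h w) (w - z0)); [exact Hr|exact Hw|]. left. apply HM; [exact I|].
    pose proof (Cmod_minus_le w z0). pose proof (Rle_abs M). unfold r in Hw. lra. }
  assert (Fh : forall x y : R, Rabs (y - Im z0) = r -> r <= Cmod ((x, y) - z0)).
  { intros x y <-. apply (im_le_Cmod ((x, y) - z0)). }
  assert (Fv : forall x y : R, Rabs (x - Re z0) = r -> r <= Cmod ((x, y) - z0)).
  { intros x y <-. apply (re_le_Cmod ((x, y) - z0)). }
  assert (Ab : forall c : R, Rabs (c - r - c) = r /\ Rabs (c + r - c) = r).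
  { intros c. split; [rewrite Rabs_left|rewrite Rabs_pos_eq]; lra. }
  assert (B : Cmod (C2PIi * h z0) <= 2 * PI * eps).
  { rewrite <- (cauchy_formula_square z0 r Off Hr).
    eapply Rle_trans; [apply (Cmod_rect_int_le _ _ _ _ _ (eps / 2 / r)); try lra|].
    - repeat split; continuity_C; apply Far; (apply Fh, Ab || apply Fv, Ab).
    - intros x _. split; apply Far, Fh, Ab.
    - intros y _. split; apply Far, Fv, Ab.
    - replace ((Re z0 + r - (Re z0 - r) + (Im z0 + r - (Im z0 - r))) * (2 * (eps / 2 / r)))%R
        with (4 * eps)%R by (field; lra).
      pose proof PI_gt_3. nra. }
  rewrite Cmod_mult, Cmod_C2PIi in B. pose proof PI_gt_3.
  apply (Rmult_le_reg_l (2 * PI)); lra.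
Qed.

End Liouville.

(** * Functions on the loop *)

Section LoopFunctions.
Variable gam : R -> C.

Definition conjugate_on_loop (f g : C -> C) : Prop := forall z, onG gam z -> f z = Cconj (g z).

Lemma conjugate_on_loop_sym (f g : C -> C) : conjugate_on_loop f g -> conjugate_on_loop g f.
Proof. intros Hfg z Gz. now rewrite (Hfg z Gz), Cconj_conj. Qed.

Lemma nonconst_conjugate (f g : C -> C) : conjugate_on_loop f g -> nonconst gam f -> nonconst gam g.
Proof.
  intros Hfg (z & w & Gz & Gw & N). exists z, w. split; [exact Gz|split; [exact Gw|]].
  intros E. apply N. now rewrite !Hfg, E.
Qed.

Lemma not_nonconst_eq (f : C -> C) : ~ nonconst gam f -> forall z, onG gam z -> f z = f (gam 0%R).
Proof.
  intros Const z Gz. apply NNPP. intros N. apply Const. exists z, (gam 0%R).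
  split; [exact Gz|split; [now exists 0%R|exact N]].
Qed.

Lemma Cconj_0 : Cconj 0 = 0.
Proof. apply injective_projections; simpl; ring. Qed.

Lemma nonconst_neq_0 (f : C -> C) : nonconst gam f -> exists z, onG gam z /\ f z <> 0.
Proof.
  intros (z & w & Gz & Gw & N). destruct (classic (f z = 0)) as [E|]; [|exists z; now split].
  exists w. split; [exact Gw|]. intros Ew. apply N. now rewrite E, Ew.
Qed.

End LoopFunctions.

(** * The two sides of the loop *)

Section Hilbert.
Variable gam : R -> C.
Hypothesis gam_regular : regular_loop gam.
Hypothesis gam_pos : pos_oriented gam.
Variable sigma : R.
Hypothesis sigma_range : 0 < sigma < 1.
Notation npt := (normal_pt gam).

Let gam_continuous : continuous_map gam := loop_continuous gam gam_regular.
Let gam_periodic : periodic gam := loop_periodic gam gam_regular.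

Lemma extD_iff (z : C) : extD gam z <-> ~ onG gam z /\ wind gam z = 0.
Proof.
  split; [intros Ez; split; [apply Ez|now apply wind_extD]|]. intros [Off W].
  apply NNPP. intros Nz. rewrite gam_pos in W by now split. now apply C1_nz.
Qed.

Lemma intD_iff (z : C) : intD gam z <-> ~ onG gam z /\ wind gam z = 1.
Proof.
  split; [intros Iz; split; [apply Iz|now apply gam_pos]|]. intros [Off W].
  split; [exact Off|]. intros Ez. rewrite wind_extD in W by assumption. now apply C1_nz.
Qed.

Lemma not_intD_extD (z : C) : ~ onG gam z -> ~ intD gam z -> extD gam z.
Proof. intros Off Nz. apply NNPP. intros Ez. apply Nz. now split. Qed.

Lemma locally_not_onG (z : C) : ~ onG gam z -> @locally C_UniformSpace z (fun w => ~ onG gam w).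
Proof.
  intros Off. destruct (not_onG_dist gam gam_continuous gam_periodic z Off) as (d & Hd & D).
  apply locally_Cmod. exists d. split; [exact Hd|]. intros w Hw.
  apply (dist_not_onG gam w (d - Cmod (w - z))); [lra|]. now apply dist_perturb.
Qed.

Lemma exists_extD_radius : exists M, forall z, M < Cmod z -> extD gam z.
Proof.
  destruct (cauchy_vanishes gam gam_regular (fun _ => 1) ltac:(continuity_C) 1 Rlt_0_1) as [M HM].
  destruct (periodic_bounded gam gam_continuous gam_periodic) as (G & _ & BG).
  exists (Rmax M G). intros z Hz. apply Rmax_Rlt in Hz as [HzM HzG].
  apply not_intD_extD.
  - intros [t <-]. specialize (BG t). lra.
  - intros Iz. apply intD_iff in Iz as [_ W]. specialize (HM z I HzM).
    rewrite <- wind_eq_cauchy, W, Cmod_1 in HM. lra.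
Qed.

Lemma collar_normal_filterlim (U : C -> Prop) (e kappa L c tau0 t : R) :
  collar gam U e kappa L c tau0 ->
  filterlim (fun tau => npt t (e * tau)) (at_right 0) (within U (locally (gam t))).
Proof.
  intros HU P HP.
  assert (Cn : @continuous R_UniformSpace C_UniformSpace (fun tau => npt t (e * tau)) 0).
  { unfold normal_pt. continuity_C. }
  assert (HP' : locally 0%R (fun tau => U (npt t (e * tau)) -> P (npt t (e * tau)))).
  { refine (Cn (fun w => U w -> P w) _). now replace (npt t (e * 0)) with (gam t)
      by (unfold normal_pt; rewrite Rmult_0_r; ring). }
  assert (Near : locally 0%R (fun tau => Rabs (tau - 0) < tau0)).
  { exists (mkposreal _ (proj1 (collar_width HU))). intros tau Htau. exact Htau. }
  refine (filter_imp _ _ _ (filter_and _ _ HP' Near)). intros tau [HPtau Htau] Pos.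
  rewrite Rminus_0_r, Rabs_pos_eq in Htau by lra.
  apply HPtau, (collar_normal HU). lra.
Qed.

Definition side (U : C -> Prop) : Prop := U = intD gam \/ U = extD gam.

Lemma exists_side_collar (U : C -> Prop) : side U -> exists e kappa L c tau0,
  collar gam U e kappa L c tau0.
Proof.
  destruct (exists_collars gam gam_regular gam_pos) as (L & c & tau0 & Ci & Ce).
  intros [-> | ->]; eauto 6.
Qed.

Lemma side_not_onG (U : C -> Prop) (z : C) : side U -> U z -> ~ onG gam z.
Proof. now intros [-> | ->] [Off _]. Qed.

Lemma side_open (U : C -> Prop) (z : C) : side U -> U z -> @locally C_UniformSpace z U.
Proof.
  intros HU Hz. pose proof (side_not_onG U z HU Hz) as Off.
  refine (filter_imp _ _ _ (filter_and _ _ (locally_not_onG z Off)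
    (wind_locally_constant gam gam_regular z Off))).
  intros w [Ow Ww]. destruct HU as [-> | ->].
  - apply intD_iff in Hz as [_ W]. apply intD_iff. now rewrite Ww.
  - apply extD_iff in Hz as [_ W]. apply extD_iff. now rewrite Ww.
Qed.

Lemma onG_clos_side (U : C -> Prop) (z : C) : side U -> onG gam z -> clos U z.
Proof.
  intros HU [t <-] eps He. destruct (exists_side_collar U HU) as (e & kappa & L & c & tau0 & Col).
  assert (Ev : within U (@locally C_UniformSpace (gam t)) (fun w => U w /\ Cmod (w - gam t) < eps)).
  { apply locally_Cmod. exists eps. auto. }
  apply (collar_normal_filterlim U e kappa L c tau0 t Col) in Ev.
  destruct (filter_ex (F := at_right 0) _ Ev) as [tau Htau]. eauto.
Qed.

(** * Gluing along the loop *)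

Definition glue (a b : C -> C) (z : C) : C :=
  if excluded_middle_informative (intD gam z) then a z else b z.

Lemma glue_intD (a b : C -> C) (z : C) : intD gam z -> glue a b z = a z.
Proof. intros Hz. unfold glue. now destruct excluded_middle_informative. Qed.

Lemma glue_not_intD (a b : C -> C) (z : C) : ~ intD gam z -> glue a b z = b z.
Proof. intros Hz. unfold glue. now destruct excluded_middle_informative. Qed.

Lemma glue_holo (a b : C -> C) : holo (intD gam) a -> holo (extD gam) b ->
  forall z, ~ onG gam z -> exists D, is_derive_CC (glue a b) z D.
Proof.
  intros Ha Hb z Off. destruct (classic (intD gam z)) as [Iz|Nz].
  - destruct (Ha z Iz) as [D HD]. exists D. apply (is_derive_CC_ext_loc a); [|exact HD].
    refine (filter_imp _ _ _ (side_open (intD gam) z (or_introl eq_refl) Iz)).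
    intros w Iw. now rewrite glue_intD.
  - pose proof (not_intD_extD z Off Nz) as Ez.
    destruct (Hb z Ez) as [D HD]. exists D. apply (is_derive_CC_ext_loc b); [|exact HD].
    refine (filter_imp _ _ _ (side_open (extD gam) z (or_intror eq_refl) Ez)).
    intros w Ew. rewrite glue_not_intD; [reflexivity|]. now intros [_ Nw].
Qed.

Lemma glue_continuous (a b : C -> C) : holo (intD gam) a -> holo (extD gam) b ->
  holder sigma (clos (intD gam)) a -> holder sigma (clos (extD gam)) b ->
  (forall z, onG gam z -> a z = b z) -> continuous_map (glue a b).
Proof.
  intros Da Db Ha Hb Hab z. destruct (classic (onG gam z)) as [Gz|Off].
  2:{ destruct (glue_holo a b Da Db z Off) as [D HD]. exact (is_derive_CC_continuous _ _ _ HD). }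
  pose proof (onG_clos_side (intD gam) z (or_introl eq_refl) Gz) as Iz.
  pose proof (onG_clos_side (extD gam) z (or_intror eq_refl) Gz) as Ez.
  pose proof (holder_filterlim sigma _ a z (proj1 sigma_range) Ha Iz) as La.
  pose proof (holder_filterlim sigma _ b z (proj1 sigma_range) Hb Ez) as Lb.
  rewrite filterlim_within_Cmod in La, Lb. apply continuous_CC_iff. intros eps He.
  destruct (La eps He) as (d & Hd & Da'). destruct (Lb eps He) as (d' & Hd' & Db').
  exists (Rmin d d'). split; [now apply Rmin_pos|]. intros w Hw. apply Rmin_Rgt in Hw as [Hw Hw'].
  rewrite (glue_not_intD a b z) by now intros [Nz _].
  destruct (classic (intD gam w)) as [Iw|Nw].
  - rewrite glue_intD, <- Hab by assumption. now apply Da', Hw; apply subset_clos.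
  - rewrite glue_not_intD by exact Nw. apply Db'; [|exact Hw'].
    destruct (classic (onG gam w)) as [Gw|Ow].
    + now apply (onG_clos_side (extD gam)); [right|].
    + now apply subset_clos, not_intD_extD.
Qed.

Lemma glue_eq_0 (a b : C -> C) : holo (intD gam) a -> holo (extD gam) b ->
  holder sigma (clos (intD gam)) a -> holder sigma (clos (extD gam)) b ->
  vanishes_at_infinity (extD gam) b -> (forall z, onG gam z -> a z = b z) ->
  forall z, intD gam z -> a z = 0.
Proof.
  intros Da Db Ha Hb Hinf Hab z Iz. rewrite <- (glue_intD a b) by exact Iz.
  apply (liouville_thin (glue a b) (onG gam)).
  - now apply glue_continuous.
  - now apply thin_loop.
  - now apply glue_holo.
  - intros eps He. destruct (Hinf eps He) as [M HM]. destruct exists_extD_radius as [M' HM'].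
    exists (Rmax M M'). intros w _ Hw. apply Rmax_Rlt in Hw as [Hw Hw'].
    pose proof (HM' w Hw') as Ew. rewrite glue_not_intD by now intros [_ Nw]. now apply HM.
  - apply Iz.
Qed.

(** * The Hilbert operator *)

Definition cauchy_ext (U : C -> Prop) (F : C -> C) : C -> C := lim_within (cauchy gam F) U.

Section BoundaryValues.
Variable F : C -> C.
Hypothesis F_holder : Lambda sigma gam F.

Lemma holder_cauchy_side (U : C -> Prop) : side U -> holder sigma U (cauchy gam F).
Proof.
  intros HU. destruct (exists_side_collar U HU) as (e & kappa & L & c & tau0 & Col).
  now apply (holder_cauchy_one_side gam gam_regular sigma sigma_range F F_holder
    U e kappa L c tau0).
Qed.

Lemma cauchy_ext_holder (U : C -> Prop) : side U -> holder sigma (clos U) (cauchy_ext U F).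
Proof. intros HU. apply holder_lim_within; [lra|]. now apply holder_cauchy_side. Qed.

Lemma cauchy_ext_eq (U : C -> Prop) (z : C) : side U -> U z -> cauchy_ext U F z = cauchy gam F z.
Proof.
  intros HU Hz. apply (lim_within_interior U sigma); [lra|now apply holder_cauchy_side|exact Hz].
Qed.

Lemma cauchy_ext_holo (U : C -> Prop) : side U -> holo U (cauchy_ext U F).
Proof.
  intros HU z Hz. eexists. apply (is_derive_CC_ext_loc (cauchy gam F)).
  - refine (filter_imp _ _ _ (side_open U z HU Hz)). intros w Hw. symmetry. now apply cauchy_ext_eq.
  - apply (is_derive_cauchy gam gam_regular).
    + now apply (Lambda_continuous gam gam_regular sigma).
    + now apply (side_not_onG U).
Qed.

Lemma cauchy_ext_vanishes : vanishes_at_infinity (extD gam) (cauchy_ext (extD gam) F).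
Proof.
  intros eps He. destruct (cauchy_vanishes gam gam_regular F) with (eps := eps) as [M HM].
  - now apply (Lambda_continuous gam gam_regular sigma).
  - exact He.
  - exists M. intros z Ez Hz. rewrite cauchy_ext_eq by (exact Ez || now right). now apply HM.
Qed.

Lemma cauchy_jump_limit (t : R) :
  filterlim (fun tau => cauchy gam F (npt t (1 * tau)) - cauchy gam F (npt t (-1 * tau)))
    (at_right 0) (@locally C_UniformSpace (F (gam t))).
Proof.
  destruct (exists_collars gam gam_regular gam_pos) as (L & c & tau0 & Col & Col').
  pose proof (collar_width Col) as Width.
  pose proof (collar_speed_ge_0 _ _ _ _ _ _ _ Col) as HL.
  destruct (cauchy_increment_le gam gam_regular sigma sigma_range F F_holder c (2 * L))
    as (B & HB & Inc); [exact (collar_const_pos Col)|lra|].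
  apply (filterlim_Cmod (at_right 0)). intros eps He.
  destruct (Rpower_small sigma B eps (proj1 sigma_range) He) as (r & Hr & Small).
  assert (Hm : 0 < Rmin r tau0) by (apply Rmin_pos; lra).
  exists (mkposreal _ Hm). intros tau Htau Pos. change (Rabs (tau - 0) < Rmin r tau0) in Htau.
  rewrite Rminus_0_r, Rabs_pos_eq in Htau by lra. apply Rmin_Rgt in Htau as [Htr Ht0].
  assert (Htau : 0 < tau <= tau0) by lra.
  pose proof (collar_normal Col t tau Htau) as Iz.
  pose proof (collar_normal Col' t tau Htau) as Ew.
  eapply Rle_lt_trans; [|apply (Small tau); lra].
  pose proof (Inc t tau tau _ _ ltac:(lra) ltac:(lra)
    (collar_depth Col t tau Htau) (collar_depth Col' t tau Htau)) as J.
  rewrite (gam_pos _ Iz), (wind_extD gam gam_regular _ Ew) in J.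
  replace (F (gam t) * (1 - 0)) with (F (gam t)) in J by ring. apply J.
  rewrite Cmod_normal_pt_minus. replace (1 * tau - -1 * tau)%R with (2 * tau)%R by ring.
  rewrite Rabs_pos_eq by lra. pose proof (collar_speed Col t). nra.
Qed.

Lemma cauchy_ext_jump (z : C) : onG gam z ->
  cauchy_ext (intD gam) F z - cauchy_ext (extD gam) F z = F z.
Proof.
  intros Gz. destruct Gz as [t <-].
  destruct (exists_collars gam gam_regular gam_pos) as (L & c & tau0 & Col & Col').
  assert (Lim : forall U e kappa, side U -> collar gam U e kappa L c tau0 ->
    filterlim (fun tau => cauchy gam F (npt t (e * tau))) (at_right 0)
      (@locally C_UniformSpace (cauchy_ext U F (gam t)))).
  { intros U e kappa HU HC. refine (filterlim_comp _ _ _ _ _ _ _ _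
      (collar_normal_filterlim U e kappa L c tau0 t HC) _).
    apply (lim_within_holder U sigma); [lra|now apply holder_cauchy_side|].
    apply onG_clos_side; [exact HU|now exists t]. }
  pose proof (Lim _ _ _ (or_introl eq_refl) Col) as Li.
  pose proof (Lim _ _ _ (or_intror eq_refl) Col') as Le.
  apply (filterlim_locally_unique (V := C_R_NormedModule) (F := at_right 0)
    (fun tau => cauchy gam F (npt t (1 * tau)) - cauchy gam F (npt t (-1 * tau))));
    [|apply cauchy_jump_limit].
  apply (filterlim_comp_2 (H := locally (- cauchy_ext (extD gam) F (gam t))) _ _ Cplus Li).
  - exact (filterlim_comp _ _ _ _ _ _ _ _ Le (filterlim_opp (V := C_R_NormedModule) _)).
  - exact (filterlim_plus (V := C_R_NormedModule) _ _).
Qed.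

End BoundaryValues.

Lemma inA_Lambda (f : C -> C) : inA sigma gam f -> Lambda sigma gam f.
Proof.
  intros (a & Ha & _ & Ea). apply (holder_ext sigma _ a f Ea).
  apply (holder_subset sigma (clos (intD gam))); [|exact Ha].
  intros z Gz. apply onG_clos_side; [now left|exact Gz].
Qed.

Lemma inA'_Lambda (g : C -> C) : inA' sigma gam g -> Lambda sigma gam g.
Proof.
  intros (b & Hb & _ & _ & Eb). apply (holder_ext sigma _ b g Eb).
  apply (holder_subset sigma (clos (extD gam))); [|exact Hb].
  intros z Gz. apply onG_clos_side; [now right|exact Gz].
Qed.

Lemma inA_ext (f f' : C -> C) : (forall z, onG gam z -> f z = f' z) ->
  inA sigma gam f -> inA sigma gam f'.
Proof.
  intros E (a & Ha & Da & Ea). exists a. split; [exact Ha|split; [exact Da|]].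
  intros z Gz. now rewrite Ea, E.
Qed.

Lemma inA'_ext (g g' : C -> C) : (forall z, onG gam z -> g z = g' z) ->
  inA' sigma gam g -> inA' sigma gam g'.
Proof.
  intros E (b & Hb & Db & Ib & Eb). exists b.
  split; [exact Hb|split; [exact Db|split; [exact Ib|]]]. intros z Gz. now rewrite Eb, E.
Qed.

Lemma inA_const (c : C) : inA sigma gam (fun _ => c).
Proof.
  exists (fun _ => c). split; [apply holder_const|split; [|reflexivity]].
  intros z _. apply ex_derive_const.
Qed.

Lemma inA'_0 : inA' sigma gam (fun _ => 0).
Proof.
  exists (fun _ => 0). split; [apply holder_const|split; [|split; [|reflexivity]]].
  - intros z _. apply ex_derive_const.
  - intros eps He. exists 0%R. intros z _ _. now rewrite Cmod_0.
Qed.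

Lemma inA_Hop (F : C -> C) : Lambda sigma gam F -> inA sigma gam (Hop gam F).
Proof.
  intros HF. exists (cauchy_ext (intD gam) F). split; [|split; [|reflexivity]].
  - apply cauchy_ext_holder; [exact HF|now left].
  - apply cauchy_ext_holo; [exact HF|now left].
Qed.

Lemma inA'_minus_Hop (F : C -> C) : Lambda sigma gam F ->
  inA' sigma gam (fun z => F z - Hop gam F z).
Proof.
  intros HF. exists (fun z => - cauchy_ext (extD gam) F z). split; [|split; [|split]].
  - apply holder_opp, cauchy_ext_holder; [exact HF|now right].
  - intros z Ez. apply (ex_derive_opp (K := C_AbsRing) (V := C_NormedModule)).
    apply cauchy_ext_holo; [exact HF|now right|exact Ez].
  - intros eps He. destruct (cauchy_ext_vanishes F HF eps He) as [M HM]. exists M. intros z.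
    rewrite Cmod_opp. apply HM.
  - intros z Gz. change (Hop gam F z) with (cauchy_ext (intD gam) F z).
    rewrite <- (cauchy_ext_jump F HF z Gz) at 1. ring.
Qed.

(* If [a] and [b] extend [f] and [g], then the Cauchy integral of [F] minus [a] inside and
   the Cauchy integral of [F] plus [b] outside agree on the loop. *)
Lemma Hop_decomposition (F f g : C -> C) : inA sigma gam f -> inA' sigma gam g ->
  (forall z, onG gam z -> F z = f z + g z) -> forall z, onG gam z -> Hop gam F z = f z.
Proof.
  intros Hf Hg E z Gz.
  assert (HF : Lambda sigma gam F).
  { apply (holder_ext sigma _ (fun z => f z + g z)); [now intros; rewrite E|].
    apply holder_plus; [now apply inA_Lambda|now apply inA'_Lambda]. }
  destruct Hf as (a & Ha & Da & Ea). destruct Hg as (b & Hb & Db & Ib & Eb).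
  pose proof (onG_clos_side (intD gam) z (or_introl eq_refl) Gz) as Cz.
  rewrite <- (Ea z Gz). apply (lim_within_eq (intD gam) sigma); [lra|exact Ha| |exact Cz].
  intros w Iw. rewrite <- (cauchy_ext_eq F HF (intD gam)) by (exact Iw || now left).
  apply Ceq_minus.
  apply (glue_eq_0 (fun w => cauchy_ext (intD gam) F w - a w)
    (fun w => cauchy_ext (extD gam) F w + b w)); [..|exact Iw].
  - intros u Iu. apply (ex_derive_minus (K := C_AbsRing) (V := C_NormedModule)); [|now apply Da].
    apply cauchy_ext_holo; [exact HF|now left|exact Iu].
  - intros u Eu. apply (ex_derive_plus (K := C_AbsRing) (V := C_NormedModule)); [|now apply Db].
    apply cauchy_ext_holo; [exact HF|now right|exact Eu].
  - apply holder_plus; [apply cauchy_ext_holder; [exact HF|now left]|now apply holder_opp].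
  - apply holder_plus; [apply cauchy_ext_holder; [exact HF|now right]|exact Hb].
  - intros eps He. destruct (cauchy_ext_vanishes F HF (eps / 2)%R ltac:(lra)) as [M HM].
    destruct (Ib (eps / 2)%R ltac:(lra)) as [M' HM'].
    exists (Rmax M M'). intros u Eu Hu. apply Rmax_Rlt in Hu as [Hu Hu'].
    specialize (HM u Eu Hu). specialize (HM' u Eu Hu').
    eapply Rle_lt_trans; [apply Cmod_triangle|]. lra.
  - intros u Gu. pose proof (cauchy_ext_jump F HF u Gu) as J.
    rewrite (E u Gu), <- (Ea u Gu), <- (Eb u Gu) in J.
    replace (cauchy_ext (intD gam) F u) with
      (cauchy_ext (intD gam) F u - cauchy_ext (extD gam) F u + cauchy_ext (extD gam) F u) by ring.
    rewrite J. ring.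
Qed.

Lemma Hop_inA (F f : C -> C) : inA sigma gam f -> (forall z, onG gam z -> F z = f z) ->
  forall z, onG gam z -> Hop gam F z = f z.
Proof.
  intros Hf E. apply (Hop_decomposition F f (fun _ => 0) Hf inA'_0).
  intros z Gz. rewrite E by exact Gz. ring.
Qed.

Lemma Hop_inA' (F g : C -> C) : inA' sigma gam g -> (forall z, onG gam z -> F z = g z) ->
  forall z, onG gam z -> Hop gam F z = 0.
Proof.
  intros Hg E. apply (Hop_decomposition F (fun _ => 0) g (inA_const 0) Hg).
  intros z Gz. rewrite E by exact Gz. ring.
Qed.

Lemma inA'_const_eq_0 (g : C -> C) (c : C) : inA' sigma gam g ->
  (forall z, onG gam z -> g z = c) -> c = 0.
Proof.
  intros Hg Ec. assert (G0 : onG gam (gam 0%R)) by now exists 0%R.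
  rewrite <- (Hop_inA (fun _ => c) (fun _ => c) (inA_const c) (fun z _ => eq_refl) (gam 0%R) G0).
  apply (Hop_inA' _ g Hg); [|exact G0]. intros z Gz. symmetry. auto.
Qed.

(** * Fixed points of [Piop] *)

Lemma Piop_conjugate_pair (f g : C -> C) : inA sigma gam f -> inA' sigma gam g ->
  conjugate_on_loop gam f g ->
  (forall z, onG gam z -> Piop gam f z = f z) /\ (forall z, onG gam z -> Piop gam g z = g z).
Proof.
  intros Hf Hg Hfg. pose proof (conjugate_on_loop_sym gam f g Hfg) as Hgf.
  assert (Ef : forall z, onG gam z -> Cop f z = g z) by (intros z Gz; unfold Cop; now rewrite Hgf).
  assert (Eg : forall z, onG gam z -> Cop g z = f z) by (intros z Gz; unfold Cop; now rewrite Hfg).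
  split; intros z Gz; unfold Piop.
  - rewrite (Hop_inA f f Hf) by auto. unfold Cop at 1.
    rewrite (Hop_inA' (Cop f) g Hg Ef z Gz), Cconj_0. ring.
  - rewrite (Hop_inA' g g Hg) by auto. unfold Cop at 1.
    rewrite (Hop_inA (Cop g) f Hf Eg z Gz), (Hgf z Gz). ring.
Qed.

Lemma fixed_point_conjugate (F : C -> C) : (forall z, onG gam z -> Piop gam F z = F z) ->
  conjugate_on_loop gam (Hop gam (Cop F)) (fun z => F z - Hop gam F z).
Proof.
  intros Fix. apply (conjugate_on_loop_sym gam). intros z Gz.
  rewrite <- (Fix z Gz) at 1. unfold Piop, Cop at 1. ring.
Qed.

(* When [H (conj F)] is constant, [F - H F] is a constant of [A'], hence zero, so that
   [F] itself belongs to [A] and [conj F] to [A']. *)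
Lemma fixed_point_degenerate (F : C -> C) : Lambda sigma gam F ->
  (forall z, onG gam z -> Piop gam F z = F z) -> ~ nonconst gam (Hop gam (Cop F)) ->
  inA sigma gam F /\ inA' sigma gam (Cop F).
Proof.
  intros HF Fix Const.
  assert (HCF : Lambda sigma gam (Cop F)) by exact (holder_conj sigma _ F HF).
  pose proof (fixed_point_conjugate F Fix) as Hfg.
  pose proof (conjugate_on_loop_sym gam _ _ Hfg) as Hgf.
  assert (Zero : forall z, onG gam z -> F z - Hop gam F z = 0).
  { intros z Gz. apply (inA'_const_eq_0 (fun z => F z - Hop gam F z)).
    - now apply inA'_minus_Hop.
    - intros w Gw. rewrite (Hgf w Gw), (Hgf z Gz). f_equal.
      now rewrite (not_nonconst_eq gam _ Const w Gw), (not_nonconst_eq gam _ Const z Gz). }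
  split.
  - apply (inA_ext (Hop gam F)); [|now apply inA_Hop].
    intros z Gz. symmetry. now apply Ceq_minus, Zero.
  - apply (inA'_ext (fun z => Cop F z - Hop gam (Cop F) z)); [|now apply inA'_minus_Hop].
    intros z Gz. rewrite (Hfg z Gz), (Zero z Gz), Cconj_0. ring.
Qed.

Lemma fixed_point_gives_pair (F : C -> C) : Lambda sigma gam F ->
  (forall z, onG gam z -> Piop gam F z = F z) -> (exists z, onG gam z /\ F z <> 0) ->
  exists f g, inA sigma gam f /\ inA' sigma gam g /\ nonconst gam f /\ conjugate_on_loop gam f g.
Proof.
  intros HF Fix (z & Gz & Nz). destruct (classic (nonconst gam (Hop gam (Cop F)))) as [N|Const].
  - exists (Hop gam (Cop F)), (fun z => F z - Hop gam F z).
    split; [|split; [now apply inA'_minus_Hop|split; [exact N|now apply fixed_point_conjugate]]].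
    apply inA_Hop. exact (holder_conj sigma _ F HF).
  - destruct (fixed_point_degenerate F HF Fix Const) as [HA HA'].
    assert (Conj : conjugate_on_loop gam F (Cop F)) by (intros w _; symmetry; apply Cconj_conj).
    exists F, (Cop F). split; [exact HA|split; [exact HA'|split; [|exact Conj]]].
    apply NNPP. intros ConstF. apply Nz. rewrite (Conj z Gz), <- Cconj_0. f_equal.
    apply (inA'_const_eq_0 (Cop F) _ HA'). intros w Gw. unfold Cop.
    now rewrite (not_nonconst_eq gam F ConstF w Gw), (not_nonconst_eq gam F ConstF z Gz).
Qed.

End Hilbert.

Theorem theorem1p20 (sigma : R) (gam : R -> C) :
  0 < sigma < 1 ->
  analytic_jordan gam ->
  pos_oriented gam ->
  ((exists F : C -> C, Lambda sigma gam F /\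
      (forall z, onG gam z -> Piop gam F z = F z) /\
      (exists z, onG gam z /\ F z <> 0))
   <->
   (exists f g : C -> C, inA sigma gam f /\ inA' sigma gam g /\
      nonconst gam f /\ nonconst gam g /\
      (forall z, onG gam z -> f z = Cconj (g z))))
  /\
  (forall f g : C -> C, inA sigma gam f -> inA' sigma gam g ->
      nonconst gam f -> nonconst gam g ->
      (forall z, onG gam z -> f z = Cconj (g z)) ->
      (forall z, onG gam z -> Piop gam f z = f z) /\
      (forall z, onG gam z -> Piop gam g z = g z)).
Proof.
  intros Hsigma Hjordan Hpos. pose proof (analytic_jordan_regular gam Hjordan) as Hreg.
  pose proof (Piop_conjugate_pair gam Hreg Hpos sigma Hsigma) as Pair.
  split; [split|].
  - intros (F & HF & Fix & Nz).
    destruct (fixed_point_gives_pair gam Hreg Hpos sigma Hsigma F HF Fix Nz)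
      as (f & g & Hf & Hg & Nf & Hfg).
    exists f, g. repeat (split; [assumption|]).
    split; [now apply (nonconst_conjugate gam f g)|exact Hfg].
  - intros (f & g & Hf & Hg & Nf & _ & Hfg). exists f.
    split; [now apply inA_Lambda|].
    split; [exact (proj1 (Pair f g Hf Hg Hfg))|now apply (nonconst_neq_0 gam f)].
  - intros f g Hf Hg _ _ Hfg. exact (Pair f g Hf Hg Hfg).
Qed.
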